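(* Let $p$ be a prime and $n\ge1$. A cyclic subgroup $C\cong\mathbb Z_p$ of $GL(n,\mathbb Z)$ lifts to $\mathrm{Out}\,F_n$ with respect to $\beta:\mathrm{Out}\,F_n\to GL(n,\mathbb Z)$ if and only if the corresponding integral representation of $\mathbb Z_p$ on $\mathbb Z^n$ is standard.
   Context: $F_n$ is the free group of rank $n$, $\mathrm{Out}\,F_n=\mathrm{Aut}\,F_n/\mathrm{Inn}\,F_n$, and $\beta$ is the homomorphism induced by the action on the abelianization $(F_n)_{ab}=\mathbb Z^n$. A subgroup $U\le GL(n,\mathbb Z)$ lifts to $\mathrm{Out}\,F_n$ if there is an injective homomorphism $\iota:U\to\mathrm{Out}\,F_n$ with $\beta\circ\iota=\mathrm{id}_U$. Let $t$ be a generator of $\mathbb Z_p$ and $\lambda$ a primitive $p$-th root of unity. The following $\mathbb Z[\mathbb Z_p]$-lattices are called standard indecomposables: the trivial module $\mathbb Z$; the regular module $\mathbb Z[\mathbb Z_p]$; and the cyclotomic module $\mathbb Z[\lambda]$ on which $t$ acts by multiplication by $\lambda$. An integral representation of $\mathbb Z_p$ on $\mathbb Z^n$ is called standard if, as a $\mathbb Z[\mathbb Z_p]$-module, it is isomorphic to a direct sum of standard indecomposables (i.e. it has no indecomposable summand isomorphic to a non-principal ideal of $\mathbb Z[\lambda]$ with $t$ acting by multiplication by $\lambda$). *)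

(* Defs.v *)
From HB Require Import structures.
From mathcomp Require Import all_boot all_order all_algebra.
Set Implicit Arguments. Unset Strict Implicit. Unset Printing Implicit Defensive.
Import Order.TTheory GRing.Theory Num.Theory.
Local Open Scope ring_scope.

(* A letter (i, b) is x_i if b = false and x_i^{-1} if b = true. *)
Definition letter (n : nat) := ('I_n * bool)%type.
Definition word (n : nat) := seq (letter n).

Definition inv_letter n (x : letter n) : letter n := (x.1, ~~ x.2).
Definition inv_word n (w : word n) : word n := rev (map (@inv_letter n) w).

(* Free reduction: the reduced representative of the element of F_n
   represented by w.  Two words represent the same element of F_n iff
   they have the same reduction. *)
Definition reduce n (w : word n) : word n :=
  foldr (fun x acc => match acc with
                      | y :: t => if y == inv_letter x then t else x :: acc
                      | [::] => [:: x]
                      end) [::] w.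

(* An endomorphism of F_n, given by the images of the generators. *)
Definition endo (n : nat) := 'I_n -> word n.

Definition apply_endo n (f : endo n) (w : word n) : word n :=
  flatten (map (fun x : letter n => if x.2 then inv_word (f x.1) else f x.1) w).

Definition comp_endo n (f g : endo n) : endo n := fun i => apply_endo f (g i).

Definition gen n (i : 'I_n) : word n := [:: (i, false)].

Definition is_aut n (f : endo n) : Prop :=
  exists h : endo n, forall i : 'I_n,
    reduce (apply_endo f (h i)) = gen i /\ reduce (apply_endo h (f i)) = gen i.

(* f and g define the same element of Out F_n = Aut F_n / Inn F_n:
   g = c_w \o f for the inner automorphism c_w : u |-> w^{-1} u w. *)
Definition out_equiv n (f g : endo n) : Prop :=
  exists w : word n, forall i : 'I_n,
    reduce (g i) = reduce (inv_word w ++ f i ++ w).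

(* beta : action on the abelianization Z^n (column vectors):
   column i is the exponent-sum vector of f(x_i). *)
Definition beta n (f : endo n) : 'M[int]_n :=
  \matrix_(j < n, i < n)
     \sum_(x <- f i) (if x.1 == j then (if x.2 then -1 else 1) else 0).

(* A subgroup U of GL(n,Z) (given as a predicate) lifts to Out F_n:
   there is an injective homomorphism iota : U -> Out F_n with
   beta \o iota = id_U.  A map into the quotient Out F_n is represented
   by a choice of representative automorphisms, with the homomorphism
   and injectivity conditions taken modulo Inn F_n. *)
Definition lifts_to_Out n (U : 'M[int]_n -> Prop) : Prop :=
  exists iota : 'M[int]_n -> endo n,
    (forall A, U A -> is_aut (iota A)) /\
    (forall A B, U A -> U B ->
        out_equiv (iota (A *m B)) (comp_endo (iota A) (iota B))) /\
    (forall A, U A -> beta (iota A) = A) /\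
    (forall A B, U A -> U B -> out_equiv (iota A) (iota B) -> A = B).

Definition mxpow n (g : 'M[int]_n) (k : nat) : 'M[int]_n := iter k (mulmx g) 1%:M.

(* the cyclic subgroup generated by g (g has finite order here) *)
Definition cyc_subgroup n (g : 'M[int]_n) : 'M[int]_n -> Prop :=
  fun A => exists k : nat, A = mxpow g k.

Inductive std_kind := Triv | Reg | Cyclo.

Definition kind_size (p : nat) (t : std_kind) : nat :=
  match t with Triv => 1%N | Reg => p | Cyclo => p.-1 end.

(* matrix of the action of the generator t of Z_p on the standard
   indecomposable, in its natural Z-basis:
   - Triv : Z, t acts trivially;
   - Reg  : Z[Z_p] with basis 1, t, ..., t^{p-1}, t . t^j = t^{j+1 mod p};
   - Cyclo: Z[lambda] with basis 1, lambda, ..., lambda^{p-2},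
            lambda^{p-1} = -(1 + ... + lambda^{p-2}). *)
Definition std_block (p : nat) (t : std_kind) : 'M[int]_(kind_size p t) :=
  match t return 'M[int]_(kind_size p t) with
  | Triv => 1%:M
  | Reg => \matrix_(i < p, j < p) ((i == (j.+1 %% p)%N :> nat)%:R : int)
  | Cyclo => \matrix_(i < p.-1, j < p.-1)
               (if (j == p.-2 :> nat) then -1 else ((i == j.+1 :> nat)%:R : int))
  end.

(* The Z[Z_p]-lattice Z^n with generator acting by g is standard: it is
   isomorphic (via P in GL(n,Z)) to a direct sum of standard
   indecomposables. *)
Definition standard_rep (p n : nat) (g : 'M[int]_n) : Prop :=
  exists (k : nat) (t : 'I_k -> std_kind)
         (e : (\sum_(i < k) kind_size p (t i))%N = n)
         (P : 'M[int]_n),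
    P \in unitmx /\
    P *m g = castmx (e, e) (\mxdiag_(i < k) std_block p (t i)) *m P.

(* Main.v *)
(** If the representation is standard, every block lifts to an automorphism of a free group
whose [p]-th power is the identity (for the cyclotomic block: cyclically permute
[x_0, ..., x_(p-1)] in the free group on them modulo [x_0 ... x_(p-1) = 1]), and the change of
basis lifts because transvections and signs generate [GL(n, Z)].

Conversely, a lift makes the extension [G] of [Z/p] by [F] act on a locally finite graph with
vertex set [G].  A set [A] of vertices with finite coboundary has a flux in [Hom(F, Z) = Z^n];
fluxes span [Z^n].  Following Dunwoody, choose repeatedly a cut of minimal size whose flux is
not in the sublattice spanned so far; submodularity of the coboundary allows choosing it nested
with its translates and with all previous cuts.  The structure tree of the nested family shows
that the span of the fluxes is pure at each stage.  This filters [Z^n] by submodules whose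
successive quotients are cyclic and torsion-free over [Z[Z/p]], hence standard since the [p]-th
cyclotomic polynomial is irreducible.  An extension of standard lattices is standard: the
obstruction lives in [F_p], and cyclotomic units normalise it. *)
Require Import Defs.
From HB Require Import structures.
From mathcomp Require Import all_boot all_order all_algebra qpoly.
From mathcomp Require Import finmap.
From mathcomp Require Import boolp classical_sets cardinality fsbigop.
From mathcomp Require Import zify ring.
Set Implicit Arguments. Unset Strict Implicit. Unset Printing Implicit Defensive.
Import Order.TTheory GRing.Theory Num.Theory.
Local Open Scope ring_scope.


(** * Free groups *)

(** A lift respects products only up to inner automorphisms, so the [p]-th power of the lifted
    automorphism [phi] is conjugation by some [w]; the extension exists because [w] can be chosen
    fixed by [phi]. The danger is a non-principal ideal of the cyclotomic ring. It needs two
    generators, so it is never a torsion-free cyclic quotient: everything turns on adding one orbit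
    at a time while keeping the quotients torsion-free, and this is where geometry enters. Fluxes of
    a nested family are read as invariant weights on the edges of its tree. If a combination of them
    is [q] times a homomorphism [h], the potential of the weight on the vertices is divided by [q]
    and rounded down; rounding commutes with translations, since these shift the potential by
    multiples of [q]. Without nestedness there is no tree and no potential. Minimality of the cuts
    serves twice: it makes both sides connected, so that finitely many cuts of bounded size separate
    two vertices, and it drives the uncrossing. The lattice obtained is [Hom(F, Z)] as row vectors
    under right multiplication by [g], the shape [P *m g = D *m P] of [standard_rep]. *)

Section FreeReduction.
Variable n : nat.
Implicit Types (x y : letter n) (u v w r : word n).

Definition push x r : word n :=
  match r with
  | y :: t => if y == inv_letter x then t else x :: r
  | [::] => [:: x]
  end.

Definition pushes w r := foldr push r w.

Definition reduced w := sorted (fun x y => y != inv_letter x) w.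

Lemma inv_letterK : involutive (@inv_letter n).
Proof. by case=> i b; rewrite /inv_letter /= negbK. Qed.

Lemma inv_letter_neq x : x != inv_letter x.
Proof. by case: x => i b; rewrite /inv_letter xpair_eqE /= eqxx; case: b. Qed.

Lemma reduceE w : reduce w = pushes w [::].
Proof. by []. Qed.

Lemma reduced_push x r : reduced r -> reduced (push x r).
Proof.
case: r => [//|y t] /= pt; case: ifP => [_|/negbT ne]; first exact: path_sorted pt.
by rewrite /= ne pt.
Qed.

Lemma reduced_pushes w r : reduced r -> reduced (pushes w r).
Proof. by move=> rr; elim: w => //= x w; apply: reduced_push. Qed.

Lemma reduced_reduce w : reduced (reduce w).
Proof. exact: reduced_pushes. Qed.

Lemma push_reduced x r : reduced (x :: r) -> push x r = x :: r.
Proof. by case: r => [|y t] //= /andP[ne _]; rewrite (negbTE ne). Qed.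

(** Letters act as permutations of the reduced words (van der Waerden's trick); the group laws on
    reduced words follow from this action, without any confluence argument. *)
Lemma pushK x r : reduced r -> push (inv_letter x) (push x r) = r.
Proof.
case: r => [_|y t] /=; first by rewrite inv_letterK eqxx.
case: ifP => [/eqP -> rt|_ _] /=; last by rewrite inv_letterK eqxx.
exact: push_reduced.
Qed.

Lemma pushVK x r : reduced r -> push x (push (inv_letter x) r) = r.
Proof. by move=> rr; rewrite -{1}(inv_letterK x) pushK. Qed.

Lemma reduce_id w : reduced w -> reduce w = w.
Proof.
elim: w => [//|x w IH] rw; rewrite /reduce /= -/(reduce w) IH; last exact: path_sorted rw.
exact: push_reduced.
Qed.

Lemma pushes_cat u v r : pushes (u ++ v) r = pushes u (pushes v r).
Proof. exact: foldr_cat. Qed.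

Lemma pushes_reduce u r : reduced r -> pushes (reduce u) r = pushes u r.
Proof.
move=> rr; elim: u => [//|x u IH] /=; rewrite -IH -/(reduce u).
case: (reduce u) => [//|y t] /=; case: ifP => [/eqP -> |//].
by rewrite pushVK // reduced_pushes.
Qed.

Lemma reduce_cat u v : reduce (u ++ v) = pushes u (reduce v).
Proof. exact: pushes_cat. Qed.

Lemma reduce_catl u v : reduce (reduce u ++ v) = reduce (u ++ v).
Proof. by rewrite !reduce_cat pushes_reduce // reduced_reduce. Qed.

Lemma reduce_catr u v : reduce (u ++ reduce v) = reduce (u ++ v).
Proof. by rewrite !reduce_cat reduce_id // reduced_reduce. Qed.

Lemma inv_word_cons x w : inv_word (x :: w) = rcons (inv_word w) (inv_letter x).
Proof. by rewrite /inv_word /= rev_cons. Qed.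

Lemma inv_wordK : involutive (@inv_word n).
Proof.
move=> w; rewrite /inv_word map_rev revK -map_comp -[RHS]map_id.
by apply: eq_map => x /=; rewrite inv_letterK.
Qed.

Lemma pushes_invK w r : reduced r -> pushes (inv_word w) (pushes w r) = r.
Proof.
move=> rr; elim: w => [//|x w IH].
by rewrite inv_word_cons -cats1 pushes_cat /= pushK ?IH // reduced_pushes.
Qed.

Record free_group := FreeGroup { fgval :> word n; _ : reduced fgval }.
HB.instance Definition _ := [isSub for fgval].
HB.instance Definition _ := [Countable of free_group by <:].

Definition cls w : free_group := FreeGroup (reduced_reduce w).

Lemma cls_val (f : free_group) : cls (fgval f) = f.
Proof. by apply: val_inj; rewrite /= reduce_id //; case: f. Qed.

Lemma clsP u v : cls u = cls v <-> reduce u = reduce v.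
Proof. by split=> [[]|e]; last apply: val_inj. Qed.

Definition fg_mul (f h : free_group) := cls (fgval f ++ fgval h).
Definition fg_inv (f : free_group) := cls (inv_word (fgval f)).

Lemma fg_mulA : associative fg_mul.
Proof. by move=> a b c; apply: val_inj; rewrite /= reduce_catl reduce_catr catA. Qed.

Lemma fg_mul1 : left_id (cls [::]) fg_mul.
Proof. by move=> a; rewrite /fg_mul /= cls_val. Qed.

Lemma fg_mulV : left_inverse (cls [::]) fg_inv fg_mul.
Proof.
move=> a; apply: val_inj; rewrite /= reduce_catl /= reduce_cat.
by rewrite [in X in pushes _ X]/reduce -/(pushes _ _) pushes_invK.
Qed.

Lemma fg_mulr1 : right_id (cls [::]) fg_mul.
Proof. by move=> a; rewrite /fg_mul /= cats0 cls_val. Qed.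

Lemma fg_mulrV : right_inverse (cls [::]) fg_inv fg_mul.
Proof.
move=> a; apply: val_inj; rewrite /= reduce_catr /= reduce_cat.
rewrite [in X in pushes _ X]/reduce -/(pushes _ _).
by rewrite -{1}(inv_wordK (fgval a)) pushes_invK.
Qed.

HB.instance Definition _ := isGroup.Build free_group
  fg_mulA fg_mul1 fg_mulr1 fg_mulV fg_mulrV.

End FreeReduction.

Section FreeGroupHom.
Variable n : nat.
Local Notation F := (free_group n).
Local Open Scope group_scope.
Implicit Types (x y : letter n) (u v w : word n).

Lemma cls_cat u v : cls (u ++ v) = cls u * cls v.
Proof. by apply: val_inj; rewrite /= reduce_catl reduce_catr. Qed.

Lemma cls_inv w : cls (inv_word w) = (cls w)^-1.
Proof.
apply/eqP; rewrite eq_sym; apply/eqP; apply: mulg1_eq.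
rewrite -cls_cat; apply: val_inj; rewrite /= reduce_cat -{1}(inv_wordK w).
by rewrite reduceE pushes_invK.
Qed.

Definition letter_val (H : groupType) (a : 'I_n -> H) x : H :=
  if x.2 then (a x.1)^-1 else a x.1.

Definition eval_word (H : groupType) (a : 'I_n -> H) w : H :=
  foldr (fun x acc => letter_val a x * acc) 1 w.

Definition fgen (i : 'I_n) : F := cls (gen i).

Section Eval.
Variables (H : groupType) (a : 'I_n -> H).

Lemma eval_word_cat u v : eval_word a (u ++ v) = eval_word a u * eval_word a v.
Proof. by elim: u => [|x u IH] /=; rewrite ?mul1g // IH mulgA. Qed.

Lemma letter_valV x : letter_val a (inv_letter x) = (letter_val a x)^-1.
Proof. by case: x => i [] /=; rewrite /letter_val /= ?invgK. Qed.

Lemma eval_reduce w : eval_word a (reduce w) = eval_word a w.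
Proof.
elim: w => [//|x w IH] /=; rewrite -IH -/(reduce w).
case: (reduce w) => [//|y t] /=; case: ifP => //= /eqP ->.
by rewrite letter_valV mulgA mulgV mul1g.
Qed.

Definition fg_hom (f : F) : H := eval_word a (fgval f).

Lemma fg_hom_cls w : fg_hom (cls w) = eval_word a w.
Proof. exact: eval_reduce. Qed.

Lemma fg_homM : {morph fg_hom : f h / f * h}.
Proof. by move=> f h; rewrite {1}/fg_hom eval_reduce eval_word_cat. Qed.

Lemma fg_hom_gen i : fg_hom (fgen i) = a i.
Proof. by rewrite fg_hom_cls /= mulg1. Qed.

End Eval.

Lemma cls_eval w : cls w = eval_word fgen w.
Proof.
elim: w => [//|x w IH] /=; rewrite -cat1s cls_cat IH; congr (_ * _).
by case: x => i [] //=; rewrite /letter_val /= /fgen -cls_inv.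
Qed.

Lemma eq_eval (H : groupType) (a b : 'I_n -> H) : a =1 b -> eval_word a =1 eval_word b.
Proof. by move=> ab; elim=> [//|x w IH] /=; rewrite IH /letter_val ab. Qed.

Lemma morph_eval (H K : groupType) (f : H -> K) (a : 'I_n -> H) w :
  {morph f : x y / x * y} -> f (eval_word a w) = eval_word (f \o a) w.
Proof.
move=> fM; have f1 : f 1 = 1 by apply: (@mulgI _ (f 1)); rewrite -fM !mulg1.
have fV (z : H) : f z^-1 = (f z)^-1.
  by apply/esym/mulg1_eq; rewrite -fM mulgV f1.
elim: w => [//|x w IH] /=; rewrite fM IH; congr (_ * _).
by case: x => i []; rewrite /letter_val /= ?fV.
Qed.

Lemma eval_fgen (f : F) : eval_word fgen (fgval f) = f.
Proof. by rewrite -cls_eval cls_val. Qed.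

Lemma fg_morph_ext (H : groupType) (f h : F -> H) :
  {morph f : x y / x * y} -> {morph h : x y / x * y} ->
  (forall i, f (fgen i) = h (fgen i)) -> f =1 h.
Proof.
move=> fM hM fh u; rewrite -(eval_fgen u) !morph_eval //.
exact: eq_eval.
Qed.

Lemma cls_apply_endo (f : endo n) w :
  cls (apply_endo f w) = eval_word (fun i => cls (f i)) w.
Proof.
elim: w => [//|x w IH]; rewrite /apply_endo /= cls_cat -/(apply_endo f w) IH.
by case: x => i [] /=; rewrite /letter_val /= ?cls_inv.
Qed.

Definition fg_endo (f : endo n) : F -> F := fg_hom (fun i => cls (f i)).

Lemma fg_endo_cls f w : fg_endo f (cls w) = cls (apply_endo f w).
Proof. by rewrite cls_apply_endo /fg_endo fg_hom_cls. Qed.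

Lemma fg_endoM f : {morph fg_endo f : x y / x * y}.
Proof. exact: fg_homM. Qed.

Lemma fg_endo_gen f i : fg_endo f (fgen i) = cls (f i).
Proof. exact: fg_hom_gen. Qed.

Lemma fg_endo_comp f h (u : F) : fg_endo (comp_endo f h) u = fg_endo f (fg_endo h u).
Proof.
move: u; apply: fg_morph_ext => [||i].
- exact: fg_endoM.
- by move=> x y /=; rewrite !fg_endoM.
by rewrite /= !fg_endo_gen -fg_endo_cls.
Qed.

Lemma fg_endo_id (u : F) : fg_endo (@gen n) u = u.
Proof.
by move: u; apply: (fg_morph_ext (@fg_endoM _)) => // i; rewrite fg_endo_gen.
Qed.

Section AddHom.
Variables (Z : zmodType) (h : F -> Z).
Hypothesis hM : forall f k, h (f * k) = (h f + h k)%R.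

Lemma addhom1 : h 1 = 0%R.
Proof. by apply: (@addrI _ (h 1)); rewrite -hM mulg1 addr0. Qed.

Lemma addhomV f : h f^-1 = (- h f)%R.
Proof. by apply: (@addrI _ (h f)); rewrite -hM mulgV addhom1 subrr. Qed.

Lemma addhom_cls w :
  h (cls w) = (\sum_(x <- w) (if x.2 then - h (fgen x.1) else h (fgen x.1)))%R.
Proof.
elim: w => [|x w IH]; first by rewrite big_nil addhom1.
rewrite big_cons -IH -cat1s cls_cat hM; congr +%R.
by case: x => i [] //=; rewrite -addhomV /fgen -cls_inv.
Qed.
End AddHom.

Lemma addhom_beta (h : F -> int) (f : endo n) i :
  (forall u k : F, h (u * k) = (h u + h k)%R) ->
  h (cls (f i)) = (\sum_j h (fgen j) * beta f j i)%R.
Proof.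
move=> hM; rewrite addhom_cls //.
under [RHS]eq_bigr => j _ do rewrite /beta mxE mulr_sumr.
rewrite exchange_big /=; apply: eq_bigr => x _.
rewrite (bigD1 x.1) //= eqxx big1 ?addr0; last first.
  by move=> j /negbTE; rewrite eq_sym => ->; rewrite mulr0.
by case: x.2; rewrite ?mulrN mulr1.
Qed.

Lemma size_reduce w : (size (reduce w) <= size w)%N.
Proof.
elim: w => [//|x w IH]; rewrite /reduce /= -/(reduce w).
case: (reduce w) IH => [|y t] //= IH; case: ifP => _ //=.
exact: leqW (ltnW IH).
Qed.

End FreeGroupHom.

Section FreeGroupFacts.
Variable n : nat.
Local Notation F := (free_group n).
Local Open Scope group_scope.

Lemma fgP (f : F) : reduced (fgval f).
Proof. by case: f. Qed.

Lemma fg_val_mul (f h : F) : fgval (f * h) = reduce (fgval f ++ fgval h).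
Proof. by []. Qed.

(** Take a generator [x_i] whose index differs from that of the first letter of [z]. Then [x_i z] is
    reduced, whereas [z x_i] is either reduced with another first letter or shorter. *)
Lemma fg_commute_gens_trivial (z : F) : (1 < n)%N ->
  (forall i, z * fgen i = fgen i * z) -> z = 1.
Proof.
move=> n1 zC; case Ez: (fgval z) (fgP z) => [|y t] rz.
  by apply: val_inj; rewrite /= Ez.
have [i iy] : exists i : 'I_n, i != y.1.
  have n0 : (0 < n)%N by apply: ltn_trans n1.
  have [e|ne] := eqVneq y.1 (Ordinal n0); last by exists (Ordinal n0); rewrite eq_sym.
  by exists (Ordinal n1); rewrite e.
have xr : reduced ((i, false) :: y :: t).
  apply/andP; split; last exact: rz.
  by apply: contraNneq iy => ->.
have e : reduce (rcons (y :: t) (i, false)) = (i, false) :: y :: t.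
  have := congr1 (@fgval n) (zC i); rewrite !fg_val_mul -[fgval (fgen i)]/(reduce (gen i)).
  by rewrite Ez reduce_catr reduce_catl cats1 => ->; apply: (reduce_id xr).
have [l|ne] := eqVneq (i, false) (inv_letter (last y t)); last first.
  move: e; rewrite reduce_id; last by rewrite /reduced /= rcons_path ne andbT.
  by move=> [e _]; rewrite e eqxx in iy.
exfalso; move/(congr1 size): e; rewrite lastI l -cats1 cat_rcons reduce_cat.
have -> : reduce [:: last y t; inv_letter (last y t)] = [::].
  by rewrite /reduce /= eqxx.
move=> e; have := size_reduce (belast y t); rewrite reduceE e /= size_rcons.
by rewrite ltnNge leqnSn.
Qed.

Lemma reduced_cat (u v : word n) (x : letter n) : reduced u -> reduced v ->
  (u != [::] -> v != [::] -> head x v != inv_letter (last x u)) -> reduced (u ++ v).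
Proof.
case: u => [//|a u] ru; case: v => [|b v] rv /= ne; first by rewrite cats0.
by rewrite /reduced /= cat_path; apply/andP; split; [exact: ru|rewrite /= ne].
Qed.

(* A conjugate of minimal length is cyclically reduced, so its powers do not cancel. *)
Lemma fg_torsion_free (f : F) m : (0 < m)%N -> f ^+ m = 1 -> f = 1.
Proof.
move=> m0.
have [k] := ubnP (size (fgval f)); elim: k f => // k IH f; rewrite ltnS => fk fm.
case Ef: (fgval f) (fgP f) => [|y t] rf; first by apply: val_inj; rewrite /= Ef.
have [l|ne] := eqVneq y (inv_letter (last y t)); last first.
  exfalso; have H q : fgval (f ^+ q) = flatten (nseq q (y :: t)) /\ reduced (flatten (nseq q (y :: t))).
    elim: q => [//|q [IH1 IH2]]; rewrite expgS fg_val_mul IH1 Ef.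
    suff r : reduced ((y :: t) ++ flatten (nseq q (y :: t))).
      by split; [exact: reduce_id|exact: r].
    apply: (@reduced_cat _ _ y) => //=.
    by case: q {IH1 IH2} => [|q] //=.
  by case: m m0 fm {IH} => // m _ fm; have [] := H m.+1; rewrite fm.
case/lastP: t l rf Ef => [|t x]; first by move/eqP; rewrite (negbTE (inv_letter_neq _)).
rewrite last_rcons => yx rf Ef.
have ft : f = cls [:: y] * cls t * (cls [:: y])^-1.
  rewrite -cls_inv -!cls_cat -[LHS]cls_val Ef; apply/clsP.
  by rewrite -cats1 yx /inv_word /= inv_letterK.
suff t1 : cls t = 1 by rewrite ft t1 mulg1 mulgV.
apply: IH.
  apply: leq_ltn_trans (size_reduce _) _; apply: leq_trans fk.
  by rewrite Ef /= size_rcons.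
apply: (@conjg_inj _ (cls [:: y])^-1); rewrite conj1g conjXg -fm.
by congr (_ ^+ _); rewrite ft /conjg invgK mulgA.
Qed.

End FreeGroupFacts.

(** * From a lift to an automorphism whose power is conjugation by a fixed element *)

Section Lift.
Variables (n : nat).
Local Notation F := (free_group n).
Local Open Scope group_scope.

Lemma is_aut_cancel (f : endo n) : is_aut f -> exists h : endo n,
  cancel (fg_endo f) (fg_endo h) /\ cancel (fg_endo h) (fg_endo f).
Proof.
move=> [h H]; exists h; split=> x.
  rewrite -fg_endo_comp -[RHS]fg_endo_id; move: x; apply: fg_morph_ext; try exact: fg_endoM.
  by move=> i; rewrite !fg_endo_gen; apply/clsP; have [_ ->] := H i.
rewrite -fg_endo_comp -[RHS]fg_endo_id; move: x; apply: fg_morph_ext; try exact: fg_endoM.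
by move=> i; rewrite !fg_endo_gen; apply/clsP; have [-> _] := H i.
Qed.

Lemma out_equiv_conj (f h : endo n) : out_equiv f h ->
  exists w, forall x, fg_endo h x = fg_endo f x ^ w.
Proof.
move=> [w H]; exists (cls w); apply: fg_morph_ext.
- exact: fg_endoM.
- by move=> x y; rewrite fg_endoM conjMg.
move=> i; have e : cls (h i) = cls (inv_word w ++ (f i ++ w)) by apply/clsP; exact: H.
by rewrite !fg_endo_gen e !cls_cat cls_inv.
Qed.

Lemma fg_endoV (f : endo n) x : fg_endo f x^-1 = (fg_endo f x)^-1.
Proof.
apply/esym/mulg1_eq; rewrite -fg_endoM mulgV.
by apply: (@mulgI _ (fg_endo f 1)); rewrite -fg_endoM !mulg1.
Qed.

Lemma fg_endoJ (f : endo n) x w : fg_endo f (x ^ w) = fg_endo f x ^ fg_endo f w.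
Proof. by rewrite /conjg !fg_endoM fg_endoV. Qed.

Lemma lift_power_inner p (g : 'M[int]_n) (iota : 'M[int]_n -> endo n) :
  mxpow g p = 1%:M ->
  (forall A, cyc_subgroup g A -> is_aut (iota A)) ->
  (forall A B, cyc_subgroup g A -> cyc_subgroup g B ->
        out_equiv (iota (A *m B)) (comp_endo (iota A) (iota B))) ->
  exists w, forall x, iter p (fg_endo (iota g)) x = x ^ w.
Proof.
move=> gp aut hom.
have c k : cyc_subgroup g (mxpow g k) by exists k.
have c1 : cyc_subgroup g 1%:M by exact: (c 0%N).
have cg : cyc_subgroup g g by have := c 1%N; rewrite /mxpow /= mulmx1.
(* The representative of the trivial class need not be the identity. Composed with itself it is a
   conjugate of itself, and cancelling one factor shows that it is inner. *)
have [w0 e1] : exists w, forall x, fg_endo (iota 1%:M) x = x ^ w.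
  have := hom _ _ c1 c1; rewrite mulmx1 => /out_equiv_conj[w e].
  have [h [hK Kh]] := is_aut_cancel (aut _ c1).
  by exists w => x; have := e (fg_endo h x); rewrite fg_endo_comp !Kh.
have [w H] : exists w, forall x, iter p (fg_endo (iota g)) x = fg_endo (iota (mxpow g p)) x ^ w.
  elim: p {gp} => [|k [w IH]]; first by exists w0^-1 => x; rewrite /= e1 conjgK.
  have [u e] := out_equiv_conj (hom _ _ cg (c k)).
  exists (u * fg_endo (iota g) w) => x.
  by rewrite /= IH fg_endoJ -fg_endo_comp e conjgM.
by exists (w0 * w) => x; rewrite H gp e1 conjgM.
Qed.

End Lift.

Lemma rank1_commute (x : free_group 1) : (x * fgen ord0 = fgen ord0 * x)%g.
Proof.
rewrite -(eval_fgen x); elim: (fgval x) => [|[j b] u IH] /=; first by rewrite mulg1 mul1g.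
rewrite -mulgA IH !mulgA; congr (_ * _)%g; rewrite /letter_val /= (ord1 j).
by case: b; rewrite ?mulVg ?mulgV.
Qed.

(** Computing the [(p+1)]-st power of [fg_endo f] in two ways makes [fg_endo f w0 * w0^-1] central,
    hence trivial in rank at least 2. In rank 1 conjugation is trivial and the conjugator is
    replaced by [1]. A fixed conjugator is what makes the relation [t^p = w] consistent with the
    action of [t]. *)
Lemma inner_power_fixed n p (f : endo n.+1) w0 : is_aut f ->
  (forall x, iter p (fg_endo f) x = (x ^ w0)%g) ->
  exists w, (forall x, iter p (fg_endo f) x = (w * x * w^-1)%g) /\ fg_endo f w = w.
Proof.
move=> /is_aut_cancel [h [hK Kh]] inner.
have iM k : {morph iter k (fg_endo f) : x y / (x * y)%g}.
  by elim: k => // k IH x y; rewrite !iterS IH fg_endoM.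
case: n f w0 h hK Kh inner iM => [|n] f w0 h hK Kh inner iM.
  exists 1%g; split; last first.
    by apply: (@mulgI _ (fg_endo f 1%g)); rewrite -fg_endoM !mulg1.
  move=> x; rewrite mul1g invg1 mulg1; move: x.
  apply: (fg_morph_ext (h := id) (iM p)) => // i.
  by rewrite inner /conjg (ord1 i) -rank1_commute mulKg.
exists w0^-1%g; split=> [x|]; first by rewrite inner /conjg invgK mulgA.
rewrite fg_endoV; congr (_^-1)%g.
have z1 : (fg_endo f w0 * w0^-1)%g = 1%g.
  apply: fg_commute_gens_trivial => // i.
  rewrite -(Kh (fgen i)); set y := fg_endo h (fgen i).
  have := fg_endoJ f y w0; rewrite -inner -iterS iterSr inner.
  move=> e; have e' := congr1 (fun z => fg_endo f w0 * z * w0^-1)%g e.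
  move: e'; rewrite /= /conjg !mulgA mulgV mul1g => <-.
  by rewrite -!mulgA mulgV mulg1.
by rewrite -[LHS]mulg1 -(mulVg w0) mulgA z1 mul1g.
Qed.

Lemma mxpowE n (g : 'M[int]_n.+1) k : mxpow g k = g ^+ k.
Proof. by elim: k => // k IH; rewrite exprS -IH. Qed.

(** * Lifting standard representations *)
Section Exponents.
Variable n : nat.
Implicit Types (u v w : word n) (f h : endo n).

Definition expo (j : 'I_n) w : int :=
  \sum_(x <- w) (if x.1 == j then (if x.2 then -1 else 1) else 0).

Lemma betaE f j i : beta f j i = expo j (f i).
Proof. by rewrite mxE. Qed.

Lemma expo_cat j u v : expo j (u ++ v) = expo j u + expo j v.
Proof. exact: big_cat. Qed.

Lemma expo_inv j w : expo j (inv_word w) = - expo j w.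
Proof.
rewrite /expo /inv_word (perm_big (map (@inv_letter n) w)) ?perm_rev //= big_map -sumrN.
by apply: eq_bigr => -[i b] _ /=; case: ifP => _; case: b; rewrite ?opprK ?oppr0.
Qed.

Lemma expo_reduce j w : expo j (reduce w) = expo j w.
Proof.
elim: w => [//|x w IH]; rewrite /reduce /= -/(reduce w) [RHS]big_cons -/(expo j w) -IH.
case: (reduce w) => [|y t]; first by rewrite /expo !big_cons.
rewrite /=; case: eqP => [->|_]; rewrite /expo !big_cons // addrA.
by case: x => i b /=; case: ifP => _; case: b => /=; rewrite ?addr0 ?addNr ?subrr add0r.
Qed.

Lemma expo_cls j u v : cls u = cls v -> expo j u = expo j v.
Proof. by move=> /clsP e; rewrite -expo_reduce e expo_reduce. Qed.

Lemma beta_cls f h : (forall i, cls (f i) = cls (h i)) -> beta f = beta h.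
Proof. by move=> e; apply/matrixP => j i; rewrite !betaE; apply: expo_cls. Qed.

Lemma beta_comp f h : beta (comp_endo f h) = beta f *m beta h.
Proof.
apply/matrixP => j i; rewrite betaE mxE /comp_endo.
under [RHS]eq_bigr => k _ do rewrite !betaE.
elim: (h i) => [|x w IH].
  by rewrite /expo big_nil big1 // => k _; rewrite big_nil mulr0.
rewrite /apply_endo /= expo_cat -/(apply_endo f w) IH.
under [RHS]eq_bigr => k _ do rewrite [expo k _]big_cons mulrDr.
rewrite big_split /=; congr (_ + _); rewrite (bigD1 x.1) //= eqxx big1 ?addr0.
  by case: x.2; rewrite ?expo_inv ?mulrN mulr1.
by move=> k /negbTE; rewrite eq_sym => ->; rewrite mulr0.
Qed.

Lemma beta_gen : beta (@gen n) = 1%:M.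
Proof.
apply/matrixP => j i; rewrite betaE /expo big_cons big_nil addr0 /= mxE eq_sym.
by case: eqP.
Qed.

Lemma out_equiv_beta f h : out_equiv f h -> beta f = beta h.
Proof.
move=> [w e]; apply/matrixP => j i; rewrite !betaE -[RHS]expo_reduce e expo_reduce.
by rewrite !expo_cat expo_inv addrCA addNr addr0.
Qed.

Lemma aut_of_cancel f h : (forall i, fg_endo f (fg_endo h (fgen i)) = fgen i) ->
  (forall i, fg_endo h (fg_endo f (fgen i)) = fgen i) -> is_aut f.
Proof.
move=> fh hf; exists h => i; split.
  by have := congr1 (@fgval n) (fh i); rewrite fg_endo_gen fg_endo_cls.
by have := congr1 (@fgval n) (hf i); rewrite fg_endo_gen fg_endo_cls.
Qed.

End Exponents.

Section SumEndo.
Variables (n1 n2 : nat).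
Implicit Types (f : endo n1) (h : endo n2).

Definition lword (w : word n1) : word (n1 + n2) := map (fun x => (lshift n2 x.1, x.2)) w.
Definition rword (w : word n2) : word (n1 + n2) := map (fun x => (rshift n1 x.1, x.2)) w.

Definition sum_endo f h : endo (n1 + n2) := fun i =>
  match fintype.split i with inl a => lword (f a) | inr b => rword (h b) end.

Definition lemb : free_group n1 -> free_group (n1 + n2) := fg_hom (fun i => fgen (lshift n2 i)).
Definition remb : free_group n2 -> free_group (n1 + n2) := fg_hom (fun i => fgen (rshift n1 i)).

Lemma lemb_cls w : lemb (cls w) = cls (lword w).
Proof. by rewrite /lemb fg_hom_cls cls_eval /eval_word foldr_map; elim: w => //= x w ->. Qed.

Lemma remb_cls w : remb (cls w) = cls (rword w).
Proof. by rewrite /remb fg_hom_cls cls_eval /eval_word foldr_map; elim: w => //= x w ->. Qed.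

Lemma sum_endo_l f h x : fg_endo (sum_endo f h) (lemb x) = lemb (fg_endo f x).
Proof.
move: x; apply: fg_morph_ext => [x y|x y|i] /=.
- by rewrite /lemb fg_homM fg_endoM.
- by rewrite fg_endoM /lemb fg_homM.
rewrite fg_endo_gen lemb_cls /lemb fg_hom_gen fg_endo_gen /sum_endo.
by rewrite -[lshift _ _]/(unsplit (inl _)) unsplitK.
Qed.

Lemma sum_endo_r f h x : fg_endo (sum_endo f h) (remb x) = remb (fg_endo h x).
Proof.
move: x; apply: fg_morph_ext => [x y|x y|i] /=.
- by rewrite /remb fg_homM fg_endoM.
- by rewrite fg_endoM /remb fg_homM.
rewrite fg_endo_gen remb_cls /remb fg_hom_gen fg_endo_gen /sum_endo.
by rewrite -[rshift _ _]/(unsplit (inr _)) unsplitK.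
Qed.

Lemma sum_gen_cases (P : free_group (n1 + n2) -> Prop) :
  (forall x, P (lemb x)) -> (forall x, P (remb x)) -> forall i, P (fgen i).
Proof.
move=> Pl Pr i; rewrite -(splitK i); case: (fintype.split i) => a /=.
  by have := Pl (fgen a); rewrite /lemb fg_hom_gen.
by have := Pr (fgen a); rewrite /remb fg_hom_gen.
Qed.

Lemma beta_sum f h : beta (sum_endo f h) = block_mx (beta f) 0 0 (beta h).
Proof.
apply/matrixP => j i; rewrite betaE /sum_endo -(splitK i) -(splitK j) unsplitK.
case: (fintype.split i) => a; case: (fintype.split j) => b /=;
  rewrite ?block_mxEul ?block_mxEur ?block_mxEdl ?block_mxEdr !mxE /expo big_map /=.
- by apply: eq_bigr => x _; rewrite eq_lshift.
- by rewrite big1 // => x _; rewrite eq_lrshift.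
- by rewrite big1 // => x _; rewrite eq_rlshift.
- by apply: eq_bigr => x _; rewrite eq_rshift.
Qed.

End SumEndo.

(** Asking for the identity, and not just an inner automorphism, allows direct sums: on a free
    product, different conjugators on the two factors would not combine into one. *)
Definition periodic_lift (p n : nat) (g : 'M[int]_n) := exists f : endo n,
  beta f = g /\ forall i, iter p (fg_endo f) (fgen i) = fgen i.

Lemma iter_morph n (f : endo n) k : {morph iter k (fg_endo f) : x y / (x * y)%g}.
Proof. by elim: k => // k IH x y; rewrite !iterS IH fg_endoM. Qed.

Lemma periodic_all p n (f : endo n) : (forall i, iter p (fg_endo f) (fgen i) = fgen i) ->
  forall x, iter p (fg_endo f) x = x.
Proof. by move=> H; apply: (fg_morph_ext (h := id) (iter_morph f p)). Qed.

Lemma periodic_sum p n1 n2 (g1 : 'M[int]_n1) (g2 : 'M[int]_n2) :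
  periodic_lift p g1 -> periodic_lift p g2 -> periodic_lift p (block_mx g1 0 0 g2).
Proof.
move=> [f1 [b1 p1]] [f2 [b2 p2]]; exists (sum_endo f1 f2); split; first by rewrite beta_sum b1 b2.
have il k x : iter k (fg_endo (sum_endo f1 f2)) (lemb n2 x) = lemb n2 (iter k (fg_endo f1) x).
  by elim: k => //= k ->; rewrite sum_endo_l.
have ir k x : iter k (fg_endo (sum_endo f1 f2)) (remb n1 x) = remb n1 (iter k (fg_endo f2) x).
  by elim: k => //= k ->; rewrite sum_endo_r.
apply: (sum_gen_cases (P := fun y => iter p (fg_endo (sum_endo f1 f2)) y = y)) => x.
  by rewrite il periodic_all.
by rewrite ir periodic_all.
Qed.

Lemma periodic_cast p m k (e : m = k) (g : 'M[int]_m) :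
  periodic_lift p g -> periodic_lift p (castmx (e, e) g).
Proof. by case: k / e; rewrite castmx_id. Qed.

Lemma periodic_triv p : periodic_lift p (std_block p Triv).
Proof.
exists (@gen 1); split; first exact: beta_gen.
have H q (x : free_group 1) : iter q (fg_endo (@gen 1)) x = x.
  by elim: q => //= q ->; rewrite fg_endo_id.
by move=> i; apply: H.
Qed.

Lemma periodic_reg p : prime p -> periodic_lift p (std_block p Reg).
Proof.
move=> p_pr; have p0 := prime_gt0 p_pr.
pose nx k : 'I_p := Ordinal (ltn_pmod k p0).
exists (fun i => gen (nx i.+1)); split.
  apply/matrixP => j i; rewrite betaE /expo big_cons big_nil addr0 mxE -val_eqE /= eq_sym.
  by case: eqP.
move=> i.
have it k : iter k (fg_endo (fun i : 'I_p => gen (nx i.+1))) (fgen i) = fgen (nx (i + k)%N).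
  elim: k => [|k IH]; first by congr fgen; apply: val_inj; rewrite /= addn0 modn_small.
  rewrite iterS IH fg_endo_gen; congr (cls (gen _)); apply: val_inj.
  by rewrite /= -addn1 modnDml addn1 addnS.
by rewrite it; congr fgen; apply: val_inj; rewrite /= modnDr modn_small.
Qed.

Lemma periodic_cyclo p : prime p -> periodic_lift p (std_block p Cyclo).
Proof.
move=> p_pr; have := prime_gt1 p_pr; case: p p_pr => [|[|m]] // p_pr _ /=.
pose all := [seq (i, false) | i <- enum 'I_m.+1] : word m.+1.
(* Here [p = m.+2]; the last generator goes to the missing element [x_(p-1)], the inverse of the
   product of all the others. *)
pose f (i : 'I_m.+1) : word m.+1 := if (i < m)%N then gen (inord i.+1) else inv_word all.
exists f; split.
  apply/matrixP => j i; rewrite betaE mxE /f.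
  case: (ltngtP i m) => im; last 2 first.
  - by have := ltn_ord i; rewrite ltnS leqNgt im.
  - rewrite expo_inv /expo big_map big_enum /= (bigD1 j) //= eqxx big1 ?addr0 //.
    by move=> k /negbTE ->.
  rewrite /expo big_cons big_nil addr0 /= -val_eqE /= inordK // eq_sym.
  by case: eqP.
pose P := (\prod_(i < m.+1) fgen i)%g.
have clsall : cls all = P.
  have <- : (\prod_(i <- enum 'I_m.+1) fgen i)%g = P.
    by rewrite /P [index_enum _]unlock -enumT.
  rewrite /all; elim: (enum 'I_m.+1) => [|i s IH]; first by rewrite big_nil.
  by rewrite big_cons -IH -cls_cat.
have fgs i : (i < m)%N -> fg_endo f (fgen (inord i)) = fgen (inord i.+1).
  by move=> im; rewrite fg_endo_gen /f inordK ?im // ltnW.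
have fgl : fg_endo f (fgen ord_max) = P^-1%g.
  by rewrite fg_endo_gen /f ltnn cls_inv clsall.
have it k : (k <= m)%N -> iter k (fg_endo f) (fgen ord0) = fgen (inord k).
  elim: k => [_|k IH km]; first by congr fgen; apply: val_inj; rewrite /= inordK.
  by rewrite iterS IH 1?ltnW // fgs.
(* Write [P = x_0 Q]. All factors of [P] except the last move one place on and the last becomes
   [P^-1], so the image is [Q P^-1 = x_0^-1]. *)
have fP : fg_endo f P = ((fgen ord0)^-1)%g.
  have -> : fg_endo f P = (\prod_(i < m.+1) fg_endo f (fgen i))%g.
    apply: (big_morph _ (fg_endoM f)).
    by apply: (@mulgI _ (fg_endo f 1%g)); rewrite -fg_endoM !mulg1.
  rewrite big_ord_recr /= fgl.
  have PE : P = (fgen ord0 * \prod_(i < m) fgen (inord i.+1))%g.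
    rewrite /P big_ord_recl; congr (_ * _)%g; apply: eq_bigr => i _; congr fgen.
    by apply: val_inj; rewrite /= inordK // ltnS.
  have -> : (\prod_(i < m) fg_endo f (fgen (widen_ord (leqnSn m) i)) =
      \prod_(i < m) fgen (inord i.+1))%g.
    apply: eq_bigr => i _; rewrite -fgs //; congr (fg_endo f (fgen _)).
    by apply: val_inj; rewrite /= inordK // ltnW // ltnS.
  by apply: (@mulgI _ (fgen ord0)); rewrite mulgA -PE !mulgV.
have top : iter m.+2 (fg_endo f) (fgen ord0) = fgen ord0.
  rewrite !iterS it //.
  have -> : inord m = ord_max :> 'I_m.+1 by apply: val_inj; rewrite /= inordK.
  by rewrite fgl fg_endoV fP invgK.
move=> i; have ei : fgen i = iter i (fg_endo f) (fgen ord0).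
  by rewrite it; [congr fgen; apply: val_inj; rewrite /= inordK|rewrite -ltnS].
by rewrite {1}ei -iterD addnC iterD top -ei.
Qed.

Lemma periodic_diag p k (t : 'I_k -> std_kind) : prime p ->
  periodic_lift p (\mxdiag_i std_block p (t i)).
Proof.
move=> p_pr; elim: k t => [|k IH] t.
  have empty (i : 'I_(\sum_(i < 0) kind_size p (t i))) : False.
    by have := ltn_ord i; rewrite [X in (_ < X)%N]big_ord0.
  by exists (fun=> [::]); split=> [|i]; [apply/matrixP => i|]; case: (empty i).
rewrite mxdiag_recl; apply: periodic_cast; apply: periodic_sum; last exact: IH.
case: (t _); [exact: periodic_triv|exact: periodic_reg|exact: periodic_cyclo].
Qed.

Section CyclicPowers.
Variables (p n : nat) (g : 'M[int]_n).
Hypotheses (p_pr : prime p) (gp : mxpow g p = 1%:M).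

Lemma mxpowD a b : mxpow g (a + b) = mxpow g a *m mxpow g b.
Proof. by elim: a => [|a IH]; rewrite ?mul1mx // addSn /mxpow !iterS -!/(mxpow _ _) IH mulmxA. Qed.

Lemma mxpow_mul a b : mxpow g a = 1%:M -> mxpow g (b * a) = 1%:M.
Proof. by move=> ga; elim: b => // b IH; rewrite mulSn mxpowD ga mul1mx. Qed.

Lemma mxpow_mod k : mxpow g (k %% p) = mxpow g k.
Proof. by rewrite {2}(divn_eq k p) mxpowD mxpow_mul // mul1mx. Qed.

Lemma mxpow_inj a b : g <> 1%:M -> mxpow g a = mxpow g b -> a = b %[mod p].
Proof.
move=> g1 ab; have p0 := prime_gt0 p_pr.
(* [a + (p - 1) b] stands for [a - b] modulo [p]. *)
have d1 : mxpow g (a + p.-1 * b) = 1%:M.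
  rewrite mxpowD ab -mxpowD -[(b + _)%N]/(p.-1.+1 * b)%N prednK // mulnC.
  exact: mxpow_mul.
have [pd|npd] := boolP (p %| a + p.-1 * b)%N.
  apply/eqP; rewrite -(eqn_modDr (p.-1 * b)) -[(b + _)%N]/(p.-1.+1 * b)%N prednK //.
  by rewrite (eqP pd) modnMr.
case: g1; have d0 : (0 < a + p.-1 * b)%N by rewrite lt0n; apply: contraNneq npd => ->.
have cop : gcdn (a + p.-1 * b) p = 1%N.
  by apply/eqP; rewrite -/(coprime _ _) coprime_sym prime_coprime.
case: (egcdnP p d0) => u v e _; rewrite cop in e.
have := mxpow_mul u d1; rewrite e mxpowD mxpow_mul // mul1mx.
by rewrite /mxpow /= mulmx1.
Qed.

Lemma lifts_of_periodic : g <> 1%:M -> periodic_lift p g -> lifts_to_Out (cyc_subgroup g).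
Proof.
move=> g1 [f [bf pf]]; have p0 := prime_gt0 p_pr.
pose pw k : endo n := iter k (comp_endo f) (@gen n).
have bpw k : beta (pw k) = mxpow g k.
  elim: k => [|k IH]; first exact: beta_gen.
  by rewrite /pw iterS beta_comp -/(pw k) IH bf.
have fpw k x : fg_endo (pw k) x = iter k (fg_endo f) x.
  elim: k => [|k IH]; first exact: fg_endo_id.
  by rewrite /pw iterS fg_endo_comp -/(pw k) IH.
have pall := periodic_all pf.
have pmul q x : iter (q * p) (fg_endo f) x = x.
  by elim: q => //= q IH; rewrite mulSn iterD IH pall.
have pmod k x : iter k (fg_endo f) x = iter (k %% p) (fg_endo f) x.
  by rewrite {1}(divn_eq k p) iterD pmul.
(* Choosing for each power of [g] one exponent below [p] makes the lift multiplicative on the nose,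
   so the conjugating word below is empty. *)
pose idx A : nat := if [pick k : 'I_p | A == mxpow g k] is Some k then k : nat else 0%N.
have idxP A : cyc_subgroup g A -> A = mxpow g (idx A).
  move=> [k ->]; rewrite /idx; case: pickP => [j /eqP//|/(_ (Ordinal (ltn_pmod k p0)))].
  by rewrite /= mxpow_mod eqxx.
exists (fun A => pw (idx A)); split; [|split; [|split]].
- move=> A _; set k := idx A.
  have kp : (k <= k * p)%N by rewrite leq_pmulr.
  apply: (@aut_of_cancel _ _ (pw (k * p - k)%N)) => i; rewrite !fpw -iterD.
    by rewrite subnKC // pmul.
  by rewrite subnK // pmul.
- move=> A B cA cB; exists [::] => i; rewrite /inv_word /= cats0; apply/clsP.
  rewrite -!fg_endo_gen fg_endo_comp !fpw -iterD.
  have cAB : cyc_subgroup g (A *m B).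
    by rewrite (idxP A cA) (idxP B cB) -mxpowD; exists (idx A + idx B)%N.
  rewrite pmod [RHS]pmod; congr iter; apply: mxpow_inj => //.
  by rewrite mxpowD -!idxP.
- by move=> A cA; rewrite bpw -idxP.
- by move=> A B cA cB /out_equiv_beta; rewrite !bpw -!idxP.
Qed.
End CyclicPowers.

(** * Surjectivity of [beta] onto GL(n, Z) *)

Definition aut_lift n (P : 'M[int]_n) := exists2 f : endo n, is_aut f & beta f = P.

Lemma aut_lift_mul n (P Q : 'M[int]_n) : aut_lift P -> aut_lift Q -> aut_lift (P *m Q).
Proof.
move=> [f /is_aut_cancel[f' [fK fK']] <-] [h /is_aut_cancel[h' [hK hK']] <-].
exists (comp_endo f h); last exact: beta_comp.
by apply: (@aut_of_cancel _ _ (comp_endo h' f')) => i; rewrite !fg_endo_comp ?hK' ?fK' ?fK ?hK.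
Qed.

Lemma aut_lift_block n1 n2 (P : 'M[int]_n1) (Q : 'M[int]_n2) :
  aut_lift P -> aut_lift Q -> aut_lift (block_mx P 0 0 Q).
Proof.
move=> [f /is_aut_cancel[f' [fK fK']] <-] [h /is_aut_cancel[h' [hK hK']] <-].
exists (sum_endo f h); last exact: beta_sum.
apply: (@aut_of_cancel _ _ (sum_endo f' h')).
  apply: (sum_gen_cases (P := fun y => fg_endo (sum_endo f h) (fg_endo (sum_endo f' h') y) = y)) => x.
    by rewrite !sum_endo_l fK'.
  by rewrite !sum_endo_r hK'.
apply: (sum_gen_cases (P := fun y => fg_endo (sum_endo f' h') (fg_endo (sum_endo f h) y) = y)) => x.
  by rewrite !sum_endo_l fK.
by rewrite !sum_endo_r hK.
Qed.

Lemma aut_lift_sign (P : 'M[int]_1) : P 0 0 \is a GRing.unit -> aut_lift P.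
Proof.
move=> uP; pose f b : endo 1 := fun=> [:: (ord0, b)].
have ff b i : fg_endo (f b) (fg_endo (f b) (fgen i)) = fgen i.
  rewrite fg_endo_gen fg_endo_cls; apply/clsP; rewrite (ord1 i).
  by rewrite /apply_endo /f /=; case: b.
exists (f (P 0 0 == -1)); first exact: (aut_of_cancel (ff _) (ff _)).
apply/matrixP => i j; rewrite (ord1 i) (ord1 j) betaE /expo big_cons big_nil /= addr0.
by case/orP: uP => /eqP ->.
Qed.

Section Transvections.
Variable n : nat.
Implicit Types (i j k l : 'I_n) (b : bool) (P : 'M[int]_n).

Definition sgb b : int := if b then -1 else 1.
Definition transvection i j b : 'M[int]_n := 1%:M + sgb b *: delta_mx i j.

Lemma transvection_l i j b P k l :
  (transvection i j b *m P) k l = P k l + (if k == i then sgb b * P j l else 0).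
Proof.
rewrite mulmxDl mul1mx mxE -scalemxAl mxE; congr (_ + _).
rewrite mxE (bigD1 j) //= mxE eqxx andbT big1 ?addr0; last first.
  by move=> m /negbTE mj; rewrite mxE mj andbF mul0r.
by case: eqP => _; rewrite ?mul1r // mul0r mulr0.
Qed.

Lemma transvection_r i j b P k l :
  (P *m transvection i j b) k l = P k l + (if l == j then sgb b * P k i else 0).
Proof.
rewrite mulmxDr mulmx1 mxE -scalemxAr mxE; congr (_ + _).
rewrite mxE (bigD1 i) //= mxE eqxx big1 ?addr0 /=; last first.
  by move=> m /negbTE mj; rewrite mxE mj mulr0.
by case: eqP => _; rewrite ?mulr1 // !mulr0.
Qed.

Lemma transvectionK i j b : i != j -> transvection i j b *m transvection i j (~~ b) = 1%:M.
Proof.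
move=> ij; apply/matrixP => k l; rewrite transvection_l !mxE.
have -> : (j == i) = false by rewrite eq_sym (negbTE ij).
by rewrite [l == j]eq_sym; case: (k == i); case: (j == l); case: b; rewrite /sgb /=; ring.
Qed.

Lemma aut_lift_transvection i j b : i != j -> aut_lift (transvection i j b).
Proof.
move=> ij; pose f b : endo n := fun k => if k == j then [:: (i, b); (j, false)] else gen k.
have ff c k : fg_endo (f c) (fg_endo (f (~~ c)) (fgen k)) = fgen k.
  rewrite fg_endo_gen /f; case: eqP => [->|kj]; last first.
    by rewrite fg_endo_gen; case: eqP kj.
  have -> : fg_endo (f c) (cls [:: (i, ~~ c); (j, false)]) = cls [:: (i, ~~ c); (i, c); (j, false)].
    by rewrite fg_endo_cls /apply_endo /f /= eqxx (negbTE ij); case: c.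
  apply/clsP; rewrite /reduce /= /inv_letter /= xpair_eqE [j == i]eq_sym (negbTE ij) /=.
  by rewrite negbK eqxx.
exists (f b); first by apply: (@aut_of_cancel _ _ (f (~~ b))) => // k; rewrite -{2}(negbK b) ff.
apply/matrixP => k l; rewrite betaE !mxE /f [k == l]eq_sym.
case: (eqVneq l j) => [->|lj]; rewrite /expo !big_cons big_nil /= ?addr0.
  by rewrite andbT [k == i]eq_sym addrC; congr (_ + _); case: eqP => _; case: b => /=; rewrite ?mulr1 ?mulr0.
by rewrite andbF mulr0 addr0; case: eqP.
Qed.

Lemma aut_lift_transvection_l i j b P : i != j ->
  aut_lift (transvection i j b *m P) -> aut_lift P.
Proof.
move=> ij /(aut_lift_mul (aut_lift_transvection (~~ b) ij)).
by rewrite mulmxA -{2}(negbK b) transvectionK // mul1mx.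
Qed.

Lemma aut_lift_transvection_r i j b P : i != j ->
  aut_lift (P *m transvection i j b) -> aut_lift P.
Proof.
move=> ij aP; have := aut_lift_mul aP (aut_lift_transvection (~~ b) ij).
by rewrite -mulmxA transvectionK // mulmx1.
Qed.

Lemma transvection_unit i j b : i != j -> transvection i j b \in unitmx.
Proof. by move=> ij; have [] := mulmx1_unit (transvectionK b ij). Qed.

End Transvections.

Section Reduction.
Variable n : nat.
Implicit Types (P : 'M[int]_n.+1).

(** Along row and column operations unimodularity is carried forward and liftability is carried
    back. *)
Definition reduces_to P P' := (P \in unitmx -> P' \in unitmx) /\ (aut_lift P' -> aut_lift P).

Lemma reduces_trans P Q T : reduces_to P Q -> reduces_to Q T -> reduces_to P T.
Proof. by move=> [a b] [c d]; split=> [/a/c|/d/b]. Qed.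

Lemma reduces_l i j b P : i != j -> reduces_to P (transvection i j b *m P).
Proof.
move=> ij; split; last exact: aut_lift_transvection_l.
by rewrite unitmx_mul transvection_unit.
Qed.

Lemma reduces_r i j b P : i != j -> reduces_to P (P *m transvection i j b).
Proof.
move=> ij; split; last exact: aut_lift_transvection_r.
by rewrite unitmx_mul transvection_unit // andbT.
Qed.

Lemma sum_absz_lt (I : finType) (F G : I -> int) i : (forall k, k != i -> G k = F k) ->
  (absz (G i) < absz (F i))%N -> (\sum_k absz (G k) < \sum_k absz (F k))%N.
Proof.
move=> e lt; rewrite (bigD1 i) //= [X in (_ < X)%N](bigD1 i) //=.
rewrite (eq_bigr (fun k => absz (F k))) ?ltn_add2r // => k ki.
by rewrite e.
Qed.

(** Euclid's algorithm on the first column, with the sum of the absolute values of its entries as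
    measure. *)
Lemma column_reduction P : exists2 P', reduces_to P P' & forall i, i != 0 -> P' i 0 = 0.
Proof.
have [k] := ubnP (\sum_i absz (P i 0%R))%N; elim: k P => // k IH P; rewrite ltnS => Pk.
have [/existsP[i /existsP[j /and4P[ij Pi Pj lij]]]|none] := boolP [exists i, exists j,
    [&& i != j, P i 0 != 0, P j 0 != 0 & (absz (P j 0%R) <= absz (P i 0%R))%N]].
  (* The sign is such that the entry in row [i] loses the absolute value of the entry in row [j],
     which is not larger. *)
  pose b := 0 < P i 0 * P j 0.
  have [|P' rP cP] := IH (transvection i j b *m P).
    apply: leq_trans Pk; apply: (@sum_absz_lt _ (fun i => P i 0)
       (fun l => (transvection i j b *m P) l 0) i) => [l li|].
      by rewrite transvection_l (negbTE li) addr0.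
    rewrite transvection_l eqxx /b; move: lij Pi Pj; rewrite /sgb.
    by case: ltP => H lij Pi Pj; [have : P i 0 * P j 0 > 0 by []|]; nia.
  by exists P' => //; apply: reduces_trans rP; apply: reduces_l.
have uniq i j : i != j -> P i 0 != 0 -> P j 0 = 0.
  move=> ij Pi; apply/eqP; apply/negPn/negP => Pj; move/negP: none; apply.
  have [l|l] := leqP (absz (P j 0)) (absz (P i 0)); apply/existsP.
    by exists i; apply/existsP; exists j; rewrite ij Pi Pj l.
  by exists j; apply/existsP; exists i; rewrite eq_sym ij Pi Pj ltnW.
have [/existsP[i /andP[i0 Pi]]|clean] := boolP [exists i, (i != 0) && (P i 0 != 0)]; last first.
  exists P => [|i i0]; first by split.
  by apply/eqP; apply/negPn/negP => Pi; move/negP: clean; apply; apply/existsP; exists i; rewrite i0.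
have i0' : 0 != i by rewrite eq_sym.
(* The only nonzero entry sits in row [i]: adding this row to row 0 and then subtracting row 0 from
   row [i] moves it to the corner. *)
exists (transvection i 0 true *m (transvection 0 i false *m P)).
  by apply: (reduces_trans (reduces_l false P i0')); apply: reduces_l.
move=> l l0; rewrite !transvection_l eqxx (negbTE l0) (uniq i 0) // /sgb.
case: eqP => [->|/eqP li]; first by ring.
by rewrite (uniq i l) // eq_sym.
Qed.

Lemma clean_column_unit P : P \in unitmx -> (forall i, i != 0 -> P i 0 = 0) ->
  P 0 0 \is a GRing.unit.
Proof.
move=> uP cP; have := uP; rewrite unitmxE (expand_det_col P 0) (bigD1 0) //= big1 ?addr0.
  by rewrite unitrM => /andP[].
by move=> i /cP ->; rewrite mul0r.
Qed.

(** The corner divides the determinant, so it is a sign, and adding or subtracting the first column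
    brings another entry of the first row closer to 0 by 1 without disturbing the first column. *)
Lemma row_reduction P : P \in unitmx -> (forall i, i != 0 -> P i 0 = 0) ->
  exists2 P', reduces_to P P' & (forall i, i != 0 -> P' i 0 = 0) /\ (forall j, j != 0 -> P' 0 j = 0).
Proof.
have [k] := ubnP (\sum_j absz (P 0%R j))%N; elim: k P => // k IH P; rewrite ltnS => Pk uP cP.
have u := clean_column_unit uP cP.
have [/existsP[j /andP[j0 Pj]]|clean] := boolP [exists j, (j != 0) && (P 0 j != 0)]; last first.
  exists P; split=> // j j0.
  by apply/eqP; apply/negPn/negP => Pj; move/negP: clean; apply; apply/existsP; exists j; rewrite j0.
have j0' : 0 != j by rewrite eq_sym.
pose b := 0 < P 0 j * P 0 0.
have rP := reduces_r b P j0'.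
have [||i i0|P' rP' cP'] := IH (P *m transvection 0 j b).
- apply: leq_trans Pk; apply: (@sum_absz_lt _ (fun j => P 0 j)
     (fun l => (P *m transvection 0 j b) 0 l) j) => [l lj|].
    by rewrite transvection_r (negbTE lj) addr0.
  rewrite transvection_r eqxx /b; move: Pj; rewrite /sgb.
  by case/orP: u => /eqP ->; rewrite ?mulr1 ?mulrN1; case: ltP => H Pj; lia.
- exact: rP.1.
- by rewrite transvection_r (negbTE j0') addr0 cP.
by exists P' => //; apply: reduces_trans rP rP'.
Qed.

End Reduction.

Theorem aut_lift_unit n (P : 'M[int]_n) : P \in unitmx -> aut_lift P.
Proof.
elim: n P => [|n IH] P uP.
  exists (fun=> [::]); last by apply/matrixP => -[].
  by exists (fun=> [::]) => -[].
have [Q [rQ aQ] cQ] := column_reduction P; apply: aQ.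
have [T [rT aT] [cT lT]] := row_reduction (rQ uP) cQ; apply: aT.
have uT := rT (rQ uP); have u := clean_column_unit uT cT.
pose T' : 'M[int]_(1 + n) := T.
have eT : T' = block_mx (ulsubmx T') 0 0 (drsubmx T').
  rewrite -{1}[T']submxK; congr block_mx; apply/matrixP => i j; rewrite !mxE.
    by rewrite (ord1 i) -[RHS](lT (rshift 1 j)) //; congr (T _ _); apply: val_inj.
  by rewrite (ord1 j) -[RHS](cT (rshift 1 i)) //; congr (T _ _); apply: val_inj.
change (aut_lift T'); rewrite eT; apply: aut_lift_block.
  apply: aut_lift_sign; rewrite !mxE.
  by have -> : T' (lshift n 0) (lshift n 0) = T 0 0 by congr (T _ _); apply: val_inj.
apply: IH; have : T' \in unitmx by exact: uT.
by rewrite {1}eT !unitmxE det_ublock unitrM => /andP[].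
Qed.

Lemma periodic_conj p n (g D P : 'M[int]_n) : P \in unitmx -> P *m g = D *m P ->
  periodic_lift p D -> periodic_lift p g.
Proof.
move=> uP PgDP [f [bf pf]].
have [h /is_aut_cancel[h' [hK hK']] bh] := aut_lift_unit uP.
have inv : beta h' *m P = 1%:M.
  rewrite -bh -beta_comp -beta_gen; apply: beta_cls => i.
  by rewrite -fg_endo_gen fg_endo_comp hK.
exists (comp_endo h' (comp_endo f h)); split.
  by rewrite !beta_comp bf bh -PgDP mulmxA inv mul1mx.
move=> i; have it k x : iter k (fg_endo (comp_endo h' (comp_endo f h))) x =
    fg_endo h' (iter k (fg_endo f) (fg_endo h x)).
  by elim: k => [|k IH]; rewrite ?hK //= IH !fg_endo_comp hK'.
by rewrite it (periodic_all pf) hK.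
Qed.

(** * Lattices over the group ring of Z/p *)
(** For [p] prime, [geom p] is the [p]-th cyclotomic polynomial; modulo it, [geom d] with [d] prime
    to [p] is the cyclotomic unit [(1 - lambda^d) / (1 - lambda)]. *)
Definition geom (k : nat) : {poly int} := \sum_(i < k) 'X^i.

Lemma geomE k : ('X - 1) * geom k = 'X^k - 1.
Proof. by rewrite subrX1. Qed.

Lemma geom1 k : (geom k).[1] = k%:Z.
Proof.
rewrite horner_sum (eq_bigr (fun=> 1)); last by move=> i _; rewrite hornerXn expr1n.
by rewrite sumr_const card_ord natz.
Qed.

Lemma polyXsub1_neq0 : ('X - 1 : {poly int}) != 0.
Proof. by rewrite -['X - 1]/('X - 1%:P) polyXsubC_eq0. Qed.

Lemma poly_at1 (c : {poly int}) : exists d, c = ('X - 1) * d + (c.[1])%:P.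
Proof.
have /factor_theorem[d e] : root (c - (c.[1])%:P) 1 by rewrite /root !hornerE subrr.
by exists d; rewrite mulrC -[X in _ * X]/('X - 1%:P) -e subrK.
Qed.

Section Prime.
Variable p : nat.
Hypothesis p_pr : prime p.
Local Notation Phi := (geom p).

(** Substituting [X + 1] turns [Phi] into [Psi], with binomial coefficients, which is irreducible by
    Eisenstein's criterion. The second alternative is Bezout's identity up to a nonzero constant. *)
Lemma geom_prime_dichotomy (c : {poly int}) :
  (exists r, c = Phi * r) \/ (exists A B (m : int), m != 0 /\ A * c + B * Phi = m%:P).
Proof.
have p0 := prime_gt0 p_pr; have p1 := prime_gt1 p_pr.
pose Psi : {poly int} := \poly_(i < p) ('C(p, i.+1))%:Z.
have c1 (q : {poly int}) : 1 \Po q = 1 by rewrite -polyC1 comp_polyC.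
have PsiE : Psi = Phi \Po ('X + 1%:P).
  have X0 : ('X : {poly int}) != 0 by rewrite polyX_eq0.
  apply: (mulfI X0).
  have -> : 'X * (Phi \Po ('X + 1%:P)) = ('X + 1%:P) ^+ p - 1 :> {poly int}.
    have -> : ('X + 1%:P) ^+ p - 1 = ('X^p - 1) \Po ('X + 1%:P) :> {poly int}.
      by rewrite comp_polyB comp_Xn_poly c1.
    rewrite -geomE comp_polyM; congr (_ * _).
    by rewrite comp_polyB comp_polyX c1 polyC1 addrK.
  rewrite polyC1 [X in X ^+ p]addrC exprDn.
  rewrite big_ord_recl /= bin0 mulr1n expr0 mulr1 expr1n addrAC subrr add0r.
  rewrite /Psi poly_def mulr_sumr; apply: eq_bigr => i _.
  by rewrite expr1n mul1r /bump leq0n add1n -scalerAr -exprS -natz scaler_nat.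
have sPsi : size Psi = p.
  apply: size_poly_eq; rewrite prednK // binn //.
have lPsi : lead_coef Psi = 1.
  by rewrite lead_coefE sPsi coef_poly prednK // leqnn binn.
have irr : irreducible_poly Psi.
  apply: (@eisenstein_crit p) => //.
  - by rewrite sPsi neq_ltn p1 orbT.
  - by rewrite lPsi dvdz1 /=; rewrite neq_ltn p1 orbT.
  - rewrite coef_poly p0 bin1 dvdzE /= expr2 -[(p * p)%R]/(p * p)%N; apply/negP => /(dvdn_leq p0).
    by rewrite -[X in (_ <= X)%N]muln1 leq_pmul2l // leqNgt p1.
  - move=> i; rewrite sPsi => ip; rewrite coef_poly.
    have -> : (i < p)%N by apply: leq_trans ip (leq_pred _).
    rewrite /dvdz /=; apply: prime_dvd_bin => //=.
    by rewrite -ltn_predRL.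
have mPsi : Psi \is monic by rewrite monicE lPsi.
have back (q : {poly int}) : (q \Po ('X + 1%:P)) \Po ('X - 1%:P) = q by apply: comp_polyXaddC_K.
pose c' := c \Po ('X + 1%:P).
have := irreducible_poly_coprime c' irr.
case: (boolP (Psi %| c')) => [/dvdpP_int[r e] _|_ cop]; [left|right].
  rewrite zprimitive_monic // in e; exists (r \Po ('X - 1%:P)).
  by rewrite -[c]back -/c' e PsiE comp_polyM back.
have /Bezout_coprimepP[[u v] /eqpP[[a b] /andP[_ b0] /= e]] : coprimep Psi c' by rewrite cop.
exists ((a *: v) \Po ('X - 1%:P)), ((a *: u) \Po ('X - 1%:P)), b; split=> //.
rewrite -{1}[c]back -{1}[Phi]back -/c' -PsiE -!comp_polyM -comp_polyD.
have -> : (a *: v) * c' + (a *: u) * Psi = b%:P.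
  by rewrite -!scalerAl -scalerDr addrC e alg_polyC.
exact: comp_polyC.
Qed.
(** The residue and its inverse are natural numbers because they become lengths of geometric
    sums. *)
Lemma inverse_mod_prime (a : int) : ~~ (p %| a)%Z ->
  exists d e t : nat, exists m : int, (d * e = 1 + p * t)%N /\ a = e%:Z + p%:Z * m.
Proof.
move=> pa; have p0 := prime_gt0 p_pr; have p1 := prime_gt1 p_pr.
pose e := absz (a %% p)%Z.
have ea : (a %% p)%Z = e%:Z by rewrite gez0_abs // modz_ge0 // eqz_nat -lt0n.
have ae : a = e%:Z + p%:Z * (a %/ p)%Z by rewrite {1}(divz_eq a p) ea; ring.
have cop : coprime p e.
  rewrite prime_coprime //; apply: contra pa => pe.
  by rewrite ae rpredD ?dvdz_mulr // dvdzE.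
have [b _] := Bezoutl e p0; rewrite (eqP cop) => /dvdnP[k bk].
(* Bezout gives [b * e = p * k - 1], an inverse up to sign; squaring removes the sign:
   [(p k - 1)^2 = 1 + p k (p k - 2)]. *)
exists (b * b * e)%N, e, (k * (p * k - 2))%N, (a %/ p)%Z; split=> //.
case: k bk => [|k] bk; first by rewrite mul0n in bk.
have pk : (2 <= p * k.+1)%N by rewrite (leq_trans p1) // leq_pmulr.
have be : (b * e = p * k.+1 - 1)%N by lia.
have -> : (b * b * e * e = (b * e) * (b * e))%N by lia.
rewrite be; move: pk; set q := (p * k.+1)%N => pk.
have -> : (p * (k.+1 * (q - 2)) = q * (q - 2))%N by rewrite mulnA.
move: pk; case: q => [|[|q]] // _; rewrite !subSS !subn0; lia.
Qed.

(** The product of [geom d] and [geom e] at [X^d] telescopes to [geom (d * e)]. As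
    [d * e = 1 + p * t], this is [1] plus [X] times [geom (p * t)], and the latter is a multiple of
    [Phi]. *)
Lemma geom_unit (d e t : nat) : (d * e = 1 + p * t)%N ->
  exists v s : {poly int}, geom d * v = 1 + Phi * s.
Proof.
move=> det; exists (\sum_(j < e) ('X^d) ^+ j), ('X * \sum_(j < t) ('X^p) ^+ j).
apply: (mulfI polyXsub1_neq0); rewrite [LHS]mulrA geomE -subrX1 -exprM det.
set w := \sum_(j < t) _.
have -> : ('X - 1) * (1 + Phi * ('X * w)) = 'X - 1 + 'X * ((('X - 1) * Phi) * w) by ring.
by rewrite geomE -subrX1 -exprM exprD expr1; ring.
Qed.

End Prime.

(** * Torsion-free cyclic quotients and extensions of standard lattices *)

Section Lattice.
Variables (p n : nat) (g : 'M[int]_n.+1).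
Hypothesis p_pr : prime p.
Hypothesis gp : g ^+ p = 1.
Local Notation Phi := (geom p).
Implicit Types (u v h k : 'rV[int]_n.+1) (a b c d : {poly int}) (N M : 'rV[int]_n.+1 -> Prop).

(** Polynomials in [t] act from the right on row vectors, so that the rows of the [P] in
    [standard_rep] form a basis adapted to the blocks. *)
Definition pact v c : 'rV[int]_n.+1 := v *m horner_mx g c.

Lemma pactDl u v c : pact (u + v) c = pact u c + pact v c.
Proof. exact: mulmxDl. Qed.
Lemma pactNl v c : pact (- v) c = - pact v c.
Proof. exact: mulNmx. Qed.
Lemma pactDr v a b : pact v (a + b) = pact v a + pact v b.
Proof. by rewrite /pact rmorphD mulmxDr. Qed.
Lemma pactNr v a : pact v (- a) = - pact v a.
Proof. by rewrite /pact rmorphN mulmxN. Qed.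
Lemma pactM v a b : pact v (a * b) = pact (pact v a) b.
Proof. by rewrite /pact rmorphM /= -mulmxE mulmxA. Qed.
Lemma pactC v (x : int) : pact v x%:P = x *: v.
Proof. by rewrite /pact horner_mx_C mul_mx_scalar. Qed.
Lemma pact1 v : pact v 1 = v.
Proof. by rewrite -polyC1 pactC scale1r. Qed.
Lemma pact0 v : pact v 0 = 0.
Proof. by rewrite -polyC0 pactC scale0r. Qed.
Lemma pact0l c : pact 0 c = 0.
Proof. exact: mul0mx. Qed.
Lemma pactX v : pact v 'X = v *m g.
Proof. by rewrite /pact horner_mx_X. Qed.
Lemma pactXn v i : pact v 'X^i = v *m g ^+ i.
Proof. by rewrite /pact rmorphXn /= horner_mx_X. Qed.
Lemma pact_order v c : pact v (('X - 1) * Phi * c) = 0.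
Proof.
rewrite geomE pactM pactDr pactNr pact1 pactXn gp mulmx1 subrr.
exact: pact0l.
Qed.
Lemma pact_sum v (I : Type) (r : seq I) (P : pred I) (F : I -> {poly int}) :
  pact v (\sum_(i <- r | P i) F i) = \sum_(i <- r | P i) pact v (F i).
Proof. by rewrite /pact rmorph_sum /= mulmx_sumr. Qed.
Lemma pact_lin u v a b c :
  pact (pact u a + pact v b) c = pact u (a * c) + pact v (b * c).
Proof. by rewrite pactDl !pactM. Qed.

Record submod N : Prop := Submod {
  sub0 : N 0;
  subD : forall u v, N u -> N v -> N (u + v);
  subA : forall v c, N v -> N (pact v c) }.

Definition pure N := forall (q : int) v, q != 0 -> N (q *: v) -> N v.

Lemma subN N v : submod N -> N v -> N (- v).
Proof. by move=> sN Nv; rewrite -[v]pact1 -pactNr; apply: subA. Qed.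

Lemma subB N u v : submod N -> N u -> N v -> N (u - v).
Proof. by move=> sN Nu Nv; apply: subD => //; apply: subN. Qed.

Lemma sub_lin N u v a1 b1 a2 b2 c1 c2 a b : submod N ->
  N (pact u a1 + pact v b1) -> N (pact u a2 + pact v b2) ->
  a = a1 * c1 + a2 * c2 -> b = b1 * c1 + b2 * c2 -> N (pact u a + pact v b).
Proof.
move=> sN N1 N2 -> ->; rewrite !pactDr addrACA -!pact_lin.
by apply: subD => //; apply: subA.
Qed.

Definition add_cyclic N h v := exists c, N (v - pact h c).

Lemma add_cyclic_submod N h : submod N -> submod (add_cyclic N h).
Proof.
move=> sN; split=> [|u v [c uc] [d vd]|v c [d vd]].
- by exists 0; rewrite pact0 subr0; apply: sub0.
- by exists (c + d); rewrite pactDr opprD addrACA; apply: subD.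
- by exists (d * c); rewrite pactM -pactNl -pactDl; apply: subA.
Qed.

Lemma add_cyclic_self N h : submod N -> add_cyclic N h h.
Proof. by move=> sN; exists 1; rewrite pact1 subrr; apply: sub0. Qed.

Lemma add_cyclic_sub N h v : N v -> add_cyclic N h v.
Proof. by exists 0; rewrite pact0 subr0. Qed.

(** Generators of the annihilators of the three blocks modulo [X^p - 1]; since [X^p - 1] acts as
    zero everywhere, [Reg] gets the relation [0]. *)
Definition kind_rel (t : std_kind) : {poly int} :=
  match t with Triv => 'X - 1 | Cyclo => Phi | Reg => 0 end.

Definition of_kind N t h := N (pact h (kind_rel t)).

(** For [Reg] the relation is empty, so freeness over the group ring is demanded separately. *)
Definition block_gen N t h := of_kind N t h /\
  (t = Reg -> forall c, N (pact h c) -> exists d, c = ('X - 1) * Phi * d).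

Lemma Phi_neq0 : Phi != 0.
Proof.
apply/eqP => e; have := geom1 p; rewrite e horner0 => /eqP.
by rewrite eq_sym eqz_nat; have := prime_gt0 p_pr; case: p.
Qed.

(** [Phi] takes the value [p] at 1, so [p] lies in the ideal generated by [X - 1] and [Phi]; purity
    of [N] then removes the factor [p]. *)
Lemma kill_by_p N h c : submod N -> pure N ->
  N (pact h (c * ('X - 1))) -> N (pact h (c * Phi)) -> N (pact h c).
Proof.
move=> sN pN N1 N2; have [r er] := poly_at1 Phi; rewrite geom1 in er.
apply: (pN p%:Z); first by have := prime_gt0 p_pr; rewrite eqz_nat lt0n.
rewrite -pactC -pactM.
have -> : c * p%:Z%:P = c * Phi - c * ('X - 1) * r by rewrite er; ring.
by rewrite pactDr pactNr [pact h (_ * r)]pactM; apply: subB => //; apply: subA.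
Qed.

Lemma root1_mul c : c.[1] = 0 -> exists d, c = ('X - 1) * d.
Proof. by move=> c1; have [d] := poly_at1 c; rewrite c1 addr0 => e; exists d. Qed.

(** Trivial lattices, and likewise cyclotomic ones, have no nonsplit extensions by their own kind.
    Multiplying the relation of [h] by the complementary factor of [X^p - 1] shows that [X - 1] and
    [Phi] both take [pact h0 c] into [N]. *)
Lemma same_kind N t h0 h : submod N -> pure N -> t <> Reg ->
  of_kind N t h0 -> of_kind (add_cyclic N h0) t h -> of_kind N t h.
Proof.
move=> sN pN tR f0 [c f1].
have key a b : kind_rel t = a -> a * b = ('X - 1) * Phi -> N (pact h0 (c * b)).
  move=> ea eab; have := subA sN b f1.
  rewrite pactDl pactNl -!pactM ea eab -[_ * Phi]mulr1 pact_order sub0r => H.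
  by rewrite -[pact h0 _]opprK; apply: subN.
have Nc : N (pact h0 c).
  apply: kill_by_p => //; case: t tR f0 key {f1} => //= _ f0 key.
  - by rewrite mulrC pactM; apply: subA.
  - by apply: (key Phi); rewrite // mulrC.
  - exact: (key ('X - 1)).
  - by rewrite mulrC pactM; apply: subA.
by have := subD sN f1 Nc; rewrite subrK.
Qed.

Section Dichotomy.
Variables (N : 'rV[int]_n.+1 -> Prop) (t0 : std_kind) (h0 : 'rV[int]_n.+1).
Hypotheses (sN : submod N) (pN : pure N) (bg : block_gen N t0 h0).

Definition fixable t h := exists2 h', of_kind N t h' & add_cyclic N h0 (h - h').

(** [k] is to take the place of [h0]. The second clause says that, once this is done, no further
    generator meets an obstruction. *)
Definition absorbs k := add_cyclic N k h0 /\
  forall t h, of_kind (add_cyclic N h0) t h ->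
    exists2 h', of_kind N t h' & add_cyclic N k (h - h').

Lemma fix_by t h d : N (pact h (kind_rel t) + pact h0 (- (d * kind_rel t))) -> fixable t h.
Proof.
move=> H; exists (h - pact h0 d).
  by rewrite /of_kind pactDl pactNl -pactM -pactNr.
by exists d; rewrite subKr subrr; apply: sub0.
Qed.

Lemma fix_self t h : of_kind N t h -> fixable t h.
Proof. by move=> H; apply: (@fix_by t h 0); rewrite mul0r oppr0 pact0 addr0. Qed.

(* If [h] cannot be corrected by a multiple of [h0], the obstruction is a nonzero class modulo
   [p], and a cyclotomic unit [geom d] turns [h] into a generator [k] of a regular module. *)
Lemma dichotomy t h : of_kind (add_cyclic N h0) t h -> fixable t h \/
  exists k, [/\ absorbs k, add_cyclic N k h & (kind_size p t0 + kind_size p t = p)%N].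
Proof.
have p0 := prime_gt0 p_pr.
have := bg; rewrite /block_gen /of_kind; case=> f0 freeh [c].
rewrite -pactNr => f1.
case: t0 f0 freeh => f0 freeh; case: t f1 => /= f1; try by left; apply: fix_self; rewrite /of_kind /= pact0; apply: sub0.
- by left; apply: fix_self; apply: (same_kind sN pN _ f0) => //; exists c; rewrite -pactNr.
(* [h0] trivial, [h] cyclotomic: the obstruction is [c.[1]] modulo [p], since multiples of [X - 1]
   kill [h0] and adding [h0] times [b] to [h] changes [c] by [b * Phi]. *)
- have [c1 ec] := poly_at1 c; have [/dvdzP[b eb]|pa] := boolP (p %| c.[1])%Z.
    left; have [D eD] : exists D, c - b%:P * Phi = ('X - 1) * D.
      by apply: root1_mul; rewrite !hornerE geom1 eb; ring.
    apply: (@fix_by Cyclo h b%:P) => /=.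
    apply: (@sub_lin N h h0 Phi (- c) 0 ('X - 1) 1 D) => //.
    - by rewrite pact0 add0r.
    - ring.
    - by rewrite -eD; ring.
  right; have [d [e [s [m [de em]]]]] := inverse_mod_prime p_pr pa.
  (* Chosen so that [c * geom d + m' * Phi - 1] vanishes at 1; then [pact k Phi] is [h0] modulo [N].
     As [geom d] is a unit modulo [Phi], [h] is recovered from [k] too. *)
  pose m' : int := - (s%:Z + d%:Z * m).
  have [v [s' ev]] := geom_unit de.
  have [D eD] : exists D, c * geom d + m'%:P * Phi - 1 = ('X - 1) * D.
    apply: root1_mul; rewrite !hornerE !geom1 em /m'.
    have := congr1 (fun x => x%:Z) de; rewrite PoszD !PoszM => de'; lia.
  exists (pact h (geom d) + pact h0 m'%:P).
  set k := pact h _ + _.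
  have K : N (pact h (geom d * Phi) + pact h0 (m'%:P * Phi - 1)).
    apply: (@sub_lin N h h0 Phi (- c) 0 ('X - 1) (geom d) D) => //.
    - by rewrite pact0 add0r.
    - ring.
    - by rewrite -eD; ring.
  have Kk : N (pact k Phi - h0).
    by rewrite /k pact_lin -{2}[h0]pact1 -addrA -pactNr -pactDr.
  split=> [|| /=]; last by rewrite add1n prednK.
  + split; first by exists Phi; rewrite -opprB; apply: subN.
    move=> [] h' /= ; rewrite /of_kind /=.
    * move=> f'; exists h'; last first.
        by rewrite subrr; exists 0; rewrite pact0 subr0; apply: sub0.
      exact: (same_kind sN pN (t := Triv) (h0 := h0)).
    * move=> _; exists h'; first by rewrite /= pact0; apply: sub0.
      by rewrite subrr; exists 0; rewrite pact0 subr0; apply: sub0.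
    * move=> [c' f']; exists (h' - pact k c'); last first.
        by exists c'; rewrite subKr subrr; apply: sub0.
      rewrite /= pactDl pactNl -pactM mulrC pactM.
      have := subB sN f' (subA sN c' Kk).
      by rewrite [in pact (_ - h0) _]pactDl pactNl opprB addrA subrK.
  + exists (v - Phi * (m'%:P * v + c * s')).
    set C := v - _; rewrite /k pact_lin opprD addrA -{1}[h]pact1 -!pactNr -pactDr.
    apply: (@sub_lin N h h0 Phi (- c) (geom d * Phi) (m'%:P * Phi - 1) (- s') (m'%:P * v + c * s')) => //.
    - have -> : 1 - geom d * C = 1 - geom d * v + geom d * Phi * (m'%:P * v + c * s') by rewrite /C; ring.
      by rewrite ev; ring.
    - rewrite /C; ring.
(* When [h0] is free, multiplying the relation of [h] by the complementary factor and using freeness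
   shows that [c] is divisible by the relation itself, so [h] can be corrected. *)
- left; have [|d ed] := freeh erefl (c * Phi).
    have := subA sN Phi f1; rewrite pact_lin -[_ * Phi]mulr1 pact_order add0r => H.
    by rewrite -[pact h0 _]opprK -pactNr -mulNr; apply: subN; rewrite // -[_ * Phi]mulr1.
  have ec : c = ('X - 1) * d by apply: (mulIf Phi_neq0); rewrite ed; ring.
  by apply: (@fix_by Triv h d) => /=; rewrite mulrC -ec.
- left; have [|d ed] := freeh erefl (c * ('X - 1)).
    have := subA sN ('X - 1) f1; rewrite pact_lin [Phi * _]mulrC -[_ * Phi]mulr1 pact_order add0r => H.
    by rewrite -[pact h0 _]opprK -pactNr -mulNr; apply: subN.
  have ec : c = Phi * d by apply: (mulIf polyXsub1_neq0); rewrite ed; ring.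
  by apply: (@fix_by Cyclo h d) => /=; rewrite mulrC -ec.
- have [/dvdzP[b eb]|pa] := boolP (p %| c.[1])%Z.
    left; have [D eD] : exists D, c - b%:P * Phi = ('X - 1) * D.
      by apply: root1_mul; rewrite !hornerE geom1 eb; ring.
    apply: (@fix_by Triv h D) => /=.
    apply: (@sub_lin N h h0 ('X - 1) (- c) 0 Phi 1 b%:P) => //.
    - by rewrite pact0 add0r.
    - ring.
    - by rewrite [D * _]mulrC -eD; ring.
  (* [h0] cyclotomic, [h] trivial: a multiple of [h0] subtracted from [h] replaces [c] by [geom e],
     which has the same residue at 1. This is a unit modulo [Phi], so [h0] is a multiple of
     [pact k ('X - 1)]. *)
  right; have [d [e [s [m [de em]]]]] := inverse_mod_prime p_pr pa.
  rewrite mulnC in de; have [v [s' ev]] := geom_unit de.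
  have [D eD] : exists D, c - geom e - m%:P * Phi = ('X - 1) * D.
    by apply: root1_mul; rewrite !hornerE !geom1 em; ring.
  exists (h - pact h0 D); set k := h - _.
  have K : N (pact k ('X - 1) + pact h0 (- geom e)).
    rewrite /k pactDl pactNl -pactM -pactNr -addrA -pactDr.
    apply: (@sub_lin N h h0 ('X - 1) (- c) 0 Phi 1 m%:P) => //.
    - by rewrite pact0 add0r.
    - ring.
    - by rewrite [D * _]mulrC -eD; ring.
  have K0 : N (h0 - pact k (('X - 1) * v)).
    rewrite addrC -pactNr -{1}[h0]pact1.
    apply: (@sub_lin N k h0 ('X - 1) (- geom e) 0 Phi (- v) (- s')) => //.
    - by rewrite pact0 add0r.
    - ring.
    - by have -> : - geom e * - v = geom e * v by [ring|]; rewrite ev; ring.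
  split=> [|| /=]; last by rewrite addn1 prednK.
  + split; first by exists (('X - 1) * v).
    move=> [] h' /= ; rewrite /of_kind /=.
    * move=> [c' f']; exists (h' - pact k (v * c')); last first.
        by exists (v * c'); rewrite subKr subrr; apply: sub0.
      rewrite /= pactDl pactNl -pactM.
      have -> : v * c' * ('X - 1) = ('X - 1) * v * c' by ring.
      have := subD sN f' (subA sN c' K0).
      by rewrite [in pact (h0 - _) _]pactDl pactNl -pactM addrA subrK.
    * move=> _; exists h'; first by rewrite /= pact0; apply: sub0.
      by rewrite subrr; exists 0; rewrite pact0 subr0; apply: sub0.
    * move=> f'; exists h'; last first.
        by rewrite subrr; exists 0; rewrite pact0 subr0; apply: sub0.
      exact: (same_kind sN pN (t := Cyclo) (h0 := h0)).
  + exists (1 + ('X - 1) * v * D).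
    have := subA sN D K0; rewrite pactDl pactNl -pactM.
    have hk : h - k = pact h0 D by rewrite /k subKr.
    by rewrite pactDr pact1 opprD addrA hk.
- by left; apply: fix_self; apply: (same_kind sN pN _ f0) => //; exists c; rewrite -pactNr.
Qed.

End Dichotomy.

Local Notation fam := (seq (std_kind * 'rV[int]_n.+1)).

Definition span_fam N (L : fam) := foldr (fun e M => add_cyclic M e.2) N L.
Definition all_in M (L : fam) := foldr (fun e P => M e.2 /\ P) True L.
Definition all_of_kind N (L : fam) := foldr (fun e P => of_kind N e.1 e.2 /\ P) True L.
Definition total_size (L : fam) : nat := foldr (fun e s => kind_size p e.1 + s)%N 0%N L.

Lemma span_submod N L : submod N -> submod (span_fam N L).
Proof. by move=> sN; elim: L => //= e L; apply: add_cyclic_submod. Qed.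

Lemma span_base N L v : N v -> span_fam N L v.
Proof. by move=> Nv; elim: L => //= e L; apply: add_cyclic_sub. Qed.

Lemma all_in_mono M M' L : (forall v, M v -> M' v) -> all_in M L -> all_in M' L.
Proof. by move=> MM; elim: L => //= e L IH [/MM ? /IH]. Qed.

Lemma span_gens N L : submod N -> all_in (span_fam N L) L.
Proof.
move=> sN; elim: L => //= e L IH; split; first exact/add_cyclic_self/span_submod.
by apply: all_in_mono IH => v; apply: add_cyclic_sub.
Qed.

Lemma add_cyclic_min N M h v : submod M -> (forall v, N v -> M v) -> M h ->
  add_cyclic N h v -> M v.
Proof.
move=> sM NM Mh [c /NM Mv]; rewrite -[v](subrK (pact h c)).
by apply: subD => //; apply: subA.
Qed.

Lemma span_min N M L v : submod M -> (forall v, N v -> M v) -> all_in M L ->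
  span_fam N L v -> M v.
Proof.
move=> sM NM; elim: L v => [|e L IH] v /=; first by move=> _; apply: NM.
by move=> [Me ML]; apply: add_cyclic_min => // w; apply: IH.
Qed.

(** Generators are corrected one after another. At most once a trivial and a cyclotomic generator
    merge into a regular one, and this keeps the total size; from then on [h0] is absorbed and every
    remaining generator can be corrected. *)
Lemma extend_family N t0 h0 L : submod N -> pure N -> block_gen N t0 h0 ->
  all_of_kind (add_cyclic N h0) L ->
  (exists L', [/\ all_of_kind N L', total_size L' = total_size L &
     all_in (span_fam N ((t0, h0) :: L')) L]) \/
  (exists L', [/\ all_of_kind N L', total_size L' = (kind_size p t0 + total_size L)%N,
     all_in (span_fam N L') ((t0, h0) :: L) &
     forall t h, of_kind (add_cyclic N h0) t h ->
       exists2 h', of_kind N t h' & span_fam N L' (h - h')]).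
Proof.
move=> sN pN bg; elim: L => [_|[t h] L IH] /=; first by left; exists [::].
move=> [kh /IH] [[L' [kL' sz gens]]|[L' [kL' sz [h0in gens] fix']]].
  case: (dichotomy sN pN bg kh) => [[h' kh' hh']|[k [[kh0 kfix] khh ks]]].
    left; exists ((t, h') :: L'); split=> //=; first by rewrite sz.
    pose M := span_fam N [:: (t0, h0), (t, h') & L'].
    have sM : submod M by apply: span_submod.
    have [M0 [Mh' ML']] : all_in M [:: (t0, h0), (t, h') & L'] by apply: span_gens.
    have NM v : N v -> M v by apply: span_base.
    split.
      rewrite -[h](subrK h'); apply: (subD sM) => //.
      exact: add_cyclic_min hh'.
    by apply: all_in_mono gens => v; apply: span_min.
  right; exists ((Reg, k) :: L').
  pose M := span_fam N ((Reg, k) :: L').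
  have sM : submod M by apply: span_submod.
  have [Mk ML'] : all_in M ((Reg, k) :: L') by apply: span_gens.
  have NM v : N v -> M v by apply: span_base.
  have M0 : M h0 by apply: add_cyclic_min kh0.
  split=> /=.
  - by split=> //; rewrite /of_kind /= pact0; apply: sub0.
  - by rewrite sz addnA ks.
  - split=> //; split; first exact: add_cyclic_min khh.
    by apply: all_in_mono gens => v; apply: span_min.
  - move=> t' x kx; have [x' kx' xx'] := kfix t' x kx; exists x' => //.
    exact: (add_cyclic_min sM NM Mk xx').
have [h' kh' hh'] := fix' t h kh.
right; exists ((t, h') :: L').
pose M := span_fam N ((t, h') :: L').
have sM : submod M by apply: span_submod.
have [Mh' ML'] : all_in M ((t, h') :: L') by apply: span_gens.
have LM v : span_fam N L' v -> M v by apply: add_cyclic_sub.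
split=> //=; first by rewrite sz; lia.
- split; first exact: LM.
  split; first by rewrite -[h](subrK h'); apply: (subD sM) => //; apply: LM.
  by apply: all_in_mono gens.
- by move=> t' x /fix' [x' kx' xx']; exists x' => //; apply: LM.
Qed.

(** Only spanning and a bound on the size are recorded; with [r] the rank of [N], the bound replaces
    linear independence, as [standard_of_family] shows at the end. *)
Definition std_family N (r : nat) := exists L : fam,
  [/\ all_of_kind N L, forall v, span_fam N L v & (total_size L + r <= n.+1)%N].

Lemma std_family_extend N t0 h0 r : submod N -> pure N -> block_gen N t0 h0 ->
  std_family (add_cyclic N h0) (kind_size p t0 + r) -> std_family N r.
Proof.
move=> sN pN bg [L [kL spL sz]].
have all M : submod M -> (forall v, N v -> M v) -> M h0 -> all_in M L -> forall v, M v.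
  move=> sM NM M0 ML v; apply: (span_min sM _ ML (spL v)) => w.
  exact: add_cyclic_min.
case: (extend_family sN pN bg kL) => [[L' [kL' szL' gens]]|[L' [kL' szL' [g0 gens] _]]].
  exists ((t0, h0) :: L'); split=> /=.
  - by split=> //; case: bg.
  - apply: (all (span_fam N ((t0, h0) :: L'))) => //.
    + exact: span_submod.
    + by move=> v; apply: span_base.
    + by apply: add_cyclic_self; apply: span_submod.
  - by lia.
exists L'; split=> //; last by lia.
apply: all => //; first exact: span_submod.
by move=> v; apply: span_base.
Qed.

(** If [h0] is killed by a nonzero polynomial not divisible by [Phi], of degree below [p], then a
    nonzero integer times [X - 1] kills it, and purity drops the integer. A multiple of [Phi] of
    degree below [p] is a constant times [Phi]. Hence torsion-freeness leaves three annihilators. *)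
Lemma block_gen_indep N h0 : submod N -> pure N -> ~ N h0 ->
  exists t0, block_gen N t0 h0 /\
    forall c, (size c <= kind_size p t0)%N -> N (pact h0 c) -> c = 0.
Proof.
move=> sN pN n0.
have sPhi : size Phi = p.
  have H (k : nat) : size (geom k.+1) = k.+1 /\ lead_coef (geom k.+1) = 1.
    elim: k => [|k [IH1 IH2]]; first by rewrite /geom big_ord1 expr0 size_poly1 lead_coef1.
    rewrite /geom big_ord_recr /= -/(geom k.+1) addrC.
    have lt : (size (geom k.+1) < size ('X^(k.+1) : {poly int}))%N by rewrite IH1 size_polyXn.
    by rewrite size_polyDl // lead_coefDl // size_polyXn lead_coefXn.
  by rewrite -(prednK (prime_gt0 p_pr)); have [] := H p.-1.
have const (a : int) w : a != 0 -> N (pact w a%:P) -> N w by rewrite pactC; apply: pN.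
have small c : c <> 0 -> (size c < size Phi)%N -> N (pact h0 c) -> N (pact h0 ('X - 1)) .
  move=> c0 sc Nc; case: (geom_prime_dichotomy p_pr c) => [[r er]|[A [B [m [m0 e]]]]].
    case: c0; apply/eqP; rewrite -[_ == _]negbK; apply/negP => c0.
    have r0 : r != 0 by apply: contra c0 => /eqP r0; rewrite er r0 mulr0.
    move: sc; rewrite er size_mul ?Phi_neq0 // sPhi; move: r0; rewrite -size_poly_gt0.
    by have := prime_gt0 p_pr; move: (size r) => x; lia.
  apply: (const m) => //; rewrite -pactM -e.
  have -> : ('X - 1) * (A * c + B * Phi) = c * (A * ('X - 1)) + ('X - 1) * Phi * B by ring.
  by rewrite pactDr pact_order addr0 pactM; apply: subA.
have [k1|k1] := boolp.lem (N (pact h0 ('X - 1))).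
  exists Triv; split; first by split.
  move=> c /= /size1_polyC ->; have [->//|c0 /const] := eqVneq c`_0 0.
  by move/(_ c0)/n0.
have [k2|k2] := boolp.lem (N (pact h0 Phi)).
  exists Cyclo; split; first by split.
  move=> c /= sc Nc; have [//|/eqP c0] := eqVneq c 0; case: k1; apply: small Nc => //.
  by rewrite sPhi -[X in (_ < X)%N](prednK (prime_gt0 p_pr)) ltnS.
have free c : (size c <= p)%N -> N (pact h0 c) -> c = 0.
  move=> sc Nc; have [//|/eqP c0] := eqVneq c 0.
  case: (geom_prime_dichotomy p_pr c) => [[r er]|[A [B [m [m0 e]]]]].
    exfalso; apply: k2; have r0 : r != 0.
      by apply/eqP => r0; apply: c0; rewrite er r0 mulr0.
    have /size1_polyC rc : (size r <= 1)%N.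
      by move: sc; rewrite er size_mul ?Phi_neq0 // sPhi; have := prime_gt0 p_pr; move: (size r) => x; lia.
    rewrite rc polyC_eq0 in r0; apply: (const r`_0) => //.
    by rewrite -pactM -rc -er.
  exfalso; apply: k1; apply: (const m) => //; rewrite -pactM -e.
  have -> : ('X - 1) * (A * c + B * Phi) = c * (A * ('X - 1)) + ('X - 1) * Phi * B by ring.
  by rewrite pactDr pact_order addr0 pactM; apply: subA.
exists Reg; split=> //; split; first by rewrite /of_kind /= pact0; apply: sub0.
move=> _ c Nc; exists (c %/ ('X^p - 1)).
have mon : ('X^p - 1 : {poly int}) \is monic by rewrite monic_Xn_sub_1 // prime_gt0.
have sX : size ('X^p - 1 : {poly int}) = p.+1 by rewrite size_Xn_sub_1 // prime_gt0.
have := Pdiv.IdomainMonic.divp_eq mon c; rewrite geomE => e.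
suff r0 : c %% ('X^p - 1) = 0 by rewrite {1}e r0 addr0 mulrC.
apply: free.
  by rewrite -ltnS -sX ltn_modp -size_poly_eq0 sX.
have -> : c %% ('X^p - 1) = c - ('X - 1) * Phi * (c %/ ('X^p - 1)).
  by rewrite {2}e geomE; ring.
by rewrite pactDr pactNr pact_order subr0.
Qed.

End Lattice.

(** * Row lattices, rational rank and bases adapted to the blocks *)

Definition rowlat (r m : nat) (W : 'M[int]_(r, m)) (v : 'rV[int]_m) : Prop :=
  exists u, v = u *m W.

Lemma rowlatD r m (W : 'M[int]_(r, m)) u v : rowlat W u -> rowlat W v -> rowlat W (u + v).
Proof. by move=> [a ->] [b ->]; exists (a + b); rewrite mulmxDl. Qed.

Lemma rowlatZ r m (W : 'M[int]_(r, m)) (c : int) v : rowlat W v -> rowlat W (c *: v).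
Proof. by move=> [a ->]; exists (c *: a); rewrite scalemxAl. Qed.

Lemma rowlat0 r m (W : 'M[int]_(r, m)) : rowlat W 0.
Proof. by exists 0; rewrite mul0mx. Qed.

Lemma rowlat_sum r m (W : 'M[int]_(r, m)) (I : Type) (s : seq I) (P : pred I) (F : I -> 'rV_m) :
  (forall i, P i -> rowlat W (F i)) -> rowlat W (\sum_(i <- s | P i) F i).
Proof. by move=> H; apply: big_ind => //; [exact: rowlat0|exact: rowlatD]. Qed.

Lemma rowlat_row r m (W : 'M[int]_(r, m)) i : rowlat W (row i W).
Proof. by exists (delta_mx 0 i); rewrite rowE. Qed.

Local Notation toQ := (map_mx (intr : int -> rat)).

Lemma toQ_inj r m : injective (toQ : 'M_(r, m) -> 'M_(r, m)).
Proof.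
move=> A B /matrixP e; apply/matrixP => i j; have := e i j; rewrite !mxE.
exact: intr_inj.
Qed.

Lemma clear_denominators m (u : 'rV[rat]_m) :
  exists (d : int) (w : 'rV[int]_m), d != 0 /\ d%:~R *: u = toQ w.
Proof.
pose d : int := \prod_j denq (u 0 j).
have d0 : d != 0 by apply/prodf_neq0 => j _; apply: denq_neq0.
exists d, (\row_j (numq (u 0 j) * \prod_(i | i != j) denq (u 0 i))); split=> //.
apply/rowP => j; rewrite !mxE /d (bigD1 j) //= !intrM numqE.
by rewrite mulrAC; congr (_ * _); apply: mulrC.
Qed.

Section PureRowlat.
Variables (r m : nat) (W : 'M[int]_(r, m.+1)).
Hypothesis pW : pure (rowlat W).

(** A rational combination of the rows becomes integral after multiplication by a common
    denominator, which purity then removes. *)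
Lemma rowlat_rat v : (toQ v <= toQ W)%MS -> rowlat W v.
Proof.
move=> /submxP[u e]; have [d [w [d0 dw]]] := clear_denominators u.
apply: (pW d0); exists w; apply: toQ_inj.
rewrite [RHS]map_mxM -dw -scalemxAl -e.
by apply/matrixP => i j; rewrite !mxE intrM.
Qed.

Lemma rank_add_indep s (B : 'M[int]_(s, m.+1)) :
  (forall w : 'rV[int]_s, rowlat W (w *m B) -> w = 0) ->
  (\rank (toQ W) + s <= \rank (toQ (col_mx W B)))%N.
Proof.
move=> indep.
have key (u : 'rV[rat]_s) : (u *m toQ B <= toQ W)%MS -> u = 0.
  move=> uB; have [d [w [d0 dw]]] := clear_denominators u.
  have w0 : w = 0.
    apply: indep; apply: rowlat_rat; rewrite map_mxM -dw -scalemxAl.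
    exact: scalemx_sub.
  have := dw; rewrite w0 map_mx0 => /eqP; rewrite scaler_eq0 intr_eq0 (negbTE d0).
  by move/eqP.
have free : row_free (toQ B).
  rewrite -kermx_eq0; apply/rowV0P => v /sub_kermxP vB.
  by apply: key; rewrite vB sub0mx.
have disj : (toQ W :&: toQ B)%MS = 0.
  apply/eqP/rowV0P => v; rewrite sub_capmx => /andP[vW /submxP[u uB]].
  by rewrite uB in vW *; rewrite (key u vW) mul0mx.
rewrite map_col_mx -addsmxE (mxrank_disjoint_sum disj).
by rewrite (eqP free).
Qed.
End PureRowlat.

Section LatticeChain.
Variables (p n : nat) (g : 'M[int]_n.+1).
Hypothesis p_pr : prime p.
Hypothesis gp : g ^+ p = 1.
Implicit Types (v h : 'rV[int]_n.+1).

Definition orbit_mx h : 'M[int]_(p, n.+1) := \matrix_(i < p) (h *m g ^+ i).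

Lemma orbit_mx_pact h c : rowlat (orbit_mx h) (pact g h c).
Proof.
rewrite -[c]coefK poly_def pact_sum; apply: rowlat_sum => i _.
rewrite -mul_polyC mulrC pactM pactC pactXn; apply: rowlatZ.
have -> : g ^+ i = g ^+ (i %% p).
  by rewrite {1}(divn_eq i p) exprD mulnC exprM gp expr1n mul1r.
have ip : (i %% p < p)%N by rewrite ltn_mod prime_gt0.
have := rowlat_row (orbit_mx h) (Ordinal ip); rewrite rowK; exact.
Qed.

Lemma rowlat_orbit r (W : 'M[int]_(r, n.+1)) h :
  rowlat (col_mx W (orbit_mx h)) = add_cyclic g (rowlat W) h.
Proof.
apply/boolp.funext => v; apply/boolp.propext; split.
  move=> [u ->]; rewrite -[u]hsubmxK mul_row_col.
  exists (\sum_i (rsubmx u 0 i)%:P * 'X^i); exists (lsubmx u).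
  suff -> : pact g h (\sum_i (rsubmx u 0 i)%:P * 'X^i) = rsubmx u *m orbit_mx h by rewrite addrK.
  rewrite pact_sum mulmx_sum_row; apply: eq_bigr => i _.
  by rewrite rowK mulrC pactM pactC pactXn.
move=> [c [u e]]; have [w ew] := orbit_mx_pact h c.
by exists (row_mx u w); rewrite mul_row_col -e -ew subrK.
Qed.

Lemma rowlat_orbit_rank r (W : 'M[int]_(r, n.+1)) h : submod g (rowlat W) -> pure (rowlat W) ->
  ~ rowlat W h -> exists t0, block_gen p g (rowlat W) t0 h /\
   (kind_size p t0 + \rank (toQ W) <= \rank (toQ (col_mx W (orbit_mx h))))%N.
Proof.
move=> sW pW nh; have [t0 [bg indep]] := block_gen_indep p_pr gp sW pW nh.
exists t0; split=> //.
have tp : (kind_size p t0 <= p)%N by case: t0 {bg indep} => //=; [exact: prime_gt0|exact: leq_pred].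
pose B : 'M[int]_(kind_size p t0, n.+1) := \matrix_(i < kind_size p t0) (h *m g ^+ i).
rewrite addnC; apply: leq_trans (rank_add_indep pW (B := B) _) _.
  move=> w wB; pose c : {poly int} := \sum_i (w 0 i)%:P * 'X^i.
  have cB : pact g h c = w *m B.
    rewrite pact_sum mulmx_sum_row; apply: eq_bigr => i _.
    by rewrite rowK mulrC pactM pactC pactXn.
  have cE : c = \poly_(i < kind_size p t0) (if insub i is Some j then w 0 j else 0).
    by rewrite poly_def; apply: eq_bigr => i _; rewrite valK mul_polyC.
  have c0 : c = 0 by apply: indep; rewrite ?cB // cE size_poly.
  apply/rowP => j; have := congr1 (fun q : {poly int} => q`_j) c0.
  by rewrite cE coef_poly ltn_ord valK coef0 mxE.
apply: mxrankS; rewrite !map_col_mx -!addsmxE; apply: addsmxS => //.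
apply/row_subP => i.
have -> : row i (toQ B) = row (widen_ord tp i) (toQ (orbit_mx h)).
  by rewrite -!map_row !rowK.
exact: row_sub.
Qed.

(** [Good] isolates what geometry has to supply. Each new orbit raises the rational rank by the size
    of a block, so the chain reaches the full lattice; the standard family is built on the way back
    down. *)
Lemma std_family_chain (Good : forall r, 'M[int]_(r, n.+1) -> Prop) :
  (forall r (W : 'M_(r, n.+1)), Good r W -> pure (rowlat W)) ->
  (forall r (W : 'M_(r, n.+1)), Good r W -> (exists v, ~ rowlat W v) ->
     exists2 h, ~ rowlat W h & Good (r + p)%N (col_mx W (orbit_mx h))) ->
  forall r (W : 'M_(r, n.+1)), Good r W -> submod g (rowlat W) ->
  std_family p g (rowlat W) (\rank (toQ W)).
Proof.
move=> gpure gnext r W.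
have [k] := ubnP (n.+1 - \rank (toQ W)); elim: k r W => // k IH r W.
rewrite ltnS => kW gW sW; have pW := gpure r W gW.
have [[v nv]|full] := boolp.lem (exists v, ~ rowlat W v); last first.
  exists [::]; split=> //= [v|]; last exact: rank_leq_col.
  by apply: boolp.contrapT => nv; apply: full; exists v.
have [|h nh gW'] := gnext r W gW; first by exists v.
have [t0 [bg rk]] := rowlat_orbit_rank sW pW nh.
apply: (std_family_extend p_pr gp sW pW bg); rewrite -rowlat_orbit.
have t0p : (0 < kind_size p t0)%N.
  by case: t0 {bg rk} => //=; [exact: prime_gt0|rewrite -ltnS prednK ?prime_gt1 ?prime_gt0].
have rn : (\rank (toQ (col_mx W (orbit_mx h))) <= n.+1)%N by exact: rank_leq_col.
have [|//||L [kL sL tL]] := IH _ (col_mx W (orbit_mx h)).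
- by move: kW rk rn t0p; set a := \rank _; set b := \rank _; lia.
- by rewrite rowlat_orbit; apply: add_cyclic_submod.
by exists L; split=> //; apply: leq_trans tL; rewrite leq_add2l.
Qed.

(* The rows [r_i] of the cyclotomic block solve [r_i g = r_(i-1) - r_(p-2)], [r_(p-2) = h]. *)
Definition block_rows (t : std_kind) h : 'M[int]_(kind_size p t, n.+1) :=
  match t as t' return 'M[int]_(kind_size p t', n.+1) with
  | Triv => h
  | Reg => \matrix_(i < p) (h *m g ^+ (p.-1 - i))
  | Cyclo => \matrix_(i < p.-1) pact g h (geom (p.-1 - i))
  end.

Lemma sum_delta m (F : 'I_m -> 'rV[int]_n.+1) (b : 'I_m -> bool) (j : 'I_m) :
  (forall i, b i = (i == j)) -> \sum_i (b i)%:R *: F i = F j.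
Proof.
move=> bj; rewrite (bigD1 j) //= bj eqxx scale1r big1 ?addr0 // => i ij.
by rewrite bj (negbTE ij) scale0r.
Qed.

Lemma block_rows_intertwine t h : pact g h (kind_rel p t) = 0 ->
  std_block p t *m block_rows t h = block_rows t h *m g.
Proof.
have p0 := prime_gt0 p_pr; have p1 := prime_gt1 p_pr.
case: t => /= rel.
- by rewrite mul1mx; move: rel; rewrite pactDr pactNr pact1 pactX => /eqP; rewrite subr_eq0 => /eqP.
- apply/row_matrixP => i; rewrite !row_mul rowK -mulmxA mulmxE -exprSr mulmx_sum_row.
  have [j [jE jb]] : exists j : 'I_p, h *m g ^+ (p.-1 - j) = h *m g ^+ (p.-1 - i).+1 /\
      forall k : 'I_p, (i == (k.+1 %% p)%N :> nat) = (k == j).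
    case: i => [[|i] ip].
      have lp : (p.-1 < p)%N by rewrite prednK.
      exists (Ordinal lp); split; first by rewrite subnn subn0 prednK // gp expr0.
      move=> k /=; have := ltn_ord k; rewrite -val_eqE /=.
      have [kp|kp] := eqVneq (k : nat) p.-1; first by rewrite kp prednK // modnn eqxx.
      by move=> kl; rewrite modn_small //; lia.
    have lp : (i < p)%N by exact: ltnW.
    exists (Ordinal lp); split=> [|k]; first by congr (_ *m g ^+ _) => /=; lia.
    have := ltn_ord k; rewrite -val_eqE /=.
    have [kp|kp] := eqVneq (k : nat) p.-1; first by rewrite kp prednK // modnn; lia.
    by move=> kl; rewrite modn_small //; lia.
  rewrite -jE; have -> : h *m g ^+ (p.-1 - j) = row j (block_rows Reg h) by rewrite rowK.
  rewrite -(sum_delta (fun k => row k (block_rows Reg h)) jb).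
  by apply: eq_bigr => k _; rewrite !mxE.
- apply/row_matrixP => i; rewrite !row_mul rowK mulmx_sum_row.
  have lp : (p.-2 < p.-1)%N by have := ltn_ord i; lia.
  have gX m : geom m * 'X = geom m.+1 - 1.
    rewrite /geom big_ord_recl /= expr0 [1 + _]addrC addrK mulr_suml.
    by apply: eq_bigr => k _; rewrite -exprSr.
  rewrite -pactX -pactM gX pactDr pactNr pact1.
  under eq_bigr => j _ do rewrite mxE !mxE.
  rewrite (eq_bigr (fun j : 'I_p.-1 => (i == j.+1 :> nat)%:R *: row j (block_rows Cyclo h) -
      (j == p.-2 :> nat)%:R *: row j (block_rows Cyclo h))); last first.
    move=> j _; rewrite -scalerBl; congr (_ *: _).
    case: eqP => [->|_]; last by rewrite subr0.
    by rewrite ltn_eqF ?sub0r //; have := ltn_ord i; lia.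
  rewrite big_split /= sumrN; congr (_ - _); last first.
    rewrite (@sum_delta _ _ _ (Ordinal lp)) // rowK /=.
    have -> : (p.-1 - p.-2 = 1)%N by have := ltn_ord i; lia.
    by rewrite /geom big_ord1 expr0 pact1.
  case: i => [[|i] ip] /=.
    by rewrite subn0 prednK // rel big1 // => j _; rewrite scale0r.
  have li : (i < p.-1)%N by exact: ltnW.
  rewrite (@sum_delta _ _ _ (Ordinal li)) => [|k]; last by rewrite eqSS eq_sym.
  by rewrite rowK /=; congr (pact _ _ (geom _)); lia.
Qed.

Lemma block_rows_span t h c : pact g h (kind_rel p t) = 0 ->
  rowlat (block_rows t h) (pact g h c).
Proof.
move=> rel; have p0 := prime_gt0 p_pr.
have [u ->] := orbit_mx_pact h c.
rewrite mulmx_sum_row; apply: rowlat_sum => i _; apply: rowlatZ; rewrite rowK.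
case: t rel => /= rel.
- have hg : h *m g = h.
    by move: rel; rewrite pactDr pactNr pact1 pactX => /eqP; rewrite subr_eq0 => /eqP.
  exists 1%:M; rewrite mul1mx; elim: (i : nat) => [|k IH]; first by rewrite expr0 mulmx1.
  by rewrite exprS -mulmxE mulmxA hg.
- have := rowlat_row (block_rows Reg h) (rev_ord i); rewrite rowK /=.
  by have -> : (p.-1 - (p - i.+1) = i)%N by have := ltn_ord i; lia.
- have G m : (m <= p)%N -> rowlat (block_rows Cyclo h) (pact g h (geom m)).
    case: m => [_|m]; first by rewrite /geom big_ord0 pact0; apply: rowlat0.
    rewrite leq_eqVlt => /orP[/eqP -> |mp]; first by rewrite rel; apply: rowlat0.
    have lm : (p.-1 - m.+1 < p.-1)%N by lia.
    have := rowlat_row (block_rows Cyclo h) (Ordinal lm); rewrite rowK /=.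
    by have -> : (p.-1 - (p.-1 - m.+1) = m.+1)%N by lia.
  (* A power is the difference of two consecutive geometric sums, and these are the rows of the
     cyclotomic block. *)
  have -> : h *m g ^+ i = pact g h (geom i.+1) + (-1) *: pact g h (geom i).
    by rewrite /geom big_ord_recr /= pactDr pactXn scaleN1r addrC addKr.
  by apply: rowlatD; [apply: G|apply/rowlatZ/G/ltnW].
Qed.

Lemma cast_intertwine m k (e : m = k) (D : 'M[int]_m) (P : 'M[int]_(m, k)) (Q : 'M[int]_(k, m))
  (A : 'M[int]_k) : Q *m P = 1%:M -> D *m P = P *m A ->
  castmx (e, erefl k) P \in unitmx /\
  castmx (e, erefl k) P *m A = castmx (e, e) D *m castmx (e, erefl k) P.
Proof.
case: k / e P Q A => P Q A QP DP; rewrite !castmx_id; split=> //.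
by have [] := mulmx1_unit QP.
Qed.

Lemma all_in_nth (M : 'rV[int]_n.+1 -> Prop) (L : seq (std_kind * 'rV[int]_n.+1)) :
  (forall i, (i < size L)%N -> M (nth (Triv, 0) L i).2) -> all_in M L.
Proof.
elim: L => //= e L IH H; split; first exact: (H 0%N).
by apply: IH => i iL; apply: (H i.+1).
Qed.

(** The block rows span the lattice, which gives a left inverse of [P] and at least [n.+1] rows; the
    bound in [std_family] gives at most that many. So [P] is square and unimodular. *)
Lemma standard_of_family : std_family p g (fun v => v = 0) 0 -> standard_rep p g.
Proof.
move=> [L [kL spL sz]].
have kn i : (i < size L)%N -> pact g (nth (Triv, 0) L i).2 (kind_rel p (nth (Triv, 0) L i).1) = 0.
  by elim: L kL i {spL sz} => //= e L IH [ke kL] [|i] //; apply: IH.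
pose t (i : 'I_(size L)) := (nth (Triv, 0) L i).1.
pose h (i : 'I_(size L)) := (nth (Triv, 0) L i).2.
have total : total_size p L = (\sum_(i < size L) kind_size p (t i))%N.
  rewrite /t; elim: {kL spL sz kn t h} L => [|e L IH] /=; first by rewrite big_ord0.
  by rewrite big_ord_recl /= IH.
pose P := \mxcol_i block_rows (t i) (h i).
have rel i : pact g (h i) (kind_rel p (t i)) = 0 by apply: kn.
have DP : \mxdiag_i std_block p (t i) *m P = P *m g.
  rewrite mul_mxdiag_mxcol mxcol_mul; apply: eq_mxcol => i.
  exact: block_rows_intertwine.
have inP i : rowlat P (h i).
  have [u e] := block_rows_span 1 (rel i); rewrite pact1 in e.
  exists (u *m submxcol 1%:M i); rewrite -mulmxA submxcol_mul mul1mx.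
  by rewrite mxcolK.
have sP : submod g (rowlat P).
  split; [exact: rowlat0|exact: rowlatD|move=> v c rv].
  rewrite -[c]coefK poly_def pact_sum; apply: rowlat_sum => i _.
  rewrite -mul_polyC mulrC pactM pactC pactXn; apply: rowlatZ.
  elim: (i : nat) => [|k [u IH]]; first by rewrite expr0 mulmx1.
  by exists (u *m \mxdiag_i std_block p (t i)); rewrite exprSr -mulmxE mulmxA IH -mulmxA -DP mulmxA.
have all v : rowlat P v.
  apply: (span_min sP _ _ (spL v)) => [_ ->|]; first exact: rowlat0.
  by apply: all_in_nth => i iL; apply: (inP (Ordinal iL)).
have [Q QP] : exists Q, Q *m P = 1%:M.
  have /boolp.choice[f ef] : forall i : 'I_n.+1, exists u, row i 1%:M = u *m P by move=> i; apply: all.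
  exists (\matrix_i f i); apply/row_matrixP => i.
  by rewrite row_mul rowK -ef.
have e : (\sum_(i < size L) kind_size p (t i))%N = n.+1.
  apply/eqP; rewrite eqn_leq (mulmx1_min QP) andbT -total.
  by move: sz; rewrite addn0.
have [uP eP] := cast_intertwine e QP DP.
by exists (size L), t, e, (castmx (e, erefl n.+1) P).
Qed.

End LatticeChain.

(** * Cuts and nested families *)
Local Open Scope classical_set_scope.

Section CardSet.
Variable T : choiceType.
Implicit Types X Y : set T.

Definition card_set X : nat := #|` fset_set X|.

Lemma card_set_le X Y : finite_set Y -> X `<=` Y -> (card_set X <= card_set Y)%N.
Proof.
move=> fY XY; apply: fsubset_leq_card; rewrite -fset_set_sub //.
exact: sub_finite_set fY.
Qed.

Lemma card_setUI X Y : finite_set X -> finite_set Y ->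
  (card_set (X `|` Y) + card_set (X `&` Y) = card_set X + card_set Y)%N.
Proof. by move=> fX fY; rewrite /card_set fset_setU // fset_setI // cardfsUI. Qed.

Lemma card_set_lt X Y a : finite_set Y -> X `<=` Y -> Y a -> ~ X a ->
  (card_set X < card_set Y)%N.
Proof.
move=> fY XY Ya Xa; have fX := sub_finite_set XY fY.
apply: fproper_ltn_card; rewrite fproperEneq; apply/andP; split; last first.
  by rewrite -fset_set_sub.
by apply/eqP => /(fset_set_inj fX fY) e; apply: Xa; rewrite e.
Qed.

Lemma card_set_gt0 X a : finite_set X -> X a -> (0 < card_set X)%N.
Proof.
move=> fX Xa; apply: leq_ltn_trans (@card_set_lt set0 X a fX _ Xa _) => //.
Qed.

Lemma card_set_eq0 X a : finite_set X -> card_set X = 0%N -> ~ X a.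
Proof. by move=> fX X0 /(card_set_gt0 fX); rewrite X0. Qed.

End CardSet.

Lemma card_set_image (T U : choiceType) (f : T -> U) (X : set T) :
  injective f -> finite_set X -> card_set (f @` X) = card_set X.
Proof.
by move=> fI fX; rewrite /card_set fset_set_image // card_imfset.
Qed.

Section Crossing.
Variable V : Type.
Implicit Types A C D : set V.

Definition cross A C := [/\ (A `&` C) !=set0, (A `&` ~` C) !=set0,
  (~` A `&` C) !=set0 & (~` A `&` ~` C) !=set0].

Lemma crossC A C : cross A C -> cross C A.
Proof. by case=> a b c d; split; rewrite setIC. Qed.

Lemma crossNr A C : cross A (~` C) <-> cross A C.
Proof.
have H B : cross A B -> cross A (~` B) by case=> a b c d; split; rewrite ?setCK.
by split=> [/H|]; [rewrite setCK|apply: H].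
Qed.

Lemma crossNl A C : cross (~` A) C <-> cross A C.
Proof. by split=> /crossC/crossNr/crossC. Qed.

(** If [D] crossed the corner, both [D] and its complement would meet [A] and [C]; nestedness then
    puts one of the two inside [A] and one inside [C]. The same one would lie in the corner, and
    different ones would leave the opposite corner empty. *)
Lemma not_cross_corner A C D :
  cross A C -> ~ cross D A -> ~ cross D C -> ~ cross D (A `&` C).
Proof.
move=> [_ _ _ [z [zA zC]]] DA DC [[a [aD [aA aC]]] [b [bD bAC]] [c [cD [cA cC]]] [d [dD dAC]]].
have HA : D `<=` A \/ ~` D `<=` A.
  apply: contrapT => H; apply: DA; split; [by exists a| |by exists c|].
    apply: contrapT => K; apply: H; left=> x xD; apply: contrapT => xA.
    by apply: K; exists x.
  apply: contrapT => K; apply: H; right=> x xD; apply: contrapT => xA.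
  by apply: K; exists x.
have HC : D `<=` C \/ ~` D `<=` C.
  apply: contrapT => H; apply: DC; split; [by exists a| |by exists c|].
    apply: contrapT => K; apply: H; left=> x xD; apply: contrapT => xA.
    by apply: K; exists x.
  apply: contrapT => K; apply: H; right=> x xD; apply: contrapT => xA.
  by apply: K; exists x.
case: HA HC => HA [] HC.
- by apply: bAC; split; [apply: HA|apply: HC].
- by apply: zC; apply: HC => /HA.
- by apply: zA; apply: HA => /HC.
- by apply: dAC; split; [apply: HA|apply: HC].
Qed.

(** Together with [not_cross_corner] this makes the number of crossings submodular, as used in
    [optimal_nested_corner]. *)
Lemma cross_both_corners A C D :
  cross D (A `&` C) -> cross D (~` A `&` ~` C) -> cross D A.
Proof.
move=> [[a [aD [aA aC]]] _ [c [cD [cA cC]]] _].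
by move=> [[b [bD [bA bC]]] _ [d [dD [dA dC]]] _]; split; [exists a|exists b|exists c|exists d].
Qed.

Lemma not_cross_subset A C : ~ cross A (A `&` C).
Proof. by move=> [_ _ [x [xA []]]]. Qed.

Lemma cross_preimage (s : V -> V) A C :
  cross (s @^-1` A) (s @^-1` C) -> cross A C.
Proof. by move=> [[a ?] [b ?] [c ?] [d ?]]; split; [exists (s a)|exists (s b)|exists (s c)|exists (s d)]. Qed.

End Crossing.

Section Cuts.
Variables (V : choiceType) (S : finType) (R : S -> V -> V).
Implicit Types A C D U : set V.

Definition cut_edges A : set (V * S) :=
  [set e | (A e.1 /\ ~ A (R e.2 e.1)) \/ (~ A e.1 /\ A (R e.2 e.1))].

Definition is_cut A := finite_set (cut_edges A).
Definition cut_size A := card_set (cut_edges A).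

Lemma cut_edgesC A : cut_edges (~` A) = cut_edges A.
Proof.
apply/seteqP; split=> e /=; rewrite /cut_edges /setC /=.
  by case=> -[a b]; [right; split=> //; apply: contrapT|left; split=> //; apply: contrapT].
by case=> -[a b]; [right|left]; split=> // x; apply: x.
Qed.

Lemma is_cutC A : is_cut A -> is_cut (~` A).
Proof. by rewrite /is_cut cut_edgesC. Qed.

Lemma cut_sizeC A : cut_size (~` A) = cut_size A.
Proof. by rewrite /cut_size cut_edgesC. Qed.

Lemma cut_edgesI A C : cut_edges (A `&` C) `<=` cut_edges A `|` cut_edges C.
Proof.
move=> e; rewrite /cut_edges /setI /setU /=.
have [a|a] := lem (A e.1); have [b|b] := lem (A (R e.2 e.1));
have [c|c] := lem (C e.1); have [d|d] := lem (C (R e.2 e.1)); tauto.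
Qed.

Lemma is_cutI A C : is_cut A -> is_cut C -> is_cut (A `&` C).
Proof.
by move=> fA fC; apply: sub_finite_set (@cut_edgesI A C) _; rewrite finite_setU.
Qed.

Lemma is_cutU A C : is_cut A -> is_cut C -> is_cut (A `|` C).
Proof.
move=> /is_cutC fA /is_cutC fC; rewrite -(setCK (A `|` C)) setCU.
exact/is_cutC/is_cutI.
Qed.

Lemma cut_size_corners A C : is_cut A -> is_cut C ->
  (cut_size (A `&` C) + cut_size (~` A `&` ~` C) <= cut_size A + cut_size C)%N.
Proof.
move=> fA fC; rewrite -setCU cut_sizeC /cut_size.
rewrite -card_setUI; [|exact: is_cutI|exact: is_cutU].
rewrite -[X in (_ <= X)%N]card_setUI //.
apply: leq_add; apply: card_set_le.
- by rewrite finite_setU; split.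
- move=> e [/cut_edgesI//|]; rewrite -cut_edgesC setCU => /cut_edgesI.
  by rewrite !cut_edgesC.
- exact: finite_setIl.
move=> e; rewrite /cut_edges /setI /setU /=.
have [a|a] := lem (A e.1); have [b|b] := lem (A (R e.2 e.1));
have [c|c] := lem (C e.1); have [d|d] := lem (C (R e.2 e.1)); tauto.
Qed.

(** Connectedness of the graph on [A] with the edges in [D] deleted, phrased through closed subsets
    instead of paths. *)
Definition connected_off (D : set (V * S)) A := forall U, U `<=` A -> U !=set0 ->
  (forall v s, ~ D (v, s) -> A v -> A (R s v) -> (U v <-> U (R s v))) -> A `<=` U.

Definition bond A := [/\ is_cut A, connected_off set0 A & connected_off set0 (~` A)].

(** Walk from [u] to [v] avoiding [D]: any such cut uses one of the finitely many edges of the walk,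
    and deleting that edge lowers [k]. If there is no walk, the component of [u] is the only
    possible cut. *)
Lemma finite_bonds_off k (D : set (V * S)) u v : finite_set
  [set A | [/\ A u, ~ A v, connected_off D A, connected_off D (~` A) & is_cut A] /\
           (card_set (cut_edges A `\` D) <= k)%N].
Proof.
elim: k D => [|k IH] D.
(* The component of [u] off [D]. A walk is remembered only through its list of edges and the fact
   that every cut between its ends meets this list. *)
all: pose U := [set x | exists l : seq (V * S), (forall e, e \in l -> ~ D e) /\
  forall A, A u -> ~ A x -> exists2 e, e \in l & cut_edges A e].
all: have Uu : U u by exists [::]; split.
all: have Ucl x s : ~ D (x, s) -> (U x <-> U (R s x)) by
  move=> nD; split=> -[l [lD lA]]; exists ((x, s) :: l); split=> [e|A Au nA];
  [ rewrite inE => /orP[/eqP->//|/lD//]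
  | have [Ax|nAx] := lem (A x);
    [ exists (x, s); rewrite ?mem_head //; left
    | have [e el ee] := lA A Au nAx; exists e => //; rewrite inE el orbT ]
  | rewrite inE => /orP[/eqP->//|/lD//]
  | have [Ax|nAx] := lem (A (R s x));
    [ exists (x, s); rewrite ?mem_head //; right
    | have [e el ee] := lA A Au nAx; exists e => //; rewrite inE el orbT ]].
all: have [[l [lD lA]]|nUv] := lem (U v); last first.
1,3: apply: (@sub_finite_set _ _ [set U]); last exact: finite_set1.
1,2: move=> A [[Au nAv cA cA' _] _] /=; apply/seteqP; split=> x.
1,3: move=> Ax; suff /(_ x Ax) [] : A `<=` A `&` U by [].
1,2: apply: cA => [y []//||y s nD Ay As]; [by exists u|rewrite /setI /=].
1,2: by have := Ucl y s nD; tauto.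
1,2: move=> Ux; apply: contrapT => nAx; suff /(_ x nAx) [] : ~` A `<=` ~` A `&` ~` U by [].
1,2: apply: cA' => [y []//||y s nD Ay As]; [by exists v|rewrite /setI /setC /=].
1,2: by have := Ucl y s nD; rewrite /setC /= in Ay As; tauto.
- apply: (@sub_finite_set _ _ set0); last exact: finite_set0.
  move=> A [[Au nAv _ _ fA]]; rewrite leqn0 => /eqP A0.
  have [e /lD eD eA] := lA A Au nAv.
  by apply: (card_set_eq0 (a := e) _ A0); [exact: finite_setD|split].
- apply: (@sub_finite_set _ _ (\bigcup_(e in [set` l])
    [set A | [/\ A u, ~ A v, connected_off (D `|` [set e]) A,
     connected_off (D `|` [set e]) (~` A) & is_cut A] /\
     (card_set (cut_edges A `\` (D `|` [set e])) <= k)%N])); last first.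
    by apply: bigcup_finite => [|e _]; [exact: finite_seq|exact: IH].
  move=> A [[Au nAv cA cA' fA] kA]; have [e el eA] := lA A Au nAv.
  exists e => //=; split; last first.
    rewrite -ltnS; apply: leq_trans kA; apply: (@card_set_lt _ _ _ e).
    - exact: finite_setD.
    - by move=> x [xA xD]; split=> // Dx; apply: xD; left.
    - by split=> //; exact: lD.
    - by move=> [_ nD]; apply: nD; right.
  have sub B : connected_off D B -> ~ (B e.1 /\ B (R e.2 e.1)) ->
      connected_off (D `|` [set e]) B.
    move=> cB nB X XB X0 Xcl; apply: cB => // x s nD Bx Bs; apply: Xcl => //.
    by case=> // -/= xe; apply: nB; rewrite -xe.
  split=> //; apply: sub => //; case: eA; rewrite /setC /=; tauto.
Qed.

Lemma finite_bonds k u v :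
  finite_set [set A | [/\ A u, ~ A v, bond A & (cut_size A <= k)%N]].
Proof.
apply: sub_finite_set (finite_bonds_off k set0 u v) => A [Au nAv [fA cA cA'] kA].
by split=> //; rewrite setD0.
Qed.

(** [D] is connected and meets both sides of [A], so it contains the source of an edge cut by [A];
    so does its complement. Hence [D] separates two vertices from a finite list. *)
Lemma finite_crossing_bonds A k : is_cut A ->
  finite_set [set D | [/\ bond D, (cut_size D <= k)%N & cross D A]].
Proof.
move=> fA.
apply: (@sub_finite_set _ _ (\bigcup_(e in cut_edges A) \bigcup_(e' in cut_edges A)
   [set D | [/\ D e.1, ~ D e'.1, bond D & (cut_size D <= k)%N]])); last first.
  by apply: bigcup_finite => // e _; apply: bigcup_finite => // e' _; exact: finite_bonds.
have H D : connected_off set0 D -> (D `&` A) !=set0 -> (D `&` ~` A) !=set0 ->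
    exists2 e, cut_edges A e & D e.1.
  move=> cD DA [x [xD xA]]; apply: contrapT => nE.
  suff /(_ x xD) [_ /xA//] : D `<=` D `&` A.
  apply: cD => // y s _ Dy Ds.
  have : ~ cut_edges A (y, s) by move=> E; apply: nE; exists (y, s).
  by rewrite /cut_edges /setI /=; have [a|a] := lem (A y); have [b|b] := lem (A (R s y)); tauto.
move=> D [[fD cD cD'] kD [a b c d]].
have [e eA eD] := H D cD a b; have [e' eA' eD'] := H (~` D) cD' c d.
by exists e => //; exists e'.
Qed.

(* Models the sets whose flux lies in a given sublattice of [Hom(F, Z)]. *)
Record additive_class (I : set V -> Prop) : Prop := AdditiveClass {
  add_class0 : I set0;
  add_classC : forall A, I A -> I (~` A);
  add_classU : forall A C, is_cut A -> is_cut C -> A `&` C = set0 ->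
    I A -> I C -> I (A `|` C) }.

Definition minimal_outside (I : set V -> Prop) A := [/\ is_cut A, ~ I A &
  forall C, is_cut C -> ~ I C -> (cut_size A <= cut_size C)%N].

Hypothesis graph_connected : forall U, U !=set0 ->
  (forall v s, U v <-> U (R s v)) -> U = setT.

Section AdditiveClass.
Variables (I : set V -> Prop) (addI : additive_class I).

Lemma add_class_split A C : is_cut A -> is_cut C -> I (A `&` C) -> I (A `&` ~` C) -> I A.
Proof.
move=> fA fC I1 I2; rewrite -(setUIDK A C) setDE; apply: add_classU => //.
- exact: is_cutI.
- exact/is_cutI/is_cutC.
- by rewrite setIACA setICr setI0.
Qed.

Lemma add_classNC A : ~ I A -> ~ I (~` A).
Proof. by move=> nA /(add_classC addI); rewrite setCK. Qed.

Lemma minimal_outsideC A : minimal_outside I A -> minimal_outside I (~` A).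
Proof.
by case=> fA nA mA; split; [exact: is_cutC|exact: add_classNC|rewrite cut_sizeC].
Qed.

(** Two adjacent corners inside the class would put a side of [A] or [C] inside it. So every
    adjacent pair has a corner outside, which forces an opposite pair outside. *)
Lemma outside_corners A C : is_cut A -> is_cut C -> ~ I A -> ~ I C ->
  (~ I (A `&` C) /\ ~ I (~` A `&` ~` C)) \/ (~ I (A `&` ~` C) /\ ~ I (~` A `&` C)).
Proof.
move=> fA fC nA nC.
have nA' := add_classNC nA; have nC' := add_classNC nC.
have H1 := add_class_split fA fC; have H2 := add_class_split fC fA.
have H3 := add_class_split (is_cutC fA) fC; have H4 := add_class_split (is_cutC fC) fA.
rewrite ![C `&` _]setIC ![~` C `&` _]setIC in H2 H4.
have [a|a] := lem (I (A `&` C)); have [b|b] := lem (I (A `&` ~` C));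
have [c|c] := lem (I (~` A `&` C)); have [d|d] := lem (I (~` A `&` ~` C)); tauto.
Qed.

Lemma cut_edges_proper U : U !=set0 -> (~` U) !=set0 -> cut_edges U !=set0.
Proof.
move=> U0 [x nUx]; apply: contrapT => nE; apply: nUx.
rewrite (graph_connected U0) // => v s.
have : ~ cut_edges U (v, s) by move=> E; apply: nE; exists (v, s).
by rewrite /cut_edges /=; have [a|a] := lem (U v); have [b|b] := lem (U (R s v)); tauto.
Qed.

(** A disconnected [A] splits into two pieces whose coboundaries are disjoint, nonempty and
    contained in that of [A]. Both are smaller cuts, hence in the class, and so is their union. *)
Lemma minimal_outside_connected A : minimal_outside I A -> connected_off set0 A.
Proof.
move=> [fA nA mA] U UA U0 Ucl; apply: contrapT => nAU.
pose W := A `&` ~` U.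
have W0 : W !=set0.
  by apply: contrapT => nW; apply: nAU => x Ax; apply: contrapT => nU; apply: nW; exists x.
have [w [Aw nUw]] := W0; have [u Uu] := U0.
have sU : cut_edges U `<=` cut_edges A.
  move=> [v s]; have := UA v; have := UA (R s v); have := Ucl v s id.
  rewrite /cut_edges /set0 /=.
  by have [a|a] := lem (A v); have [b|b] := lem (A (R s v)); tauto.
have sW : cut_edges W `<=` cut_edges A.
  move=> [v s]; have := UA v; have := UA (R s v); have := Ucl v s id.
  rewrite /cut_edges /set0 /W /setI /setC /=.
  by have [a|a] := lem (A v); have [b|b] := lem (A (R s v)); tauto.
have dUW e : cut_edges U e -> cut_edges W e -> False.
  case: e => v s; have := UA v; have := UA (R s v); have := Ucl v s id.
  rewrite /cut_edges /set0 /W /setI /setC /=.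
  by have [a|a] := lem (A v); have [b|b] := lem (A (R s v)); tauto.
have fU : is_cut U := sub_finite_set sU fA.
have fW : is_cut W := sub_finite_set sW fA.
have [eU eUU] : cut_edges U !=set0 by apply: cut_edges_proper => //; exists w.
have [eW eWW] : cut_edges W !=set0 by apply: cut_edges_proper => //; exists u; case.
have IU : I U.
  apply: contrapT => /(mA _ fU); rewrite leqNgt => /negP; apply.
  by apply: (card_set_lt (a := eW)) => //; [exact: sW|move/dUW; exact].
have IW : I W.
  apply: contrapT => /(mA _ fW); rewrite leqNgt => /negP; apply.
  by apply: (card_set_lt (a := eU)) => //; [exact: sU|move=> /(dUW _ eUU)].
apply: nA; have -> : A = U `|` W.
  apply/seteqP; split=> x; rewrite /W /setU /setI /setC /=; have := UA x.
    by have [] := lem (U x); tauto.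
  tauto.
apply: (add_classU addI) => //; apply/seteqP; split=> x //; rewrite /W /setI /setC /=; tauto.
Qed.

Lemma minimal_outside_bond A : minimal_outside I A -> bond A.
Proof.
move=> mA; split; [by case: mA|exact: minimal_outside_connected|].
exact: minimal_outside_connected (minimal_outsideC mA).
Qed.

End AdditiveClass.

End Cuts.

Section Argmin.
Variables (T : Type) (P : T -> Prop) (f : T -> nat).
Lemma exists_argmin : (exists x, P x) -> exists2 x, P x & forall y, P y -> (f x <= f y)%N.
Proof.
case=> x Px; have ex : exists k, `[< exists2 y, P y & f y = k >].
  by exists (f x); apply/asboolP; exists x.
case: (ex_minnP ex) => k /asboolP[y Py fy] mk; exists y => // z Pz.
by rewrite fy; apply: mk; apply/asboolP; exists z.
Qed.
End Argmin.

(** * Uncrossing minimal cuts *)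

Section NestedExtension.
Variables (V : choiceType) (S : finType) (R : S -> V -> V).
Hypothesis graph_connected : forall U : set V, U !=set0 ->
  (forall v s, U v <-> U (R s v)) -> U = setT.
Variable Sym : set (V -> V).
Hypothesis SymR : forall t, Sym t -> forall s v, t (R s v) = R s (t v).
Hypothesis SymV : forall t, Sym t -> exists t', [/\ Sym t', cancel t t' & cancel t' t].
Implicit Types A C D : set V.
Local Notation is_cut := (is_cut R).
Local Notation cut_size := (cut_size R).

Lemma cut_edges_sym t t' A : Sym t -> cancel t t' -> cancel t' t ->
  cut_edges R (t @^-1` A) = (fun e => (t' e.1, e.2)) @` cut_edges R A.
Proof.
move=> st tK tK'; apply/seteqP; split=> [[v s] /=|_ [[v s] /= H <-]].
  rewrite /cut_edges /= SymR // => H; exists (t v, s) => //=; first by rewrite tK.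
by rewrite /cut_edges /= SymR // tK'.
Qed.

Lemma is_cut_sym t A : Sym t -> is_cut A -> is_cut (t @^-1` A).
Proof.
move=> st fA; have [t' [st' tK tK']] := SymV st.
by rewrite /is_cut (cut_edges_sym _ st tK tK'); apply: finite_image.
Qed.

Lemma cut_size_sym t A : Sym t -> is_cut A -> cut_size (t @^-1` A) = cut_size A.
Proof.
move=> st fA; have [t' [st' tK tK']] := SymV st.
rewrite /cut_size (cut_edges_sym _ st tK tK') card_set_image //.
by move=> [a b] [c d] /= [/(can_inj tK') -> ->].
Qed.

Variable I : set V -> Prop.
Hypothesis addI : additive_class R I.
Hypothesis I_sym : forall t A, Sym t -> is_cut A -> I A -> I (t @^-1` A).
Variable E : set (set V).
Hypothesis E_C : forall D, E D -> E (~` D).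
Hypothesis E_sym : forall t D, Sym t -> E D -> E (t @^-1` D).
Hypothesis E_nested : forall D D', E D -> E D' -> ~ cross D D'.
Hypothesis E_old : forall D, E D -> I D /\ exists J, [/\ additive_class R J,
  forall A, J A -> I A & minimal_outside R J D].

Lemma minimal_outside_sym t A : Sym t -> minimal_outside R I A ->
  minimal_outside R I (t @^-1` A).
Proof.
move=> st [fA nA mA]; split; first exact: is_cut_sym.
  move=> It; apply: nA; have [t' [st' tK tK']] := SymV st.
  have <- : t' @^-1` (t @^-1` A) = A by apply/funext => x; rewrite /= /preimage /= tK'.
  exact/I_sym/It/is_cut_sym.
by move=> C fC nC; rewrite cut_size_sym //; apply: mA.
Qed.

(** [A] is also outside the smaller class [J] for which [D] is minimal, so older cuts are never
    larger than newer ones. *)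
Lemma E_bond D A : E D -> minimal_outside R I A ->
  bond R D /\ (cut_size D <= cut_size A)%N.
Proof.
move=> /E_old [_ [J [aJ JI mD]]] [fA nA _]; split.
  exact: minimal_outside_bond mD.
by case: mD => _ _; apply=> // /JI.
Qed.

Definition crossed_by (X : set (set V)) A := X `&` [set D | cross D A].

Lemma finite_crossed_E A A' : minimal_outside R I A -> is_cut A' ->
  finite_set (crossed_by E A').
Proof.
move=> mA fA'; apply: sub_finite_set (finite_crossing_bonds (cut_size A) fA').
by move=> D [ED c]; have [bD sD] := E_bond ED mA; split.
Qed.

Lemma minimal_size A C : minimal_outside R I A -> is_cut C -> ~ I C ->
  (cut_size C <= cut_size A)%N -> minimal_outside R I C.
Proof.
by move=> [fA nA mA] fC nC CA; split=> // B fB nB; apply: leq_trans CA (mA _ _ _).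
Qed.

(* Cutting [A] along a crossing member [D] of [E] removes a crossing and creates none. *)
Lemma uncross_step A D : minimal_outside R I A -> E D -> cross D A ->
  exists2 A', minimal_outside R I A' &
    (card_set (crossed_by E A') < card_set (crossed_by E A))%N.
Proof.
move=> mA ED DA.
have corner X Y : E X -> X = D \/ X = ~` D -> Y = A \/ Y = ~` A ->
    minimal_outside R I (Y `&` X) ->
    (card_set (crossed_by E (Y `&` X)) < card_set (crossed_by E A))%N.
  move=> EX XD YA mYX.
  have cYX : cross Y X.
    by case: XD YA => -> [] ->; rewrite ?crossNl ?crossNr; apply: crossC.
  have cr B : cross B Y -> cross B A by case: YA => ->; rewrite ?crossNr.
  have crD B : cross B X -> cross B D by case: XD => ->; rewrite ?crossNr.
  apply: (@card_set_lt _ _ _ D); first by apply: (finite_crossed_E mA); case: mA.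
  - move=> B [EB cB]; split=> //; apply/cr; apply: contrapT => nB.
    by apply: (not_cross_corner cYX nB _ cB); exact: E_nested.
  - by [].
  - move=> [_]; case: XD => ->; rewrite setIC; first exact: not_cross_subset.
    by move/crossNl; exact: not_cross_subset.
have [ID [J [aJ JI [fD nD mD]]]] := E_old ED.
have [fA nA minA] := mA.
have fA' := is_cutC fA; have fD' := is_cutC fD.
have kD : (cut_size D <= cut_size A)%N by apply: mD => // /JI.
have sA : cut_size (~` A) = cut_size A by rewrite cut_sizeC.
have sD : cut_size (~` D) = cut_size D by rewrite cut_sizeC.
have out X : is_cut X -> I X -> ~ I (A `&` X) -> ~ I (~` A `&` X).
  move=> fX IX H K; apply: H.
  have -> : A `&` X = ~` (~` X `|` (~` A `&` X)).
    rewrite setCU setCK setCI setCK setIUr setICr setU0; exact: setIC.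
  have dis : ~` X `&` (~` A `&` X) = set0 by rewrite setIC -setIA setICr setI0.
  apply: (add_classC addI).
  exact: (add_classU addI (is_cutC fX) (is_cutI fA' fX) dis (add_classC addI IX) K).
(* Both [A] and its complement meet [X] in a set outside [I], of size at least that of [A]. One of
   the two corners in the complement of [X] is outside [J], of size at least that of [D].
   Submodularity then makes the corner opposite to it a minimal cut outside [I]. *)
have main X : is_cut X -> I X -> ~ J (~` X) -> cut_size X = cut_size D ->
   E X -> X = D \/ X = ~` D -> ~ I (A `&` X) ->
   exists2 A', minimal_outside R I A' &
    (card_set (crossed_by E A') < card_set (crossed_by E A))%N.
  move=> fX IX nX sX EX XD o1; have o2 := out X fX IX o1; have fX' := is_cutC fX.
  have fAX := is_cutI fA fX; have fAX' := is_cutI fA' fX.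
  have l1 := minA _ fAX o1; have l2 := minA _ fAX' o2.
  have c1 := cut_size_corners fA fX; have c2 := cut_size_corners fA' fX.
  rewrite setCK in c2.
  have [j|j] := lem (J (A `&` ~` X)).
    have j2 : ~ J (~` A `&` ~` X).
      move=> j2; apply: nX; apply: (add_class_split aJ fX' fA); by rewrite setIC.
    have l3 := mD _ (is_cutI fA' fX') j2.
    exists (A `&` X); last apply: corner => //; try by left.
      by apply: (minimal_size mA) => //; lia.
    by apply: (minimal_size mA) => //; lia.
  have l3 := mD _ (is_cutI fA fX') j.
  exists (~` A `&` X); last apply: corner => //; try by right.
    by apply: (minimal_size mA) => //; lia.
  by apply: (minimal_size mA) => //; lia.
have nD' := add_classNC aJ nD.
have [o|o] := lem (I (A `&` D)); last by apply: (main D) => //; left.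
have [o'|o'] := lem (I (A `&` ~` D)).
  by case: nA; apply: (add_class_split addI fA fD).
apply: (main (~` D)) => //; rewrite ?setCK //; last by right.
- exact: (add_classC addI ID).
- exact: E_C.
Qed.

(** Among the cuts of least size, one that is crossed by the fewest members of [E] is crossed by
    none, by [uncross_step]. *)
Lemma exists_minimal_nested : (exists2 A, is_cut A & ~ I A) ->
  exists2 A, minimal_outside R I A & forall D, E D -> ~ cross D A.
Proof.
move=> [A0 f0 n0].
have [A [fA nA] mA] := @exists_argmin _ (fun A => is_cut A /\ ~ I A) cut_size
  (ex_intro _ A0 (conj f0 n0)).
have mA' : minimal_outside R I A by split=> // C fC nC; apply: mA.
have [C mC minC] := @exists_argmin _ (minimal_outside R I)
  (fun A => card_set (crossed_by E A)) (ex_intro _ A mA').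
exists C => // D ED DC; have [C' mC' lt] := uncross_step mC ED DC.
by have := minC _ mC'; rewrite leqNgt lt.
Qed.

Definition candidates := [set A | minimal_outside R I A /\ forall D, E D -> ~ cross D A].

Lemma candidatesC A : candidates A -> candidates (~` A).
Proof.
move=> [mA nA]; split=> [|D ED]; first exact: minimal_outsideC.
by rewrite crossNr; apply: nA.
Qed.

Lemma candidates_sym t A : Sym t -> candidates A -> candidates (t @^-1` A).
Proof.
move=> st [mA nA]; split=> [|D ED]; first exact: minimal_outside_sym.
have [t' [st' tK tK']] := SymV st.
have -> : D = t @^-1` (t' @^-1` D) by apply/funext => x; rewrite /preimage /= tK.
by move/cross_preimage; apply: nA; apply: E_sym.
Qed.

Lemma finite_crossed_candidates A : is_cut A -> finite_set (crossed_by candidates A).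
Proof.
move=> fA; have [[C cC]|nC] := lem (candidates !=set0); last first.
  by apply: (@sub_finite_set _ _ set0) => // B [cB _]; case: nC; exists B.
apply: sub_finite_set (finite_crossing_bonds (cut_size C) fA) => B [[mB _] c].
split=> //; first exact: minimal_outside_bond mB.
by case: mB => _ _; apply; case: cC => -[].
Qed.

Lemma card_crossed_sym t A : Sym t -> is_cut A ->
  card_set (crossed_by candidates (t @^-1` A)) = card_set (crossed_by candidates A).
Proof.
move=> st fA; have [t' [st' tK tK']] := SymV st.
have ptK B : t @^-1` (t' @^-1` B) = B by apply/funext => x; rewrite /preimage /= tK.
have ptK' B : t' @^-1` (t @^-1` B) = B by apply/funext => x; rewrite /preimage /= tK'.
rewrite -(@card_set_image _ _ (preimage t) (crossed_by candidates A)).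
- congr card_set; apply/seteqP; split=> [B [cB xB]|_ [B [cB xB] <-]].
    exists (t' @^-1` B) => //; split; first exact: candidates_sym.
    by apply: (@cross_preimage _ t); rewrite ptK.
  split; first exact: candidates_sym.
  by apply: (@cross_preimage _ t'); rewrite !ptK'.
- by move=> X Y e; rewrite -(ptK' X) e ptK'.
- exact: finite_crossed_candidates.
Qed.

Lemma crossed_by_compl (X : set (set V)) A : crossed_by X (~` A) = crossed_by X A.
Proof. by apply/seteqP; split=> B [XB /crossNr]. Qed.

(** Both corners are again candidates, and their crossing numbers add up to less than those of [A]
    and [C]: the count is submodular, and strictly so because [C] crosses [A] but neither corner.
    One corner would beat the optimum. *)
Lemma optimal_nested_corner A C : candidates A -> candidates C -> cross A C ->
  (forall B, candidates B ->
     (card_set (crossed_by candidates A) <= card_set (crossed_by candidates B))%N) ->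
  card_set (crossed_by candidates C) = card_set (crossed_by candidates A) ->
  ~ I (A `&` C) -> ~ I (~` A `&` ~` C) -> False.
Proof.
move=> cA cC xAC minA eC o1 o2.
have [[fA nA mA] eA] := cA; have [[fC nC mC] eEC] := cC.
have fA' := is_cutC fA; have fC' := is_cutC fC.
have f1 := is_cutI fA fC; have f2 := is_cutI fA' fC'.
have sAC : cut_size A = cut_size C by apply/eqP; rewrite eqn_leq mA // mC.
have sub := cut_size_corners fA fC.
have l1 := mA _ f1 o1; have l2 := mA _ f2 o2.
have cc1 : candidates (A `&` C).
  split; first by apply: (minimal_size (A := A)) => //; lia.
  by move=> D ED; apply: not_cross_corner => //; [exact: eA|exact: eEC].
have cc2 : candidates (~` A `&` ~` C).
  split; first by apply: (minimal_size (A := A)) => //; lia.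
  move=> D ED; apply: not_cross_corner; rewrite ?crossNl ?crossNr //.
    exact: eA.
  exact: eEC.
have m1 := minA _ cc1; have m2 := minA _ cc2.
have := card_setUI (finite_crossed_candidates f1) (finite_crossed_candidates f2).
have := card_setUI (finite_crossed_candidates fA) (finite_crossed_candidates fC).
have fin : finite_set (crossed_by candidates A `|` crossed_by candidates C).
  by rewrite finite_setU; split; apply: finite_crossed_candidates.
have lI : (card_set (crossed_by candidates (A `&` C) `&`
    crossed_by candidates (~` A `&` ~` C)) <=
    card_set (crossed_by candidates A `&` crossed_by candidates C))%N.
  apply: card_set_le; first exact/finite_setIl/finite_crossed_candidates.
  move=> B [[cB x1] [_ x2]]; split; split=> //; first exact: cross_both_corners x1 x2.
  by apply: (@cross_both_corners _ C A); rewrite setIC.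
have lU : (card_set (crossed_by candidates (A `&` C) `|`
    crossed_by candidates (~` A `&` ~` C)) <
    card_set (crossed_by candidates A `|` crossed_by candidates C))%N.
  apply: (@card_set_lt _ _ _ C) => //.
  - move=> B [[cB x]|[cB x]]; have [xA|xA] := lem (cross B A); try by left.
      right; split=> //; apply: contrapT => xC; exact: (not_cross_corner xAC xA xC x).
    right; split=> //; apply: contrapT => xC; move: x.
    by apply: not_cross_corner; rewrite ?crossNl ?crossNr.
  - by left; split=> //; exact: crossC.
  - case=> -[_]; first by rewrite setIC; exact: not_cross_subset.
    by rewrite setIC => /crossNl; exact: not_cross_subset.
move=> eAC e12; have lt := leq_add lU lI.
by rewrite addSn e12 eAC eC in lt; have := leq_add m1 m2; rewrite leqNgt lt.
Qed.

(** A candidate crossed by the fewest candidates shares this number with its translates. Two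
    crossing translates have an opposite pair of corners outside [I]; complementing one of them if
    necessary reduces to [optimal_nested_corner]. *)
Theorem nested_extension : (exists2 A, is_cut A & ~ I A) ->
  exists A, [/\ minimal_outside R I A, forall D, E D -> ~ cross D A &
    forall t t', Sym t -> Sym t' -> ~ cross (t @^-1` A) (t' @^-1` A)].
Proof.
move=> /exists_minimal_nested [A0 m0 n0].
have [A cA minA] := @exists_argmin _ candidates
  (fun A => card_set (crossed_by candidates A)) (ex_intro _ A0 (conj m0 n0)).
have [mA nA] := cA; exists A; split=> // t t' st st' x.
have [fA oA _] := mA.
have cT u : Sym u -> candidates (u @^-1` A) by move=> su; apply: candidates_sym.
have eT u : Sym u -> card_set (crossed_by candidates (u @^-1` A)) =
    card_set (crossed_by candidates A) by move=> su; apply: card_crossed_sym.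
have [[[f1 o1 _] _] [[f2 o2 _] _]] := (cT t st, cT t' st').
case: (outside_corners addI f1 f2 o1 o2) => -[q1 q2].
  apply: (optimal_nested_corner (cT t st) (cT t' st')) => //; last by rewrite !eT.
  by move=> B cB; rewrite eT //; exact: minA.
apply: (optimal_nested_corner (cT t st) (candidatesC (cT t' st'))) => //.
- exact/crossNr.
- by move=> B cB; rewrite eT //; exact: minA.
- by rewrite crossed_by_compl !eT.
- by rewrite setCK.
Qed.
End NestedExtension.

(** * The structure tree of a nested family *)
Section FiniteSupportSums.
Variable T : choiceType.
Implicit Types f g : T -> int.

Definition supp f := [set x | f x <> 0].
Definition fsum f : int := \sum_(x \in [set: T]) f x.

Lemma fsumE (X : {fset T}) f : supp f `<=` [set` X] -> fsum f = \sum_(x <- X) f x.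
Proof.
move=> sX; apply: fsbigTE => x xX; apply: contrapT => fx.
by move: xX; rewrite (sX x fx).
Qed.

Lemma fsumD f g : finite_set (supp f) -> finite_set (supp g) ->
  fsum (fun x => f x + g x) = fsum f + fsum g.
Proof.
move=> ff fg; have fU : finite_set (supp f `|` supp g) by rewrite finite_setU.
have eU := fset_setK fU.
rewrite !(@fsumE (fset_set (supp f `|` supp g))) ?eU; first exact: big_split.
- by move=> x; right.
- by move=> x; left.
move=> x; rewrite /supp /setU /= => H; apply: contrapT => /not_orP[].
by move=> /contrapT fx /contrapT gx; apply: H; rewrite fx gx.
Qed.

Lemma eq_fsum f g : f =1 g -> fsum f = fsum g.
Proof. by move/funext ->. Qed.

Lemma fsum0 f : (forall x, f x = 0) -> fsum f = 0.
Proof. by move=> f0; apply: fsbig1. Qed.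

Lemma fsumZ c f : fsum (fun x => c * f x) = c * fsum f.
Proof.
have [->|c0] := eqVneq c 0; first by rewrite mul0r fsum0 // => x; rewrite mul0r.
have es : supp (fun x => c * f x) = supp f.
  apply/seteqP; split=> x /= H K; apply: H; first by rewrite K mulr0.
  by apply/eqP; move/eqP: K; rewrite mulf_eq0 (negbTE c0).
have [ff|nf] := lem (finite_set (supp f)).
  have eU := fset_setK ff.
  by rewrite !(@fsumE (fset_set (supp f))) ?eU ?es // mulr_sumr.
rewrite [fsum f]fsbig_dflt ?mulr0; last by rewrite setTI.
by apply: fsbig_dflt; rewrite setTI -[X in infinite_set X]/(supp (fun x => c * f x)) es.
Qed.

Lemma fsumN f : fsum (fun x => - f x) = - fsum f.
Proof. by rewrite -mulN1r -fsumZ; apply: eq_fsum => x; rewrite mulN1r. Qed.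

Lemma fsum1 f a : (forall x, x <> a -> f x = 0) -> fsum f = f a.
Proof.
move=> fa; rewrite (@fsumE [fset a]%fset) ?big_seq_fset1 // => x fx.
by rewrite /= inE; apply/eqP; apply: contrapT => /fa.
Qed.

Lemma supp_finiteD f g : finite_set (supp f) -> finite_set (supp g) ->
  finite_set (supp (fun x => f x + g x)).
Proof.
move=> ff fg; apply: (@sub_finite_set _ _ (supp f `|` supp g)); last by rewrite finite_setU.
move=> x; rewrite /supp /setU /= => H; apply: contrapT => /not_orP[].
by move=> /contrapT fx /contrapT gx; apply: H; rewrite fx gx.
Qed.

Lemma supp_finiteZ c f : finite_set (supp f) -> finite_set (supp (fun x => c * f x)).
Proof. by apply: sub_finite_set => x /= H K; apply: H; rewrite K mulr0. Qed.

End FiniteSupportSums.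

Lemma fsum_reindex (T U : choiceType) (h : T -> U) (f : U -> int) :
  bijective h -> fsum (f \o h) = fsum f.
Proof. by move=> bh; rewrite /fsum (reindex_fsbigT h). Qed.

Lemma fsum_image (T U : choiceType) (h : T -> U) (f : U -> int) :
  injective h -> (forall y, (forall x, y <> h x) -> f y = 0) -> fsum (f \o h) = fsum f.
Proof.
move=> hI f0; rewrite /fsum -(fsbig_image [set: T] h); last by move=> x y _ _ /hI.
apply: fsbig_widen => // y [_ ny] /=; apply: f0 => x e; apply: ny.
by exists x.
Qed.

Definition indic (P : Prop) : int := (`[< P >] : nat)%:Z.

Lemma indicT (P : Prop) : P -> indic P = 1.
Proof. by move=> p; rewrite /indic asboolT. Qed.
Lemma indicF (P : Prop) : ~ P -> indic P = 0.
Proof. by move=> p; rewrite /indic asboolF. Qed.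
Lemma indicN (P : Prop) : indic (~ P) = 1 - indic P.
Proof.
by have [p|p] := lem P; [rewrite (indicT p) indicF // => /(_ p)|rewrite (indicF p) indicT].
Qed.
Lemma indic_iff (P Q : Prop) : (P <-> Q) -> indic P = indic Q.
Proof. by move=> /propext ->. Qed.

Section NestedTree.
Variables (V : choiceType) (E : set (set V)).
Hypothesis E_C : forall D, E D -> E (~` D).
Hypothesis E_nested : forall D D', E D -> E D' -> ~ cross D D'.
Implicit Types (A B D : set V) (a b c : set (set V)).

(* Vertices of the structure tree of [E], as sets of half-spaces. *)
Definition tree_vertex a := [/\ a `<=` E, (forall A, E A -> (a (~` A) <-> ~ a A)) &
  (forall A B, a A -> E B -> A `<=` B -> a B)].

Definition point_vertex (v : V) : set (set V) := [set A | E A /\ A v].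

(** The end inside [A] of the edge formed by [A] and its complement: [A] is a minimal member, since
    a smaller half-space [B] is replaced by its complement. *)
Definition half_vertex A : set (set V) :=
  [set B | E B /\ (A `<=` B \/ (~` B `<=` A /\ ~` B <> A))].

Lemma point_vertexP v : tree_vertex (point_vertex v).
Proof.
split=> [A []//|A EA|A B [EA Av] EB AB]; last by split=> //; apply: AB.
split=> [[_ nA] [_ /nA//]|nA]; split; first exact: E_C.
by move=> Av; apply: nA.
Qed.

Lemma nested_cases A B : E A -> E B ->
  [\/ A `<=` B, B `<=` A, ~` B `<=` A | A `<=` ~` B].
Proof.
move=> EA EB; apply: contrapT => H; apply: (E_nested EA EB); split.
all: apply: contrapT => K; apply: H.
- by apply: Or44 => x Ax Bx; apply: K; exists x.
- by apply: Or41 => x Ax; apply: contrapT => Bx; apply: K; exists x.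
- by apply: Or42 => x Bx; apply: contrapT => Ax; apply: K; exists x.
- by apply: Or43 => x Bx; apply: contrapT => Ax; apply: K; exists x.
Qed.

Lemma setC_inj A B : ~` A = ~` B -> A = B.
Proof. by move=> e; rewrite -(setCK A) e setCK. Qed.

Lemma half_vertexP A : E A -> A !=set0 -> ~` A !=set0 -> tree_vertex (half_vertex A).
Proof.
move=> EA [u Au] [w nAw]; split=> [B []//|B EB|B D [EB hB] ED BD].
  rewrite /half_vertex /= setCK; split=> [[_ h1] [_ h2]|nB].
    case: h1 h2 => [h1|[h1 n1]] [h2|[h2 n2]].
    - by case: (h1 u Au); apply: h2.
    - by case: n2; apply/seteqP; split.
    - by case: n1; apply/seteqP; split.
    - by apply: nAw; have [/h1|/h2] := lem (B w).
  split; first exact: E_C.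
  have [h|h|h|h] := nested_cases EA EB.
  - by case: nB; split=> //; left.
  - by right; split=> // e; apply: nB; split=> //; left; rewrite e.
  - have [e|ne] := lem (~` B = A); first by left; rewrite e.
    by case: nB; split=> //; right.
  - by left.
split=> //; case: hB => [hB|[hB nB]]; first by left=> x /hB/BD.
right; split=> [x nD|e]; first by apply: hB => /BD.
by apply: nB; apply/seteqP; split=> // x; rewrite -e => nD /BD.
Qed.

Lemma half_vertex_flip A B : E B -> B <> A -> B <> ~` A ->
  half_vertex A B <-> half_vertex (~` A) B.
Proof.
move=> EB nA nA'; rewrite /half_vertex /=; split=> -[_ h]; split=> //.
  case: h => [h|[h _]].
    by right; split=> [x nB /h//|/setC_inj].
  by left=> x nAx; apply: contrapT => /h.
case: h => [h|[h _]].
  right; split=> [x nB|e]; first by apply: contrapT => /h.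
  by apply: nA'; rewrite -e setCK.
by left=> x Ax; apply: contrapT => /h.
Qed.

Lemma half_vertex_self A : E A -> half_vertex A A.
Proof. by split=> //; left. Qed.

Lemma exists_minimal_set (X : set (set V)) : finite_set X -> X !=set0 ->
  exists2 A, X A & forall B, X B -> B `<=` A -> B = A.
Proof.
move=> fX X0; have [A XA mA] := exists_argmin
  (fun A => card_set (X `&` [set B | B `<=` A])) X0.
exists A => // B XB BA; apply: contrapT => ne.
have := mA B XB; rewrite leqNgt => /negP; apply.
apply: (@card_set_lt _ _ _ A); first exact: finite_setIl.
- by move=> D [XD DB]; split=> // x /DB/BA.
- by split.
- by move=> [_ AB]; apply: ne; apply/seteqP.
Qed.

(* Every edge of the tree is counted with both orientations, hence the factors 2 below. *)
Definition weight_sum (m : set V -> int) a b : int :=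
  fsum (fun A => m A * (indic (b A) - indic (a A))).

Definition sym_diff a b := (a `\` b) `|` (b `\` a).

Lemma supp_weight m a b : supp (fun A => m A * (indic (b A) - indic (a A))) `<=` sym_diff a b.
Proof.
move=> A; rewrite /supp /sym_diff /setU /setD /= => H; apply: contrapT => K; apply: H.
have [x|x] := lem (a A); have [y|y] := lem (b A); rewrite ?(indicT x) ?(indicF x) ?(indicT y) ?(indicF y).
all: by rewrite ?subrr ?mulr0 //; tauto.
Qed.

Lemma weight_sum_cocycle m a b c :
  finite_set (sym_diff a b) -> finite_set (sym_diff b c) ->
  weight_sum m a c = weight_sum m a b + weight_sum m b c.
Proof.
move=> f1 f2; rewrite -fsumD.
- by apply: eq_fsum => A; rewrite /=; ring.
- exact: sub_finite_set (@supp_weight m a b) f1.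
- exact: sub_finite_set (@supp_weight m b c) f2.
Qed.

Section Telescope.
Variable l : set (set V) -> int.
Hypothesis E_proper : forall A, E A -> A !=set0.

Definition tree_gradient A : int :=
  if `[< E A >] then l (half_vertex A) - l (half_vertex (~` A)) else 0.

Lemma tree_gradientC A : tree_gradient (~` A) = - tree_gradient A.
Proof.
rewrite /tree_gradient; case: asboolP => [EA|nA]; case: asboolP => [EA'|nA'].
- by rewrite setCK opprB.
- by case: nA'; rewrite -(setCK A); apply: E_C.
- by case: nA; apply: E_C.
- by rewrite oppr0.
Qed.

Lemma sym_diff_vertex a b : tree_vertex a -> tree_vertex b ->
  finite_set (b `\` a) -> finite_set (sym_diff a b).
Proof.
move=> [aE aC _] [bE bC _] f; rewrite /sym_diff finite_setU; split=> //.
apply: sub_finite_set (finite_image (fun A => ~` A) f) => A [aA bA] /=.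
have EA := aE A aA; exists (~` A); last by rewrite setCK.
by split; [apply/bC|move/(aC A EA); apply].
Qed.

(** A minimal member [A] of the difference of [b] and [a] is the last edge on the way from [a]: [b]
    is its end [half_vertex A], and the other end is closer to [a]. Crossing this edge contributes
    [tree_gradient A] twice, once for each orientation. *)
Lemma tree_telescope a b : tree_vertex a -> tree_vertex b -> finite_set (b `\` a) ->
  weight_sum tree_gradient a b = 2 * (l b - l a).
Proof.
move=> va; have [k] := ubnP (card_set (b `\` a)); elim: k b => // k IH b.
rewrite ltnS => kb vb fb.
have [X0|nX] := lem ((b `\` a) !=set0); last first.
  have ab : a = b.
    have [aE aC _] := va; have [bE bC _] := vb.
    apply/seteqP; split=> A xA; apply: contrapT => nA; apply: nX; last by exists A.
    have EA := aE A xA; exists (~` A); split; first exact/bC.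
    by move/(aC A EA).
  by rewrite ab subrr mulr0 /weight_sum fsum0 // => A; rewrite subrr mulr0.
have [A [bA aA] mA] := exists_minimal_set fb X0.
have [bE bC bU] := vb; have [aE aC aU] := va; have EA := bE A bA.
have EA' := E_C EA.
have vA : tree_vertex (half_vertex A) by apply: half_vertexP => //; apply: E_proper.
have vA' : tree_vertex (half_vertex (~` A)).
  by apply: half_vertexP => //; rewrite ?setCK; apply: E_proper.
have sub : half_vertex A `<=` b.
  move=> B [EB [AB|[BA nBA]]]; first exact: bU bA EB AB.
  apply: contrapT => nB; apply: nBA; apply: mA => //; split; first exact/bC.
  by move=> aB; apply: aA; apply: aU aB _ _.
have eb : b = half_vertex A.
  apply/seteqP; split=> // B bB; apply: contrapT => nB.
  have [_ hC _] := vA; have EB := bE B bB.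
  have /sub : half_vertex A (~` B) by apply/(hC B EB).
  by move/(bC B EB); apply.
pose b' := half_vertex (~` A).
have nA' : ~ b' A by have [_ /(_ _ EA) h _] := vA'; apply/h/half_vertex_self.
have sb : b' `\` a `<=` b `\` a.
  move=> B [b'B aB]; split=> //; have [EB _] := b'B.
  have [e|ne] := lem (B = A); first by rewrite e.
  rewrite eb; apply/half_vertex_flip => // e; apply: aB; rewrite e.
  exact/aC.
have fb' := sub_finite_set sb fb.
have kb' : (card_set (b' `\` a) < k)%N.
  apply: leq_trans kb; apply: (card_set_lt (a := A)) => //.
  by move=> [].
rewrite (@weight_sum_cocycle _ a b' b).
- rewrite IH //.
  suff -> : weight_sum tree_gradient b' b = 2 * (l b - l b') by ring.
  have nAA : A <> ~` A.
    have [u Au] := E_proper EA; move=> e; have : (~` A) u by rewrite -e.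
    exact.
  have b'A' : b' (~` A) by apply: half_vertex_self.
  have bA' : ~ b (~` A) by move/(bC A EA); apply.
  rewrite /weight_sum (eq_fsum (g := fun B => (if B == A then tree_gradient A else 0) +
    (if B == ~` A then tree_gradient A else 0))); last first.
    move=> B; case: eqP => [->|n1].
      by case: eqP => // _; rewrite indicT // indicF // subr0 mulr1 addr0.
    case: eqP => [->|n2].
      by rewrite (indicF bA') (indicT b'A') tree_gradientC sub0r mulrN1 opprK add0r.
    have [EB|nB] := lem (E B); last by rewrite /tree_gradient asboolF // mul0r addr0.
    rewrite (@indic_iff (b B) (b' B)) ?subrr ?mulr0 ?addr0 //.
    by rewrite eb; apply: half_vertex_flip.
  rewrite fsumD; first last.
  + by apply: sub_finite_set (finite_set1 (~` A)) => B; rewrite /supp /=; case: eqP.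
  + by apply: sub_finite_set (finite_set1 A) => B; rewrite /supp /=; case: eqP.
  rewrite (@fsum1 _ _ A); last by move=> x /eqP/negbTE ->.
  rewrite (@fsum1 _ _ (~` A)); last by move=> x /eqP/negbTE ->.
  by rewrite !eqxx /tree_gradient asboolT // eb -/b'; ring.
- exact: sym_diff_vertex.
- apply: sym_diff_vertex => //.
  apply: (@sub_finite_set _ _ [set A]); last exact: finite_set1.
  move=> B [bB b'B] /=; apply: contrapT => ne; apply: b'B.
  have EB := bE B bB.
  have nBA : B <> ~` A by move=> e; move: bB; rewrite e => /(bC A EA); apply.
  by apply/(half_vertex_flip EB ne nBA); rewrite -eb.
Qed.

End Telescope.
End NestedTree.

(** * Purity of the span of the fluxes of a nested family *)

Section Purity.
Variables (F : groupType) (V : choiceType) (act : F -> V -> V) (v0 : V).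
Hypothesis act1 : forall v, act 1%g v = v.
Hypothesis actM : forall f h v, act (f * h)%g v = act f (act h v).
Implicit Types (A B D : set V) (a b c : set (set V)) (f x : F).

Definition transl f A := act f @^-1` A.

Lemma translM f x A : transl f (transl x A) = transl (x * f)%g A.
Proof. by apply/funext => v; rewrite /transl /preimage /= actM. Qed.

Lemma transl1 A : transl 1%g A = A.
Proof. by apply/funext => v; rewrite /transl /preimage /= act1. Qed.

Lemma translK f : cancel (transl f) (transl f^-1%g).
Proof. by move=> A; rewrite translM mulgV transl1. Qed.

Lemma translKV f : cancel (transl f^-1%g) (transl f).
Proof. by move=> A; rewrite translM mulVg transl1. Qed.

(* The image of the almost invariant set [D] under [H^1(F, Z[F]) -> H^1(F, Z)]. *)
Definition flux D x : int :=
  fsum (fun f => indic (D (act f (act x v0))) - indic (D (act f v0))).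

Variable E : set (set V).
Hypothesis E_C : forall D, E D -> E (~` D).
Hypothesis E_nested : forall D D', E D -> E D' -> ~ cross D D'.
Hypothesis E_proper : forall A, E A -> A !=set0.
Hypothesis E_act : forall f A, E A -> E (transl f A).
Hypothesis E_sep : forall u v, finite_set [set A | [/\ E A, A v & ~ A u]].

Definition tree_weight (m : set V -> int) := [/\ forall A, m (~` A) = - m A,
  forall f A, m (transl f A) = m A & forall A, ~ E A -> m A = 0].

Local Notation base := (point_vertex E v0).
Definition kappa m x := weight_sum m base (point_vertex E (act x v0)).

Definition vtransl x a : set (set V) := [set A | a (transl x A)].

Lemma E_actE f A : E (transl f A) <-> E A.
Proof. by split=> [/(E_act f^-1%g)|/E_act//]; rewrite translK. Qed.

Lemma vtransl_point x v : vtransl x (point_vertex E v) = point_vertex E (act x v).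
Proof. by apply/seteqP; split=> A [EA Av]; split=> //; apply/E_actE; exact: EA. Qed.

Lemma transl_sub f A B : transl f A `<=` transl f B <-> A `<=` B.
Proof.
split=> [h v Av|h v]; last exact: h.
have := h (act f^-1%g v); rewrite /transl /preimage /= -actM mulgV act1; exact.
Qed.

Lemma vtransl_half x A : vtransl x (half_vertex E A) = half_vertex E (transl x^-1%g A).
Proof.
have eq B : (transl x^-1%g A `<=` B) <-> (A `<=` transl x B).
  by rewrite -(transl_sub x) translKV.
have eqC B : (B `<=` transl x^-1%g A) <-> (transl x B `<=` A).
  by rewrite -(transl_sub x) translKV.
apply/seteqP; split=> B [EB h]; (split; first by apply/(E_actE x)).
  case: h => [h|[h n]]; [left; exact/eq|right; split; first exact/(eqC (~` B))].
  by move=> e; apply: n; rewrite -[X in _ = X](translKV x) -e.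
case: h => [h|[h n]]; [left; exact/eq|right; split; first exact/(eqC (~` B))].
by move=> e; apply: n; rewrite -e -[~` transl x B]/(transl x (~` B)) translK.
Qed.

Lemma bij_transl x : bijective (transl x).
Proof. by exists (transl x^-1%g); [exact: translK|exact: translKV]. Qed.

Lemma weight_sum_transl m x a b : tree_weight m ->
  weight_sum m (vtransl x a) (vtransl x b) = weight_sum m a b.
Proof.
move=> [_ mi _]; rewrite /weight_sum -[RHS](fsum_reindex _ (bij_transl x)).
by apply: eq_fsum => A /=; rewrite mi.
Qed.

Lemma sym_diff_vtransl x a b : finite_set (sym_diff a b) ->
  finite_set (sym_diff (vtransl x a) (vtransl x b)).
Proof.
move=> fab; apply: sub_finite_set (finite_image (transl x^-1%g) fab) => A h.
by exists (transl x A); rewrite ?translK.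
Qed.

Lemma sym_diff_points u v : finite_set (sym_diff (point_vertex E u) (point_vertex E v)).
Proof.
apply: sym_diff_vertex => //; try exact: point_vertexP.
by apply: sub_finite_set (E_sep u v) => A [[EA Av] nA]; split=> // Au; apply: nA.
Qed.

Lemma sym_diff_half A : E A -> finite_set (sym_diff base (half_vertex E A)).
Proof.
move=> EA; have [u Au] := E_proper EA; have [w nAw] := E_proper (E_C EA).
apply: sym_diff_vertex => //; first exact: point_vertexP.
  by apply: half_vertexP => //; [exists u|exists w].
apply: (@sub_finite_set _ _ ([set A | [/\ E A, A u & ~ A v0]] `|` [set A | [/\ E A, A w & ~ A v0]])).
  move=> B [[EB h] nB]; have nBv : ~ B v0 by move=> Bv; apply: nB.
  case: h => [h|[h n]]; [left|right]; split=> //; first exact: h.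
  by apply: contrapT => /h.
by rewrite finite_setU; split; exact: E_sep.
Qed.

(* Rounding the potential of [m] down to multiples of [2 * q] keeps it equivariant. *)
Lemma kappa_pure m (h : F -> int) (q : int) : tree_weight m -> 0 < q ->
  (forall x, kappa m x = 2 * q * h x) ->
  exists2 m', tree_weight m' & forall x, kappa m' x = 2 * h x.
Proof.
move=> wm q0 km.
pose l a := (weight_sum m base a %/ (2 * q))%Z.
have q2 : 2 * q != 0 by rewrite mulf_neq0 // gt_eqF.
(* Translation by [x] adds [kappa m x], an exact multiple of [2 * q], so the floor grows by exactly
   [h x]. This constant cancels in differences along edges, which makes the gradient of [l]
   invariant. *)
have lt x a : finite_set (sym_diff base a) -> l (vtransl x a) = l a + h x.
  move=> fa; rewrite /l (@weight_sum_cocycle _ _ _ (vtransl x base)).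
  - rewrite weight_sum_transl // vtransl_point -/(kappa m x) km mulrC divzMDl //.
    exact: addrC.
  - by rewrite vtransl_point; exact: sym_diff_points.
  - exact: sym_diff_vtransl.
exists (tree_gradient E l).
  split=> [A|f A|A nA]; first exact: tree_gradientC.
    rewrite /tree_gradient (asbool_equiv_eq (E_actE f A)); case: asboolP => // EA.
    rewrite -[~` transl f A]/(transl f (~` A)) -[f]invgK -!vtransl_half.
    rewrite (lt _ _ (sym_diff_half EA)) (lt _ _ (sym_diff_half (E_C EA))); ring.
  by rewrite /tree_gradient asboolF.
move=> x; rewrite /kappa tree_telescope //; try exact: point_vertexP.
- rewrite -vtransl_point lt; last exact: sym_diff_points.
  ring.
- have := sym_diff_points v0 (act x v0).
  by apply: sub_finite_set => A; right.
Qed.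

(** The subtraction makes the weight odd under complement; if [D] is a translate of its own
    complement the two orbits coincide and the weight is zero. *)
Definition orbit_weight D A : int :=
  indic (exists f, A = transl f D) - indic (exists f, A = transl f (~` D)).

Lemma orbit_weightP D : E D -> tree_weight (orbit_weight D).
Proof.
move=> ED; split=> [A|f A|A nA]; rewrite /orbit_weight.
- rewrite opprB; congr (_ - _); apply: indic_iff; split=> -[f e]; exists f.
  + by rewrite -(setCK A) e.
  + by rewrite e /transl preimage_setC setCK.
  + by rewrite -(setCK A) e /transl preimage_setC setCK.
  + by rewrite e.
- have H B : (exists g, transl f A = transl g B) <-> (exists g, A = transl g B).
    split=> -[g e]; last by exists (g * f)%g; rewrite e translM.
    by exists (g * f^-1)%g; rewrite -translM -e translK.
  by congr (_ - _); apply: indic_iff.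
- by rewrite !indicF ?subr0 // => -[f e]; apply: nA; rewrite e; apply: E_act => //; apply: E_C.
Qed.

Lemma kappa_supp m x : finite_set (supp (fun A => m A *
  (indic (point_vertex E (act x v0) A) - indic (base A)))).
Proof. exact: sub_finite_set (@supp_weight _ _ _ _) (sym_diff_points _ _). Qed.

Lemma fluxC D x : flux (~` D) x = - flux D x.
Proof.
rewrite /flux -fsumN; apply: eq_fsum => f /=; rewrite !indicN; ring.
Qed.

(** A trivial stabilizer identifies the orbit of [D] with [F] and turns the sum over edges into the
    flux; the orbit of the complement contributes the same again. *)
Lemma kappa_orbit D x : E D -> (forall f, transl f D = D -> f = 1%g) ->
  kappa (orbit_weight D) x = 2 * flux D x.
Proof.
move=> ED st.
have part B : E B -> (forall f, transl f B = B -> f = 1%g) ->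
    fsum (fun A => indic (exists f, A = transl f B) *
      (indic (point_vertex E (act x v0) A) - indic (base A))) = flux B x.
  move=> EB sB; rewrite -(fsum_image (h := fun f => transl f B)).
  - apply: eq_fsum => f /=; rewrite indicT ?mul1r; last by exists f.
    have Ef := E_act f EB.
    by congr (_ - _); apply: indic_iff; split=> [[]|].
  - move=> f g e; apply: divg1_eq; apply: sB.
    by rewrite -translM e translM mulgV transl1.
  - by move=> A nA; rewrite indicF ?mul0r // => -[f]; exact: nA.
have sC f : transl f (~` D) = ~` D -> f = 1%g.
  by move=> e; apply: st; apply: setC_inj; exact: e.
rewrite /kappa /weight_sum (eq_fsum (g := fun A =>
    indic (exists f, A = transl f D) *
      (indic (point_vertex E (act x v0) A) - indic (base A)) +
    -1 * (indic (exists f, A = transl f (~` D)) *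
      (indic (point_vertex E (act x v0) A) - indic (base A))))); last first.
  by move=> A; rewrite /orbit_weight; ring.
rewrite fsumD; [|exact: kappa_supp|exact/supp_finiteZ/kappa_supp].
rewrite fsumZ !part //; last exact: E_C.
by rewrite fluxC; ring.
Qed.

Lemma kappaDZ m1 m2 (c : int) x :
  kappa (fun A => m1 A + c * m2 A) x = kappa m1 x + c * kappa m2 x.
Proof.
rewrite /kappa /weight_sum -fsumZ -fsumD; last 2 first.
- exact: kappa_supp.
- exact/supp_finiteZ/kappa_supp.
by apply: eq_fsum => A; ring.
Qed.

Lemma tree_weightDZ m1 m2 (c : int) : tree_weight m1 -> tree_weight m2 ->
  tree_weight (fun A => m1 A + c * m2 A).
Proof.
move=> [a1 b1 c1] [a2 b2 c2]; split=> [A|f A|A nA].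
- by rewrite a1 a2; ring.
- by rewrite b1 b2.
- by rewrite c1 // c2 // mulr0 addr0.
Qed.

Variable Ds : seq (set V).
Hypothesis Ds_E : forall D, D \in Ds -> E D.
Hypothesis Ds_stab : forall D, D \in Ds -> forall f, transl f D = D -> f = 1%g.

Lemma weight_of_combination (s : seq (set V)) (c : nat -> int) : {subset s <= Ds} ->
  exists2 m, tree_weight m &
  forall x, kappa m x = 2 * \sum_(i < size s) c i * flux (nth set0 s i) x.
Proof.
elim: s c => [|D s IH] c sub.
  exists (fun=> 0); first by split=> // *; rewrite oppr0.
  by move=> x; rewrite big_ord0 mulr0 /kappa /weight_sum fsum0 // => A; rewrite mul0r.
have [y ys|m wm km] := IH (fun i => c i.+1); first by apply: sub; rewrite inE ys orbT.
have Din : D \in Ds by apply: sub; rewrite mem_head.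
exists (fun A => m A + c 0%N * orbit_weight D A).
  exact: tree_weightDZ wm (orbit_weightP (Ds_E Din)).
move=> x; rewrite kappaDZ km kappa_orbit ?big_ord_recl /=; last 2 first.
- exact: Ds_E.
- exact: Ds_stab.
ring.
Qed.

(** Subtracting [m D] times the weight of the orbit of the first [D] leaves a weight supported on
    the other orbits. If [D] is a translate of its complement, oddness gives [m D = 0]. *)
Lemma combination_of_weight (s : seq (set V)) m : {subset s <= Ds} -> tree_weight m ->
  (forall A, m A <> 0 -> exists2 D, D \in s & exists f, A = transl f D \/ A = transl f (~` D)) ->
  exists c : nat -> int,
  forall x, kappa m x = 2 * \sum_(i < size s) c i * flux (nth set0 s i) x.
Proof.
elim: s m => [|D s IH] m sub wm sup.
  exists (fun=> 0) => x; rewrite big_ord0 mulr0 /kappa /weight_sum fsum0 // => A.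
  have [->|/eqP/sup [//]] := eqVneq (m A) 0; exact: mul0r.
have Din : D \in Ds by apply: sub; rewrite mem_head.
have ED := Ds_E Din; have [mC mt _] := wm.
have [y ys||A|c kc] := IH (fun A => m A + - m D * orbit_weight D A).
- by apply: sub; rewrite inE ys orbT.
- exact: tree_weightDZ wm (orbit_weightP ED).
- move=> mA.
  have nA : ~ exists f, A = transl f D \/ A = transl f (~` D).
    move=> [f e]; apply: mA.
    have [_ wt _] := orbit_weightP ED; have [wC _ _] := orbit_weightP ED.
    have self : m D * orbit_weight D D = m D.
      rewrite /orbit_weight (@indicT (exists f, D = transl f D)); last by exists 1%g; rewrite transl1.
      have [[g eg]|ng] := lem (exists f, D = transl f (~` D)); last by rewrite indicF // subr0 mulr1.
      have mm : m D = - m D by rewrite {1}eg mt mC.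
      have m0 : m D = 0 by lia.
      by rewrite m0 mul0r.
    case: e => ->; rewrite ?mt ?wt ?mC ?wC; lia.
  have : m A <> 0.
    move=> m0; apply: mA; rewrite m0 /orbit_weight !indicF ?subrr ?mulr0 ?addr0 //.
      by move=> [f e]; apply: nA; exists f; right.
    by move=> [f e]; apply: nA; exists f; left.
  move=> /sup [B]; rewrite inE => /orP[/eqP->|Bs] fB; first by case: nA.
  by exists B.
exists (fun i => if i is j.+1 then c j else m D) => x.
rewrite big_ord_recl /= mulrDr -kc kappaDZ kappa_orbit //; last exact: Ds_stab.
ring.
Qed.

Hypothesis E_cover : forall A, E A ->
  exists2 D, D \in Ds & exists f, A = transl f D \/ A = transl f (~` D).

(** Combinations of fluxes correspond to invariant weights on the tree, and the division by [q] is
    carried out on the weights by [kappa_pure]. *)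
Theorem flux_pure (h : F -> int) (q : int) (c : nat -> int) : 0 < q ->
  (forall x, q * h x = \sum_(i < size Ds) c i * flux (nth set0 Ds i) x) ->
  exists c' : nat -> int,
    forall x, h x = \sum_(i < size Ds) c' i * flux (nth set0 Ds i) x.
Proof.
move=> q0 qh; have [//|m wm km] := @weight_of_combination Ds c.
have [|m' wm' km'] := @kappa_pure m h q wm q0.
  by move=> x; rewrite km -qh mulrA.
have [//|//||c' kc'] := @combination_of_weight Ds m'.
  move=> A mA; apply: E_cover; apply: contrapT => nA; apply: mA.
  by case: wm' => _ _; apply.
exists c' => x; have := km' x; rewrite kc'; lia.
Qed.

End Purity.

(** * The graph of the extension *)
Section GraphAction.
Variables (p n : nat) (g : 'M[int]_n.+1).
Local Notation F := (free_group n.+1).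
Variables (V : choiceType) (S : finType) (R : S -> V -> V) (act : F -> V -> V) (v0 : V).
Variables (phi psi : F -> F) (w : F) (tau : V -> V).
Hypothesis p_pr : prime p.
Hypothesis gp : g ^+ p = 1.
Hypothesis phiK : cancel phi psi.
Hypothesis psiK : cancel psi phi.
Hypothesis phi_beta : forall h : F -> int, (forall x y, h (x * y)%g = h x + h y) ->
  forall i, h (phi (fgen i)) = \sum_j h (fgen j) * g j i.
Hypothesis act1 : forall v, act 1%g v = v.
Hypothesis actM : forall f h v, act (f * h)%g v = act f (act h v).
Hypothesis act_free : forall f v, act f v = v -> f = 1%g.
Hypothesis actR : forall f s v, act f (R s v) = R s (act f v).
Hypothesis tauR : forall s v, tau (R s v) = R s (tau v).
Hypothesis tau_act : forall f v, tau (act f v) = act (phi f) (tau v).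
Hypothesis tau_p : forall v, iter p tau v = act w v.
Hypothesis graph_connected : forall U : set V, U !=set0 ->
  (forall v s, U v <-> U (R s v)) -> U = setT.
Local Notation is_cut := (is_cut R).
Local Notation transl := (transl act).
Local Notation flux := (flux act v0).
Hypothesis half_space : forall i : 'I_n.+1, exists2 A, is_cut A &
  forall j, flux A (fgen j) = (i == j)%:R.

Implicit Types (A D : set V) (f x y : F).

(** The flux between arbitrary end vertices. It is introduced because translations and [tau] move
    [v0]; [omega_base] shows that the base vertex does not matter. *)
Definition omega D u v : int := fsum (fun f => indic (D (act f v)) - indic (D (act f u))).

(** Along one edge the summand is nonzero only for those [f] that carry the edge into the coboundary
    of [D], finitely many since the action is free. Connectedness reaches every vertex. *)
Lemma omega_supp D u v : is_cut D ->
  finite_set (supp (fun f => indic (D (act f v)) - indic (D (act f u)))).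
Proof.
move=> fD; pose U := [set x | finite_set (supp (fun f => indic (D (act f x)) - indic (D (act f u))))].
suff UT : U = setT by have : U v by rewrite UT.
apply: graph_connected => [|x s].
  exists u; apply: (@sub_finite_set _ _ set0) => // f /=; rewrite /supp /= subrr; exact.
have fe : finite_set (supp (fun f => indic (D (act f (R s x))) - indic (D (act f x)))).
  have inj : {in setT &, injective (fun f => (act f x, s))}.
    move=> f h _ _ [e]; apply: divg1_eq; apply: (act_free (v := act h x)).
    by rewrite -actM divgK.
  have fp := finite_preimage (f := fun f => (act f x, s)) (fun a b _ _ => inj a b (mem_setT a) (mem_setT b)) fD.
  apply: sub_finite_set fp => f; rewrite /supp /= /preimage /cut_edges /= -actR => H.
  have [a|a] := lem (D (act f x)); have [b|b] := lem (D (act f (R s x))).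
  - by case: H; rewrite !indicT // subrr.
  - by left.
  - by right.
  - by case: H; rewrite !indicF // subrr.
split=> Ux.
  by apply: sub_finite_set (supp_finiteD fe Ux) => f; rewrite /supp /= addrA subrK.
apply: sub_finite_set (supp_finiteD (supp_finiteZ (-1) fe) Ux) => f; rewrite /supp /=.
by rewrite mulN1r opprB addrA subrK.
Qed.

Lemma omega_cocycle D u v z : is_cut D -> omega D u z = omega D u v + omega D v z.
Proof.
move=> fD; rewrite -fsumD; try exact: omega_supp.
by apply: eq_fsum => f; ring.
Qed.

Lemma omega_refl D v : omega D v v = 0.
Proof. by apply: fsum0 => f; rewrite subrr. Qed.

Lemma omega_act D y u v : omega D (act y u) (act y v) = omega D u v.
Proof.
rewrite /omega -[RHS](fsum_reindex (h := fun f => (f * y)%g)).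
  by apply: eq_fsum => f /=; rewrite !actM.
by exists (fun f => (f * y^-1)%g) => f; rewrite ?mulgK ?mulgVK.
Qed.

Lemma omega_base D v x : is_cut D -> omega D v (act x v) = flux D x.
Proof.
move=> fD; rewrite (omega_cocycle v v0) // (omega_cocycle v0 (act x v0)) //.
rewrite omega_act addrCA -omega_cocycle // omega_refl addr0.
by apply: eq_fsum => f.
Qed.

Lemma fluxM D x y : is_cut D -> flux D (x * y)%g = flux D x + flux D y.
Proof.
move=> fD; rewrite -!(omega_base v0) // actM (omega_cocycle v0 (act x v0)) //.
by rewrite omega_act.
Qed.

Lemma omega_transl D y u v : omega (transl y D) u v = omega D u v.
Proof.
rewrite /omega -[RHS](fsum_reindex (h := fun f => (y * f)%g)).
  by apply: eq_fsum => f /=; rewrite /transl /preimage /= !actM.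
by exists (fun f => (y^-1 * f)%g) => f; rewrite ?mulKg ?mulVKg.
Qed.

Lemma omega_tau D u v : omega (tau @^-1` D) u v = omega D (tau u) (tau v).
Proof.
rewrite /omega -[RHS](fsum_reindex (h := phi)).
  by apply: eq_fsum => f /=; rewrite /preimage /= !tau_act.
by exists psi.
Qed.

Definition flux_row D : 'rV[int]_n.+1 := \row_i flux D (fgen i).

Lemma flux_rowC D : flux_row (~` D) = - flux_row D.
Proof. by apply/rowP => i; rewrite !mxE fluxC. Qed.

Lemma flux_row0 : flux_row set0 = 0.
Proof. by apply/rowP => i; rewrite !mxE /flux fsum0 // => f; rewrite !indicF. Qed.

Lemma flux_rowU A D : is_cut A -> is_cut D -> A `&` D = set0 ->
  flux_row (A `|` D) = flux_row A + flux_row D.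
Proof.
move=> fA fD AD; apply/rowP => i; rewrite !mxE /flux -fsumD; try exact: omega_supp.
have dis v : ~ (A v /\ D v) by move=> vv; have : (A `&` D) v by []; rewrite AD.
have H v : indic ((A `|` D) v) = indic (A v) + indic (D v).
  have := dis v; rewrite /setU /=.
  have [a|a] := lem (A v); have [d|d] := lem (D v) => nn.
  - by case: nn.
  - by rewrite (indicT a) (indicF d) indicT //; left.
  - by rewrite (indicF a) (indicT d) indicT //; right.
  - by rewrite (indicF a) (indicF d) indicF //; case.
by apply: eq_fsum => f; rewrite !H; ring.
Qed.

(** The group generated by [F] and [tau] in normal form; nonnegative powers of [tau] suffice because
    its [p]-th power lies in [F]. *)
Definition Sym : set (V -> V) :=
  [set t | exists (k : nat) f, forall v, t v = iter k tau (act f v)].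

Lemma iter_tau_act k f v : iter k tau (act f v) = act (iter k phi f) (iter k tau v).
Proof. by elim: k => //= k ->; rewrite tau_act. Qed.

Lemma act_iter_tau k f v : act f (iter k tau v) = iter k tau (act (iter k psi f) v).
Proof.
rewrite iter_tau_act; congr (act _ _).
elim: k f => //= k IH f.
by rewrite -[psi (iter k psi f)]/(iter k.+1 psi f) iterSr -IH psiK.
Qed.

Lemma SymR t : Sym t -> forall s v, t (R s v) = R s (t v).
Proof.
move=> [k [f e]] s v; rewrite !e actR; elim: k {e} => //= k ->.
exact: tauR.
Qed.

Lemma SymM t t' : Sym t -> Sym t' -> Sym (t \o t').
Proof.
move=> [k [f e]] [k' [f' e']]; exists (k + k')%N, (iter k' psi f * f')%g => v /=.
by rewrite e e' act_iter_tau actM iterD.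
Qed.

Lemma Sym_act f : Sym (act f).
Proof. by exists 0%N, f. Qed.

Lemma Sym_iter_tau k : Sym (iter k tau).
Proof. by exists k, 1%g => v; rewrite act1. Qed.

Lemma tau_pk k v : iter (p * k) tau v = act (w ^+ k)%g v.
Proof.
have wtau u : tau (act w u) = act w (tau u) by rewrite -!tau_p -iterSr.
have wtauk m u : iter m tau (act w u) = act w (iter m tau u).
  by elim: m => //= m ->.
elim: k => [|k IH]; first by rewrite muln0 expg0 act1.
rewrite mulnS addnC iterD tau_p wtauk IH -actM; congr act.
by rewrite expgS.
Qed.

Lemma SymV t : Sym t -> exists t', [/\ Sym t', cancel t t' & cancel t' t].
Proof.
move=> [k [f e]].
(* [tau^b tau^k = tau^(p k)] acts as [w^k], so [tau^b] inverts [tau^k] up to [F]. *)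
pose b := (p * k - k)%N.
have bk : (b + k = p * k)%N by rewrite subnK // leq_pmull // prime_gt0.
pose t' := (act f^-1 \o (act (w ^+ k)^-1 \o iter b tau))%g.
have st' : Sym t' by apply: SymM (Sym_act _) (SymM (Sym_act _) (Sym_iter_tau _)).
have tK : cancel t t'.
  move=> v; rewrite /t' /= e -iterD bk tau_pk.
  by rewrite -[in X in act _ X]actM mulVg act1 -actM mulVg act1.
exists t'; split=> // v.
have inj : injective t'.
  move=> x y; rewrite /t' /= => exy.
  have exy' : iter b tau x = iter b tau y.
    have aK h u : act h (act h^-1%g u) = u by rewrite -actM mulgV act1.
    by have := congr1 (act f) exy; rewrite !aK => /(congr1 (act (w ^+ k)%g)); rewrite !aK.
  have := congr1 (iter k tau) exy'; rewrite -!iterD addnC bk !tau_pk => /(congr1 (act (w ^+ k)^-1%g)).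
  by rewrite -!actM mulVg !act1.
by apply: inj; rewrite tK.
Qed.

Lemma preimage_Sym t D : Sym t -> exists k f, t @^-1` D = transl f (iter k tau @^-1` D).
Proof. by move=> [k [f e]]; exists k, f; apply/funext => v; rewrite /preimage /= e. Qed.

Lemma is_cut_Sym t D : Sym t -> is_cut D -> is_cut (t @^-1` D).
Proof. exact: (is_cut_sym SymR SymV). Qed.

Lemma flux_transl f D x : is_cut D -> flux (transl f D) x = flux D x.
Proof.
move=> fD; have fD' := is_cut_Sym (Sym_act f) fD.
by rewrite -(omega_base v0 _ fD') omega_transl omega_base.
Qed.

Lemma flux_tau D x : is_cut D -> flux (tau @^-1` D) x = flux D (phi x).
Proof.
move=> fD; have fD' : is_cut (tau @^-1` D) := is_cut_Sym (Sym_iter_tau 1) fD.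
by rewrite -(omega_base v0 _ fD') omega_tau tau_act omega_base.
Qed.

Lemma flux_row_tau D : is_cut D -> flux_row (tau @^-1` D) = flux_row D *m g.
Proof.
move=> fD; apply/rowP => i; rewrite !mxE flux_tau // phi_beta; last by move=> x y; apply: fluxM.
by apply: eq_bigr => j _; rewrite mxE.
Qed.

Lemma flux_row_iter_tau k D : is_cut D -> flux_row (iter k tau @^-1` D) = flux_row D *m g ^+ k.
Proof.
elim: k D => [|k IH] D fD; first by rewrite expr0 mulmx1.
have -> : iter k.+1 tau @^-1` D = iter k tau @^-1` (tau @^-1` D) by apply/funext => v.
have fD' : is_cut (tau @^-1` D) := is_cut_Sym (Sym_iter_tau 1) fD.
by rewrite IH // flux_row_tau // exprS -mulmxE mulmxA.
Qed.

Lemma flux_row_Sym t D : Sym t -> is_cut D ->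
  exists k, flux_row (t @^-1` D) = flux_row D *m g ^+ k.
Proof.
move=> st fD; have [k [f ->]] := preimage_Sym D st; exists k.
rewrite -flux_row_iter_tau //; apply/rowP => i; rewrite !mxE flux_transl //.
exact: is_cut_Sym (Sym_iter_tau k) fD.
Qed.

(** A stabilizer permutes the finitely many edges of the coboundary. As [F] is torsion-free and acts
    freely, the powers of a nontrivial element would give infinitely many of them. *)
Lemma transl_stab D f : is_cut D -> cut_edges R D !=set0 -> transl f D = D -> f = 1%g.
Proof.
move=> fD [[v s] ev] fDD.
have st k : transl (f ^+ k)%g D = D.
  elim: k => [|k IH]; first by rewrite expg0 transl1.
  by rewrite expgS -(translM actM) fDD.
have inE k : cut_edges R D (act (f ^+ k)%g v, s).
  have sD (u : V) : D (act (f ^+ k)%g u) = D u by rewrite -[in RHS](st k).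
  by move: ev; rewrite /cut_edges /= -actR !sD.
apply: contrapT => f1; have inj : injective (fun k : nat => (act (f ^+ k)%g v, s)).
  have aux (i j : nat) : (i < j)%N -> act (f ^+ i)%g v = act (f ^+ j)%g v -> False.
    move=> ij e; apply: f1; apply: (@fg_torsion_free _ f (j - i)); first by rewrite subn_gt0.
    apply: (act_free (v := act (f ^+ i)%g v)).
    by rewrite -actM -expgnDr subnK ?e // ltnW.
  by move=> i j [e]; case: (ltngtP i j) => // ij; [case: (aux i j)|case: (aux j i)].
apply: infinite_nat; apply: (@sub_finite_set _ _ ((fun k : nat => (act (f ^+ k)%g v, s)) @^-1` cut_edges R D)).
  by move=> k _; apply: inE.
by apply: finite_preimage => // a b _ _; apply: inj.
Qed.

Definition in_lat r (W : 'M[int]_(r, n.+1)) A := rowlat W (flux_row A).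

Lemma in_lat_additive r (W : 'M[int]_(r, n.+1)) : additive_class R (in_lat W).
Proof.
split; rewrite /in_lat.
- by rewrite flux_row0; apply: rowlat0.
- by move=> A IA; rewrite flux_rowC -scaleN1r; apply: rowlatZ.
- by move=> A C fA fC AC IA IC; rewrite flux_rowU //; apply: rowlatD.
Qed.

Lemma in_lat_sym r (W : 'M[int]_(r, n.+1)) t A : submod g (rowlat W) ->
  Sym t -> is_cut A -> in_lat W A -> in_lat W (t @^-1` A).
Proof.
move=> sW st fA IA; have [k e] := flux_row_Sym st fA.
by rewrite /in_lat e -pactXn; apply: subA.
Qed.

(* [W] lists the fluxes of representatives of a nested invariant family each member of which
   was a smallest cut outside the lattice at the time it was added. *)
Definition good r (W : 'M[int]_(r, n.+1)) := submod g (rowlat W) /\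
  exists (E : set (set V)) (Ds : 'I_r -> set V),
  [/\ forall D, E D -> E (~` D),
      forall t D, Sym t -> E D -> E (t @^-1` D),
      forall D D', E D -> E D' -> ~ cross D D',
      forall D, E D -> in_lat W D /\ exists J, [/\ additive_class R J,
        forall A, J A -> in_lat W A & minimal_outside R J D] &
      (forall i, E (Ds i) /\ row i W = flux_row (Ds i)) /\
      forall A, E A -> exists i f, A = transl f (Ds i) \/ A = transl f (~` Ds i)].

Lemma additive_ext (h k : F -> int) : (forall x y, h (x * y)%g = h x + h y) ->
  (forall x y, k (x * y)%g = k x + k y) ->
  (forall i, h (fgen i) = k (fgen i)) -> forall x, h x = k x.
Proof.
move=> hM kM hk x; rewrite -(cls_val x) !addhom_cls //.
by apply: eq_bigr => y _; rewrite hk.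
Qed.

Lemma additive_with_values (v : 'rV[int]_n.+1) : exists h : F -> int,
  (forall x y, h (x * y)%g = h x + h y) /\ forall i, h (fgen i) = v 0 i.
Proof.
have /choice[A HA] : forall i, exists A, is_cut A /\ forall j, flux A (fgen j) = (i == j)%:R.
  by move=> i; have [A fA e] := half_space i; exists A.
exists (fun x => \sum_i v 0 i * flux (A i) x); split=> [x y|i].
  rewrite -big_split; apply: eq_bigr => i _ /=; rewrite fluxM ?mulrDr //.
  by case: (HA i).
rewrite (bigD1 i) //= (HA i).2 eqxx mulr1 big1 ?addr0 // => j ji.
by rewrite (HA j).2 (negbTE ji) mulr0.
Qed.

(** [E] consists of finitely many orbits up to complement, so its members are bonds of bounded size
    and finitely many separate two given vertices; this lets [flux_pure] apply. *)
Lemma good_pure r (W : 'M[int]_(r, n.+1)) : good W -> pure (rowlat W).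
Proof.
move=> [sW [E [Ds [EC Es En Eo [DsE cov]]]]] q v q0 qv.
have Ecut D : E D -> is_cut D by move=> /Eo [_ [J [_ _ []]]].
have Ebond D : E D -> bond R D.
  by move=> /Eo [_ [J [aJ _ mJ]]]; apply: (minimal_outside_bond graph_connected aJ).
have Eprop D : E D -> D !=set0.
  move=> /Eo [_ [J [aJ _ [_ nJ _]]]]; apply: contrapT => D0; apply: nJ.
  have -> : D = set0 by apply/seteqP; split=> x // Dx; apply: D0; exists x.
  exact: (add_class0 aJ).
have Esep (u z : V) : finite_set [set A | [/\ E A, A z & ~ A u]].
  pose K := \max_(i < r) cut_size R (Ds i).
  apply: sub_finite_set (finite_bonds R K z u) => A [EA Az Au]; split=> //; first exact: Ebond.
  have fDi i : is_cut (Ds i) by apply: Ecut; case: (DsE i).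
  have [i [f e]] := cov A EA.
  have <- : cut_size R (Ds i) = cut_size R A.
    case: e => ->; rewrite (cut_size_sym SymR SymV (Sym_act f)) ?cut_sizeC //.
    exact: is_cutC.
  exact: (leq_bigmax i).
have [h [hM hv]] := additive_with_values v.
have [u eu] := qv.
(* [flux_pure] divides by a positive integer, so the sign of [q] goes into the coefficients. *)
pose sgn : int := if 0 < q then 1 else -1.
pose Dl := [seq Ds i | i <- enum 'I_r].
have sDl : size Dl = r by rewrite size_map size_enum_ord.
have nDl (i : 'I_r) : nth set0 Dl i = Ds i.
  by rewrite (nth_map i) ?size_enum_ord // nth_ord_enum.
have sumDl (c : nat -> int) x : \sum_(i < size Dl) c i * flux (nth set0 Dl i) x =
    \sum_(i < r) c i * flux (Ds i) x.
  by rewrite sDl; apply: eq_bigr => i _; rewrite nDl.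
pose c (i : nat) : int := if insub i is Some j then sgn * u 0 j else 0.
have [||||||c' hc'] := @flux_pure F V act v0 act1 actM E EC En Eprop _ Esep Dl _ _ _ h `|q| c.
- by move=> f A; apply: Es; apply: Sym_act.
- by move=> D /mapP[i _ ->]; case: (DsE i).
- move=> D /mapP[i _ ->] f; have [EDi _] := DsE i; apply: transl_stab; first exact: Ecut.
  by apply: (cut_edges_proper graph_connected); [exact: Eprop|exact/Eprop/EC].
- move=> A /cov [i [f e]]; exists (Ds i); last by exists f.
  by apply: map_f; rewrite mem_enum.
- by rewrite normr_gt0.
- move=> x; rewrite sumDl; apply: (additive_ext (h := fun x => `|q| * h x)
    (k := fun x => \sum_(i < r) c i * flux (Ds i) x)) x.
  + by move=> x y; rewrite hM mulrDr.
  + move=> x y; rewrite -big_split; apply: eq_bigr => i _ /=; rewrite fluxM ?mulrDr //.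
    by apply: Ecut; case: (DsE i).
  move=> j; rewrite hv.
  have := congr1 (fun z : 'rV_n.+1 => z 0 j) eu; rewrite mulmx_sum_row summxE mxE => e.
  have -> : `|q| * v 0 j = sgn * (q * v 0 j).
    by rewrite /sgn; case: ltrgtP q0 => // ? _; [rewrite gtr0_norm // mul1r|rewrite ltr0_norm //; ring].
  rewrite e mulr_sumr; apply: eq_bigr => i _; rewrite !mxE /c valK.
  have [_ /rowP /(_ j)] := DsE i; rewrite !mxE => ->.
  exact: mulrA.
exists (\row_i c' i); apply/rowP => j; rewrite -hv hc' sumDl mulmx_sum_row summxE.
apply: eq_bigr => i _; rewrite !mxE.
by have [_ /rowP /(_ j)] := DsE i; rewrite !mxE => ->.
Qed.

Lemma good_next r (W : 'M[int]_(r, n.+1)) : good W -> (exists v, ~ rowlat W v) ->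
  exists2 h, ~ rowlat W h & good (col_mx W (orbit_mx p g h)).
Proof.
move=> [sW [E [Ds [EC Es En Eo [DsE cov]]]]] [v nv].
have aI := in_lat_additive W.
have ex : exists2 A, is_cut A & ~ in_lat W A.
  apply: contrapT => H; apply: nv; rewrite -[v]mulmx1 mulmx_sum_row.
  apply: rowlat_sum => i _; apply: rowlatZ; have [A fA e] := half_space i.
  have -> : row i 1%:M = flux_row A by apply/rowP => j; rewrite !mxE e.
  by apply: contrapT => nA; apply: H; exists A.
have Isym t A : Sym t -> is_cut A -> in_lat W A -> in_lat W (t @^-1` A) by exact: in_lat_sym.
have [A [mA oldA newA]] := nested_extension graph_connected SymR SymV aI Isym EC Es En Eo ex.
have [fA nA _] := mA.
exists (flux_row A) => //; set W' := col_mx _ _.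
have latW' : rowlat W' = add_cyclic g (rowlat W) (flux_row A) by exact: rowlat_orbit.
have subW' B : in_lat W B -> in_lat W' B.
  by rewrite /in_lat latW'; apply: add_cyclic_sub.
split; first by rewrite latW'; apply: add_cyclic_submod.
(* The new members are all translates of [A] under [F] and [tau], with complements; the matrix lists
   only the [p] translates by powers of [tau], because [F] does not change fluxes. *)
pose N := [set B | exists2 t, Sym t & B = t @^-1` A \/ B = ~` (t @^-1` A)].
exists (E `|` N), (fun i => match fintype.split i with inl a => Ds a
   | inr b => iter b tau @^-1` A end).
have NN B C : N B -> N C -> ~ cross B C.
  by move=> [t st eB] [t' st' eC]; case: eB => ->; case: eC => ->; rewrite ?crossNl ?crossNr; apply: newA.
have EN B C : E B -> N C -> ~ cross B C.
  move=> EB [t st eC]; have [t' [st' tK tK']] := SymV st.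
  have nB : ~ cross B (t @^-1` A).
    have -> : B = t @^-1` (t' @^-1` B) by apply/funext => x; rewrite /preimage /= tK.
    by move/cross_preimage; apply: oldA; apply: Es.
  by case: eC => ->; rewrite ?crossNr.
split.
- move=> D [ED|[t st [] ->]]; first by left; apply: EC.
    by right; exists t => //; right.
  by right; exists t => //; left; rewrite setCK.
- move=> t D st [ED|[t' st' e]]; first by left; apply: Es.
  by right; exists (t' \o t); [exact: SymM|case: e => ->; [left|right]].
- move=> D D' [ED|ND] [ED'|ND']; [exact: En|exact: EN| |exact: NN].
  by move/crossC; apply: EN.
- move=> D [/Eo [ID [J [aJ JI mD]]]|[t st e]].
    by split; [exact: subW'|exists J; split=> // B /JI; apply: subW'].
  have mt : minimal_outside R (in_lat W) (t @^-1` A) by exact: (minimal_outside_sym SymR SymV Isym st mA).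
  have It : in_lat W' (t @^-1` A).
    have [k ek] := flux_row_Sym st fA; rewrite /in_lat latW' ek -pactXn.
    by apply: subA; [exact: add_cyclic_submod|exact: add_cyclic_self].
  split; first by case: e => ->; rewrite // /in_lat flux_rowC -scaleN1r; apply: rowlatZ.
  exists (in_lat W); split=> //.
  by case: e => -> //; apply: minimal_outsideC.
split=> [i|B [/cov [i [f e]]|[t st e]]].
- rewrite -(splitK i) unsplitK; case: (fintype.split i) => a /=.
    by have [Ea ea] := DsE a; split; [left|rewrite /W' rowKu ea].
  split; first by right; exists (iter a tau); [exact: Sym_iter_tau|left].
  by rewrite /W' rowKd rowK flux_row_iter_tau.
- by exists (lshift _ i), f; rewrite -[lshift _ i]/(unsplit (inl i)) unsplitK.
have [k [f ef]] := preimage_Sym A st.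
have kp : (k %% p < p)%N by rewrite ltn_mod prime_gt0.
(* Reduce the exponent of [tau] modulo [p]: the full turns become a power of [w], which is moved
   past the remaining power of [tau] by means of [psi]. *)
exists (rshift _ (Ordinal kp)), (iter (k %% p) psi (w ^+ (k %/ p)) * f)%g.
rewrite -[rshift _ _]/(unsplit (inr _)) unsplitK /=.
suff eB : t @^-1` A = transl (iter (k %% p) psi (w ^+ (k %/ p)) * f)%g (iter (k %% p) tau @^-1` A).
  by case: e => ->; [left|right; rewrite eB].
rewrite ef; apply/funext => u; rewrite /transl /preimage /= actM -act_iter_tau.
by rewrite {1}(divn_eq k p) mulnC iterD tau_pk.
Qed.

Theorem standard_of_graph_action : standard_rep p g.
Proof.
apply: (standard_of_family p_pr gp).
have lat0 : rowlat (0 : 'M[int]_(0, n.+1)) = (fun v => v = 0).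
  apply/funext => v; apply/propext; split=> [[u ->]|->]; first by rewrite mulmx0.
  exact: rowlat0.
have good0 : good (0 : 'M[int]_(0, n.+1)).
  split.
    rewrite lat0; split=> // [u v -> ->|v c ->]; first by rewrite addr0.
    exact: pact0l.
  by exists set0, (fun=> set0); split=> //; split=> // -[].
have := std_family_chain p_pr gp good_pure good_next good0 good0.1.
by rewrite lat0 map_mx0 mxrank0.
Qed.

End GraphAction.

(** * Half-spaces of the free group: words with a prescribed first letter *)

Section HalfSpaces.
Variable n : nat.
Local Notation F := (free_group n).
Implicit Types (u r : word n).

(** Each letter of [r] cancels at most one letter at the end of [u], so the first letter of the
    longer word [u] survives. *)
Lemma ohead_pushes u r : reduced u -> reduced r -> (size r < size u)%N ->
  ohead (pushes u r) = ohead u.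
Proof.
elim/last_ind: u r => [//|u z IH] [|y r] ru rr; rewrite size_rcons ltnS => sz.
  by rewrite -reduceE reduce_id.
have [e|ne] := eqVneq y (inv_letter z).
  rewrite -cats1 pushes_cat /= e eqxx IH; last exact: sz.
  - by case: u sz {IH ru}.
  - by case: u ru {IH sz} => // a u; rewrite /reduced /= rcons_path => /andP[].
  - by case: r rr {sz} => // a r /andP[].
have rcat : reduced (rcons u z ++ y :: r).
  by apply: (@reduced_cat _ _ _ z) => // _ _; rewrite last_rcons.
have -> : pushes (rcons u z) (y :: r) = reduce (rcons u z ++ y :: r).
  by rewrite reduce_cat reduce_id.
by rewrite reduce_id //; case: u {IH ru sz rcat}.
Qed.

Lemma fg_ohead (f y : F) : (size (fgval y) < size (fgval f))%N ->
  ohead (fgval (f * y)%g) = ohead (fgval f).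
Proof.
move=> sz; rewrite fg_val_mul reduce_cat (reduce_id (fgP y)).
by apply: ohead_pushes => //; exact: fgP.
Qed.

Lemma finite_ball (B : nat) : finite_set [set f : F | (size (fgval f) <= B)%N].
Proof.
pose T := {m : 'I_B.+1 & m.-tuple (letter n)}.
apply: (@sub_finite_set _ _ ((fun x : T => cls (tval (tagged x))) @` setT)).
  move=> f /= sf; exists (existT (fun m : 'I_B.+1 => m.-tuple (letter n))
    (Ordinal (sf : (size (fgval f) < B.+1)%N)) (in_tuple (fgval f))) => //=.
  exact: cls_val.
exact/finite_image/finite_finset.
Qed.

Definition starts_with (i : 'I_n) (f : F) : Prop := ohead (fgval f) = Some (i, false).

Lemma starts_with_far i (f y : F) : (size (fgval y) < size (fgval f))%N ->
  starts_with i (f * y)%g <-> starts_with i f.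
Proof. by move=> sz; rewrite /starts_with fg_ohead. Qed.

(** Right multiplication by [x_j] changes the first letter only for [f = 1] and [f = x_j^-1], and in
    the second case neither the old nor the new word begins with a positive letter. *)
Lemma starts_with_sum i j :
  fsum (fun f : F => indic (starts_with i (f * fgen j)%g) - indic (starts_with i f)) = (i == j)%:R.
Proof.
rewrite (@fsum1 _ _ 1%g).
  rewrite mul1g (@indicF (starts_with i 1%g)) // subr0.
  have [<-|ne] := eqVneq i j; first by rewrite indicT.
  by rewrite indicF // => -[] e; rewrite e eqxx in ne.
move=> f f1; case Ef: (fgval f) (fgP f) => [|z [|z' t]] rf.
- by case: f1; apply: val_inj; rewrite /= Ef.
- have [e|ne] := eqVneq (j, false) (inv_letter z).
    have -> : (f * fgen j)%g = 1%g.
      apply: val_inj; change (reduce (fgval f ++ [:: (j, false)]) = [::]).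
      by rewrite Ef /reduce /= e eqxx.
    rewrite !indicF ?subrr // /starts_with Ef /= => -[ez].
    by move: e; rewrite ez.
  rewrite (@indic_iff _ (starts_with i f)) ?subrr // /starts_with fg_val_mul Ef.
  by rewrite reduce_id //= andbT.
- by rewrite (indic_iff (starts_with_far _ _)) ?subrr // Ef.
Qed.

End HalfSpaces.

(** * The Cayley graph of the extension *)

Section ConcreteGraph.
Variables (p n : nat).
Local Notation F := (free_group n.+1).
Variables (phi : F -> F) (w : F).
Hypothesis p_pr : prime p.
Hypothesis phiM : {morph phi : x y / (x * y)%g}.
Hypothesis phi_p : forall x, iter p phi x = (w * x * w^-1)%g.
Hypothesis phi_w : phi w = w.

(* [(f, i)] stands for [f t^i] in the extension of Z/p by F where [t] acts by [phi], [t^p = w]. *)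
Definition vertex := (F * 'I_p)%type.
Implicit Types (v : vertex).

Definition sheet0 : 'I_p := Ordinal (prime_gt0 p_pr).

Definition next v : vertex :=
  if insub v.2.+1 is Some j then (v.1, j) else ((v.1 * w)%g, sheet0).

(** Right multiplication by the generators [x_j] and [t]; moving [x_j] to the left of [t^i] applies
    [phi] to it [i] times. *)
Definition step (s : option 'I_n.+1) v : vertex :=
  if s is Some j then ((v.1 * iter v.2 phi (fgen j))%g, v.2) else next v.

Definition left_act (f : F) v : vertex := ((f * v.1)%g, v.2).

(** Left multiplication by [t], in the normal form [f t^i]. *)
Definition shift v : vertex := next (phi v.1, v.2).

Lemma next_small f (i : 'I_p) (ip : (i.+1 < p)%N) : next (f, i) = (f, Ordinal ip).
Proof. by rewrite /next /= insubT. Qed.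

Lemma next_last f (i : 'I_p) : i.+1 = p -> next (f, i) = ((f * w)%g, sheet0).
Proof. by move=> ip; rewrite /next /= insubF // ip ltnn. Qed.

Lemma ord_cases (i : 'I_p) : (i.+1 < p)%N \/ i.+1 = p.
Proof. by have := ltn_ord i; rewrite leq_eqVlt => /orP[/eqP|]; [right|left]. Qed.

Lemma left_act_next f v : left_act f (next v) = next (left_act f v).
Proof.
case: v => h i; rewrite /left_act /=; have [ip|ip] := ord_cases i.
  by rewrite !next_small.
by rewrite !next_last //= mulgA.
Qed.

Lemma left_act_step f s v : left_act f (step s v) = step s (left_act f v).
Proof.
case: s => [j|] /=; first by rewrite /left_act /= mulgA.
exact: left_act_next.
Qed.

(** Left and right multiplication commute in the extension. At the wrap-around from [t^(p-1)] to
    [t^p = w] this rests on [phi_p] for the edges [x_j] and on [phi_w] for the edges [t]. *)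
Lemma shift_step s v : shift (step s v) = step s (shift v).
Proof.
case: v => f i; case: s => [j|]; rewrite /shift /=; have [ip|ip] := ord_cases i.
- by rewrite !next_small /= phiM.
- rewrite !next_last //= phiM -iterS ip phi_p.
  by rewrite !mulgA mulgVK.
- by rewrite (next_small f ip) (next_small (phi f) ip).
- by rewrite (next_last f ip) (next_last (phi f) ip) /= phiM phi_w.
Qed.

Lemma shift_act f v : shift (left_act f v) = left_act (phi f) (shift v).
Proof. by rewrite /shift left_act_next /left_act /= phiM. Qed.

Lemma iter_shift_small k f (i : 'I_p) (ip : (i + k < p)%N) :
  iter k shift (f, i) = (iter k phi f, Ordinal ip).
Proof.
elim: k ip => [|k IH] ip /=; first by congr pair; apply: val_inj; rewrite /= addn0.
have ip' : (i + k < p)%N by rewrite addnS in ip; apply: ltnW.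
rewrite (IH ip') /shift /=.
have lt : ((Ordinal ip').+1 < p)%N by rewrite /= -addnS.
by rewrite (next_small _ lt); congr pair; apply: val_inj; rewrite /= addnS.
Qed.

Lemma iterM k x y : iter k phi (x * y)%g = (iter k phi x * iter k phi y)%g.
Proof. by elim: k => //= k ->; rewrite phiM. Qed.

Lemma iter_w k : iter k phi w = w.
Proof. by elim: k => //= k ->. Qed.

Lemma shift_p v : iter p shift v = left_act w v.
Proof.
case: v => f i; have ip := ltn_ord i.
have e : (p = i + (p - i.+1).+1)%N by lia.
have l1 : (i + (p - i.+1) < p)%N by lia.
rewrite {1}e iterD iterS (iter_shift_small _ l1) /shift /= next_last; last by rewrite /=; lia.
have l2 : (sheet0 + i < p)%N by rewrite add0n.
rewrite (iter_shift_small _ l2) iterM iter_w -iterS -iterD -e phi_p /left_act /=.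
by rewrite mulgVK; congr pair; apply: val_inj.
Qed.

Lemma graph_connected (U : set vertex) : U !=set0 ->
  (forall v s, U v <-> U (step s v)) -> U = setT.
Proof.
move=> [[f i] Ui] cl.
have fwd k h (j : 'I_p) : (j + k < p)%N -> forall jk : (j + k < p)%N, U (h, j) <-> U (h, Ordinal jk).
  elim: k => [|k IH] lt jk.
    by have -> : Ordinal jk = j by apply: val_inj; rewrite /= addn0.
  have lt' : (j + k < p)%N by lia.
  rewrite (IH lt' lt') (cl _ None) /=.
  have l : ((Ordinal lt').+1 < p)%N by rewrite /= -addnS.
  by rewrite (next_small _ l); have -> : Ordinal l = Ordinal jk by apply: val_inj; rewrite /= addnS.
have sheet h (j : 'I_p) : U (h, sheet0) <-> U (h, j).
  have l : (sheet0 + j < p)%N by rewrite add0n.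
  by rewrite (fwd j h sheet0 l l); have -> : Ordinal l = j by apply: val_inj.
have U0 : U (f, sheet0) by apply/(sheet f i).
have all (u : word n.+1) h : U (h, sheet0) -> U ((h * eval_word (@fgen n.+1) u)%g, sheet0).
  elim: u h => [|[j b] u IH] h Uh; first by rewrite /= mulg1.
  rewrite /= mulgA; apply: IH; rewrite /letter_val /=; case: b.
    by apply/(cl _ (Some j)); rewrite /= mulgVK.
  by have /(cl _ (Some j)) := Uh.
apply/seteqP; split=> [//|[h j] _]; apply/sheet.
by have := all (fgval (f^-1 * h)%g) f U0; rewrite eval_fgen mulVKg.
Qed.

Lemma half_space_cut (i : 'I_n.+1) : is_cut step [set v | starts_with i v.1].
Proof.
(* [B] bounds the length of every right multiplier occurring in [step]. From a longer word no edge
   changes the first letter, so the coboundary lies over a finite ball. *)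
pose B := (size (fgval w) + \sum_(k < p) \sum_(j < n.+1) size (fgval (iter k phi (fgen j))))%N.
have fin : finite_set [set e : vertex * option 'I_n.+1 | (size (fgval e.1.1) <= B)%N].
  apply: (@sub_finite_set _ _ (([set f : F | (size (fgval f) <= B)%N] `*` [set: 'I_p])
      `*` [set: option 'I_n.+1])).
    by move=> [[f k] s].
  by apply: finite_setX; [apply: finite_setX; [exact: finite_ball|]|]; exact: finite_finset.
apply: sub_finite_set fin => -[[f k] s] /= ce; rewrite leqNgt; apply/negP => lt.
suff H : starts_with i (step s (f, k)).1 <-> starts_with i f.
  by move: ce; rewrite /cut_edges /=; tauto.
case: s {ce} => [j|] /=.
  apply: starts_with_far; apply: leq_ltn_trans lt.
  rewrite /B (bigD1 k) //= (bigD1 j) //=; lia.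
have [kp|kp] := ord_cases k; first by rewrite next_small.
by rewrite next_last //; apply: starts_with_far; apply: leq_ltn_trans lt; apply: leq_addr.
Qed.

End ConcreteGraph.

(** * The two implications *)

Theorem lift_standard p n (g : 'M[int]_n.+1) : prime p -> mxpow g p = 1%:M ->
  lifts_to_Out (cyc_subgroup g) -> standard_rep p g.
Proof.
move=> p_pr gp [iota [aut [hom [bt _]]]].
have cg : cyc_subgroup g g by exists 1%N; rewrite /mxpow /= mulmx1.
have [w0 inner] := lift_power_inner gp aut hom.
have [w [phi_p phi_w]] := inner_power_fixed (aut _ cg) inner.
have [h [phiK psiK]] := is_aut_cancel (aut _ cg).
pose phi := fg_endo (iota g).
have phiM : {morph phi : x y / (x * y)%g} := fg_endoM (iota g).
have gp' : g ^+ p = 1 by rewrite -mxpowE.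
apply: (@standard_of_graph_action p n g (vertex p n) _ (step phi w p_pr) (@left_act p n)
  (1%g, sheet0 p_pr) phi (fg_endo h) w (shift phi w p_pr)) => //.
- by move=> k kM i; rewrite /phi fg_endo_gen addhom_beta // bt.
- by move=> [x i]; rewrite /left_act mul1g.
- by move=> x y [z i]; rewrite /left_act /= mulgA.
- move=> x [z i] [e]; apply: (@mulIg _ z); by rewrite mul1g.
- by move=> x s v; apply: left_act_step.
- by move=> s v; apply: shift_step.
- by move=> x v; apply: shift_act.
- by move=> v; apply: shift_p.
- by move=> U; apply: graph_connected.
move=> i; eexists; first exact: half_space_cut i.
move=> j; rewrite -starts_with_sum /flux; apply: eq_fsum => x /=.
by rewrite !mulg1.
Qed.

Theorem theorem4 (p n : nat) (g : 'M[int]_n) :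
  prime p -> (0 < n)%N ->
  g \in unitmx -> mxpow g p = 1%:M -> g <> 1%:M ->
  (lifts_to_Out (cyc_subgroup g) <-> standard_rep p g).
Proof.
move=> p_pr; case: n g => // n g _ _ gp g1; split; first exact: lift_standard.
move=> [k [t [e [P [uP PgDP]]]]]; apply: (lifts_of_periodic p_pr gp g1).
exact: periodic_conj uP PgDP (periodic_cast e (periodic_diag t p_pr)).
Qed.
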